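(* Let $V$ be a finite nonempty set with $n=|V|$, let $f:2^V\to\mathbb{Z}$ be an integer valued submodular function with $f(\emptyset)=0$ given by an evaluation oracle, and let $\delta>0$. For a suitable choice of the number of rescalings $T=O(n\log(n\delta^{-1}))$ in the algorithm Rescaling-SFM (described in the context), one can compute from its output (the final $\mu$ and $W$, and the vectors, coefficients and matrices generated) a set $W\subseteq V$ and a point $y\in B(f)$, expressed as a convex combination of $O(n)$ extreme bases of $B(f)$, such that $$f(W)\le y^-(V)+\delta L_f .$$ In particular, $f(W)\le\min_{S\subseteq V}f(S)+\delta L_f$. The overall running time is $O\big((n^4\cdot\mathrm{EO}+n^5)\log(n\delta^{-1})\big)$.
   Context: A function $f:2^V\to\mathbb{R}$ is submodular if $f(X)+f(Y)\ge f(X\cap Y)+f(X\cup Y)$ for all $X,Y\subseteq V$. $\mathrm{EO}$ is the time of one oracle query for $f(S)$; running time counts arithmetic operations on numbers plus $\mathrm{EO}$ per query. For $z\in\mathbb{R}^V$ and $S\subseteq V$, $z(S)=\sum_{v\in S}z(v)$ and $z^-(S)=\sum_{v\in S}\min\{0,z(v)\}$. The base polytope is $B(f)=\{x\in\mathbb{R}^V: x(S)\le f(S)\ \forall S\subseteq V,\ x(V)=f(V)\}$; its vertices are called extreme bases. $L_f=\max\{\|z\|_1:z\in B(f)\}$. For $Q$ symmetric positive definite, $\langle x,y\rangle_Q=x^{\top}Qy$ and $\|x\|_Q=\sqrt{\langle x,x\rangle_Q}$. Arguments of $\log$ are read as at least $2$, and $g/\|g\|_Q$ is read as $0$ if $g=0$.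 Greedy routine. $\mathrm{GreedyMin}(h,w)$, for $h$ submodular with $h(\emptyset)=0$ and $w\in\mathbb{R}^V$: order $V$ so that $w(v_1)\le\dots\le w(v_n)$ and return the point $x$ with $x(v_i)=h(\{v_1,\dots,v_i\})-h(\{v_1,\dots,v_{i-1}\})$; it minimizes $w^{\top}x$ over $B(h)$. $\mathrm{MinSet}(h,w)$ returns a set minimizing $h$ among $\emptyset$ and the prefixes $\{v_1,\dots,v_i\}$, $i=1,\dots,n$, of that ordering. Shifted function. For $\mu\ge\max\{0,-f(V)\}$, $f_\mu(S)=0$ if $S\in\{\emptyset,V\}$ and $f_\mu(S)=f(S)+\mu$ otherwise. Sliding von Neumann$(f,\mu,W,Q,\varepsilon)$, where $f(W)=-\mu$: set $\mu':=\mu$, $W':=W$; pick an arbitrary vertex $g_1$ of $B(f_\mu)$; set $x_1:=1$, $y:=g_1/\|g_1\|_Q$, $k:=2$. While $\|y\|_Q>\varepsilon$: let $g_k:=\mathrm{GreedyMin}(f_{\mu'},Qy)$; if $y^{\top}Qg_k>0$, then set $W':=\mathrm{MinSet}(f_{\mu'},Qy)$, $\theta:=-f_{\mu'}(W')$, then $\mu':=-f(W')$, and, with $v_1,v_n$ the first and last elements of the ordering by increasing $Qy$, set $g_k(v_1):=g_k(v_1)+\theta$, $g_k(v_n):=g_k(v_n)-\theta$; then (in all cases) set $\lambda:=\langle y-g_k/\|g_k\|_Q,\,y\rangle_Q/\|y-g_k/\|g_k\|_Q\|_Q^2$, $y:=(1-\lambda)y+\lambda g_k/\|g_k\|_Q$,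 $x_k:=\lambda$, $x_i:=(1-\lambda)x_i$ for $i<k$, $k:=k+1$. Return $\mu',W'$, the generated vectors $g_1,\dots,g_k$ (re-indexed so that $k$ is their number), $x$, $y$. Rescaling-SFM with $T$ rescalings. Set $\varepsilon:=1/(20n)$, $Q:=R:=I_n$, $\Gamma:=\emptyset$, $\mu:=\max\{0,-f(V)\}$; $W:=V$ if $f(V)<0$, else $W:=\emptyset$. For $i=1,\dots,T$: call Sliding von Neumann$(f,\mu,W,Q,\varepsilon)$ to obtain the new $\mu$ and $W$ and vectors $g_1,\dots,g_k,x,y$; if $y=0$ stop and return $W$; otherwise rescale: $R:=\frac{1}{(1+\varepsilon)^2}\big(R+\sum_{i=1}^k\frac{x_i}{\|g_i\|_Q^2}g_ig_i^{\top}\big)$, $Q:=R^{-1}$, and set $\Gamma:=\Gamma\cup\{g_1,\dots,g_k\}$. Finally return $W$. *)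

(* Defs.v *)
From mathcomp Require Import all_boot all_order all_algebra.
From mathcomp Require Import all_classical all_reals all_analysis.
(* Gives [set0], [set: _] etc. their finite-set meaning back. *)
From mathcomp Require Import finset.

Set Implicit Arguments.
Unset Strict Implicit.
Unset Printing Implicit Defensive.

Import Order.TTheory GRing.Theory Num.Theory.
Local Open Scope ring_scope.

(** * Submodular functions and base polytopes *)

Definition submodular (V : finType) (f : {set V} -> int) : Prop :=
  forall X Y : {set V}, f (X :&: Y) + f (X :|: Y) <= f X + f Y.

Definition base_polytope (R : realType) (V : finType) (f : {set V} -> int) :
    set {ffun V -> R} :=
  [set x | (forall S : {set V}, \sum_(v in S) x v <= (f S)%:~R) /\
           \sum_v x v = (f [set: V]%SET)%:~R]%classic.
Arguments base_polytope R {V} f.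

Definition extreme_point (R : realType) (V : finType) (P : set {ffun V -> R})
    (x : {ffun V -> R}) : Prop :=
  P x /\ forall (a b : {ffun V -> R}) (t : R), P a -> P b -> 0 < t < 1 ->
           x = t *: a + (1 - t) *: b -> a = x /\ b = x.

Definition extreme_base (R : realType) (V : finType) (f : {set V} -> int) :=
  extreme_point (base_polytope R f).

(* For f submodular with f set0 = 0 the polytope is compact and nonempty, so
   this supremum is a maximum. *)
Definition max_l1 (R : realType) (V : finType) (f : {set V} -> int) : R :=
  sup [set \sum_v `|z v| | z in base_polytope R f]%classic.

Definition neg_part (R : realType) (V : finType) (x : {ffun V -> R})
    (S : {set V}) : R :=
  \sum_(v in S) Num.min 0 (x v).

Definition safe_log (R : realType) (x : R) : R := ln (Num.max 2 x).

(** * Real-number programs with an evaluation oracle *)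

(* Numbers live in registers of an append-only memory: a program only handles
   the addresses of numbers, and the values of these numbers can influence its
   control flow only through [Test]. *)
Definition addr := nat.

Inductive instr (V : finType) :=
  | Int of int
  | Add of addr & addr
  | Sub of addr & addr
  | Mul of addr & addr
  | Div of addr & addr
  | Sqrt of addr
  | Query of {set V}.
Arguments Int {V}. Arguments Add {V}. Arguments Sub {V}. Arguments Mul {V}.
Arguments Div {V}. Arguments Sqrt {V}.

(* [Test a b] decides whether the number at [a] is smaller than the one at [b].
   [Flip] is an arbitrary choice; it models the choices an algorithm leaves
   open.  [Iter body x] runs [body] on successive loop states, starting from
   [x], until [body] returns a right injection. *)
Inductive prog (V : finType) : Type -> Type :=
  | Ret (A : Type) : A -> prog V A
  | Bind (A B : Type) : prog V A -> (A -> prog V B) -> prog V B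
  | Iter (S B : Type) : (S -> prog V (S + B)) -> S -> prog V B
  | Do : instr V -> prog V addr
  | Test : addr -> addr -> prog V bool
  | Flip : prog V bool.
Arguments Ret {V A}. Arguments Do {V}. Arguments Test {V}. Arguments Flip {V}.

Declare Scope prog_scope.
Delimit Scope prog_scope with prog.
Bind Scope prog_scope with prog.
Notation "x <- p ;; q" := (Bind p (fun x => q))
  (at level 100, p at level 90, right associativity) : prog_scope.
Notation "' pat <- p ;; q" := (Bind p (fun x => match x with pat => q end))
  (at level 100, pat pattern, p at level 90, right associativity) : prog_scope.
Local Open Scope prog_scope.

Record state (R : realType) := State {
  mem : seq R;
  ops : nat;      (* arithmetic operations and comparisons so far *)
  queries : nat   (* oracle queries so far *)
}.

Definition val_at (R : realType) (s : state R) (a : addr) : R := nth 0 (mem s) a.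

Definition eval (R : realType) (V : finType) (f : {set V} -> int)
    (s : state R) (i : instr V) : R :=
  match i with
  | Int z => z%:~R
  | Add a b => val_at s a + val_at s b
  | Sub a b => val_at s a - val_at s b
  | Mul a b => val_at s a * val_at s b
  | Div a b => val_at s a / val_at s b    (* 0 if the divisor is 0 *)
  | Sqrt a => Num.sqrt (val_at s a)
  | Query X => (f X)%:~R
  end.

Definition exec (R : realType) (V : finType) (f : {set V} -> int)
    (s : state R) (i : instr V) : state R :=
  let m := rcons (mem s) (eval f s i) in
  if i is Query _ then State m (ops s) (queries s).+1
  else State m (ops s).+1 (queries s).

Inductive iter_wp (R : realType) (S B : Type)
    (body : S -> state R -> (S + B -> state R -> Prop) -> Prop)
    (Q : B -> state R -> Prop) : S -> state R -> Prop :=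
  IterStep (x : S) (s : state R) (P : S + B -> state R -> Prop) :
    body x s P ->
    (forall x' s', P (inl x') s' -> iter_wp body Q x' s') ->
    (forall b s', P (inr b) s' -> Q b s') ->
    iter_wp body Q x s.

(* Total correctness: whatever the outcomes of [Flip], the run of [p] from [s]
   with oracle [f] terminates, with a result and a final state satisfying [Q]. *)
Fixpoint wp (R : realType) (V : finType) (f : {set V} -> int) (A : Type)
    (p : prog V A) (s : state R) {struct p} : (A -> state R -> Prop) -> Prop :=
  match p in prog _ A' return (A' -> state R -> Prop) -> Prop with
  | Ret _ a => fun Q => Q a s
  | Bind _ _ p1 k => fun Q => wp f p1 s (fun a s' => wp f (k a) s' Q)
  | Iter _ _ body x =>
      fun Q => iter_wp (fun x' s' Q' => wp f (body x') s' Q') Q x s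
  | Do i => fun Q => Q (size (mem s)) (exec f s i)
  | Test a b =>
      fun Q => Q (val_at s a < val_at s b)
                 (State (mem s) (ops s).+1 (queries s))
  | Flip => fun Q => forall b : bool, Q b s
  end.

Definition time (R : realType) (EO : R) (s : state R) : R :=
  (ops s)%:R + EO * (queries s)%:R.

(** * Lists, vectors and matrices of registers *)

Fixpoint foldM (V : finType) (A B : Type) (F : A -> B -> prog V A) (a : A)
    (s : seq B) : prog V A :=
  if s is b :: s' then (a' <- F a b;; foldM F a' s') else Ret a.

Fixpoint mapM (V : finType) (A B : Type) (F : A -> prog V B) (s : seq A) :
    prog V (seq B) :=
  if s is a :: s' then (b <- F a;; t <- mapM F s';; Ret (b :: t)) else Ret [::].

Definition vec (V : finType) := V -> addr.
Definition mat (V : finType) := V -> V -> addr.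

Definition vec_at (R : realType) (V : finType) (s : state R) (x : vec V) :
    {ffun V -> R} :=
  [ffun v => val_at s (x v)].

Definition upd (V : finType) (A : Type) (x : V -> A) (v : V) (a : A) : V -> A :=
  fun u => if u == v then a else x u.

Definition gen (V : finType) (A : Type) (d : A) (F : V -> prog V A) :
    prog V (V -> A) :=
  foldM (fun x v => a <- F v;; Ret (upd x v a)) (fun=> d) (enum V).

Definition genv (V : finType) (F : V -> prog V addr) : prog V (vec V) :=
  gen 0%N F.

Definition genm (V : finType) (F : V -> V -> prog V addr) : prog V (mat V) :=
  gen (fun=> 0%N) (fun u => genv (F u)).

Definition sumM (V : finType) (A : Type) (F : A -> prog V addr) (s : seq A) :
    prog V addr :=
  z <- Do (Int 0);; foldM (fun acc a => t <- F a;; Do (Add acc t)) z s.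

Definition dot (V : finType) (x y : vec V) : prog V addr :=
  sumM (fun v => Do (Mul (x v) (y v))) (enum V).

Definition mulmv (V : finType) (M : mat V) (x : vec V) : prog V (vec V) :=
  genv (fun v => dot (M v) x).

Definition inner (V : finType) (Q : mat V) (x y : vec V) : prog V addr :=
  Qy <- mulmv Q y;; dot x Qy.

Definition normQ (V : finType) (Q : mat V) (x : vec V) : prog V addr :=
  d <- inner Q x x;; Do (Sqrt d).

(* g / ||g||_Q, which is 0 for g = 0 as division by 0 yields 0. *)
Definition normalize (V : finType) (Q : mat V) (g : vec V) : prog V (vec V) :=
  l <- normQ Q g;; genv (fun v => Do (Div (g v) l)).

Definition is_zero (V : finType) (x : vec V) : prog V bool :=
  z <- Do (Int 0);;
  foldM (fun b v => lt <- Test (x v) z;; gt <- Test z (x v);;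
                    Ret [&& b, ~~ lt & ~~ gt]) true (enum V).

Definition identity (V : finType) : prog V (mat V) :=
  genm (fun u v => Do (Int (u == v)%:R)).

(* Gauss-Jordan inversion in place, valid for positive definite matrices, whose
   pivots are positive: in the system z = M x, the k-th equation is solved for
   x_k, which is then substituted in the others.  After all the steps, the
   matrix expresses x in terms of z. *)
Definition pivot (V : finType) (M : mat V) (k : V) : prog V (mat V) :=
  one <- Do (Int 1);;
  zero <- Do (Int 0);;
  p <- Do (Div one (M k k));;
  genm (fun i j =>
    if i == k then
      if j == k then Ret p
      else (t <- Do (Mul (M k j) p);; Do (Sub zero t))
    else
      if j == k then Do (Mul (M i k) p)
      else (t <- Do (Mul (M k j) p);; t' <- Do (Mul (M i k) t);;
            Do (Sub (M i j) t'))).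

Definition inverse (V : finType) (M : mat V) : prog V (mat V) :=
  foldM (@pivot V) M (enum V).

(** * Greedy routine *)

(* Insertion sort for a comparison procedure. *)
Fixpoint insertM (V : finType) (A : Type) (le : A -> A -> prog V bool) (a : A)
    (s : seq A) : prog V (seq A) :=
  if s is b :: s' then
    c <- le a b;;
    if c then Ret (a :: s) else (t <- insertM le a s';; Ret (b :: t))
  else Ret [:: a].

Definition sortM (V : finType) (A : Type) (le : A -> A -> prog V bool)
    (s : seq A) : prog V (seq A) :=
  foldM (fun t a => insertM le a t) [::] s.

(* Comparison of two numbers in which ties are broken arbitrarily. *)
Definition leM (V : finType) (a b : addr) : prog V bool :=
  lt <- Test a b;;
  if lt then Ret true
  else (gt <- Test b a;; if gt then Ret false else Flip).

(* Any ordering of V by increasing w can result from the choices of ties. *)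
Definition order_by (V : finType) (w : vec V) : prog V (seq V) :=
  sortM (fun u v => leM V (w u) (w v)) (enum V).

Definition any_order (V : finType) : prog V (seq V) :=
  sortM (fun _ _ => Flip) (enum V).

Definition shifted (V : finType) (mu : addr) (S : {set V}) : prog V addr :=
  if (S == set0) || (S == [set: V]) then Do (Int 0)
  else (q <- Do (Query S);; Do (Add q mu)).

Definition greedy (V : finType) (h : {set V} -> prog V addr) (o : seq V) :
    prog V (vec V) :=
  h0 <- h set0;;
  '(_, _, x) <- foldM (fun '(X, hX, x) v =>
      let X' := v |: X in
      hX' <- h X';;
      d <- Do (Sub hX' hX);;
      Ret (X', hX', upd x v d)) (set0, h0, fun=> 0%N) o;;
  Ret x.

Definition prefixes (V : finType) (o : seq V) : seq {set V} :=
  [seq [set:: take i o] | i <- iota 1 (size o)].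

Definition min_set (V : finType) (h : {set V} -> prog V addr) (o : seq V) :
    prog V {set V} :=
  h0 <- h set0;;
  '(X, _) <- foldM (fun '(X, hX) X' =>
      hX' <- h X';;
      c <- leM V hX hX';;
      Ret (if c then (X, hX) else (X', hX'))) (set0, h0) (prefixes o);;
  Ret X.

(** * Sliding von Neumann *)

Record svn_state (V : finType) := SvN {
  svn_mu : addr;
  svn_W : {set V};
  svn_terms : seq (vec V * addr);   (* the pairs (g_i, x_i) *)
  svn_y : vec V
}.

Definition slide (V : finType) (mu : addr) (o : seq V) (g : vec V) :
    prog V (addr * {set V} * vec V) :=
  W <- min_set (shifted mu) o;;
  zero <- Do (Int 0);;
  m <- shifted mu W;;
  theta <- Do (Sub zero m);;
  fW <- Do (Query W);;
  mu' <- Do (Sub zero fW);;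
  if o is v1 :: o' then
    let vn := last v1 o' in
    a <- Do (Add (g v1) theta);;
    let g' := upd g v1 a in
    b <- Do (Sub (g' vn) theta);;
    Ret (mu', W, upd g' vn b)
  else Ret (mu', W, g).

Definition svn_step (V : finType) (Q : mat V) (eps : addr) (st : svn_state V) :
    prog V (svn_state V + svn_state V) :=
  let: SvN mu W terms y := st in
  ny <- normQ Q y;;
  continue <- Test eps ny;;
  if ~~ continue then Ret (inr st) else
  Qy <- mulmv Q y;;
  o <- order_by Qy;;
  g <- greedy (shifted mu) o;;
  zero <- Do (Int 0);;
  c <- inner Q y g;;
  pos <- Test zero c;;
  '(mu', W', g') <- (if pos then slide mu o g else Ret (mu, W, g));;
  h <- normalize Q g';;
  d <- genv (fun v => Do (Sub (y v) (h v)));;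
  num <- inner Q d y;;
  den <- inner Q d d;;
  lambda <- Do (Div num den);;
  one <- Do (Int 1);;
  kappa <- Do (Sub one lambda);;
  y' <- genv (fun v => a <- Do (Mul kappa (y v));; b <- Do (Mul lambda (h v));;
                       Do (Add a b));;
  terms' <- mapM (fun '(gi, xi) => xi' <- Do (Mul kappa xi);; Ret (gi, xi'))
                 terms;;
  Ret (inl (SvN mu' W' (rcons terms' (g', lambda)) y')).

(* The extreme bases of the base polytope of f_mu are exactly the points that
   the greedy routine returns for the orderings of V, whence [any_order]. *)
Definition sliding_von_neumann (V : finType) (mu : addr) (W : {set V})
    (Q : mat V) (eps : addr) : prog V (svn_state V) :=
  o <- any_order V;;
  g1 <- greedy (shifted mu) o;;
  x1 <- Do (Int 1);;
  y <- normalize Q g1;;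
  Iter (svn_step Q eps) (SvN mu W [:: (g1, x1)] y).

(** * Rescaling-SFM *)

(* The call of the Sliding von Neumann routine in one phase: the matrix it was
   given, and the vectors and coefficients it returned. *)
Record phase (V : finType) := Phase {
  ph_Q : mat V;
  ph_terms : seq (vec V * addr);
  ph_y : vec V
}.

Record rsfm_state (V : finType) := RSFM {
  out_mu : addr;
  out_W : {set V};
  out_Q : mat V;
  out_R : mat V;
  out_Gamma : seq (vec V);
  out_phases : seq (phase V)        (* in chronological order *)
}.

(* (1 + eps)^-2 (R + sum_i x_i / ||g_i||_Q^2 g_i g_i^T) *)
Definition rescale (V : finType) (eps : addr) (Q R : mat V)
    (terms : seq (vec V * addr)) : prog V (mat V) :=
  one <- Do (Int 1);;
  e1 <- Do (Add one eps);;
  e2 <- Do (Mul e1 e1);;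
  scale <- Do (Div one e2);;
  weighted <- mapM (fun '(g, x) => n2 <- inner Q g g;; c <- Do (Div x n2);;
                                   Ret (g, c)) terms;;
  genm (fun u v =>
    t <- sumM (fun '(g, c) => a <- Do (Mul (g u) (g v));; Do (Mul c a)) weighted;;
    r <- Do (Add (R u v) t);;
    Do (Mul scale r)).

Fixpoint rsfm_loop (V : finType) (eps : addr) (T : nat) (st : rsfm_state V) :
    prog V (rsfm_state V) :=
  if T is T'.+1 then
    let: RSFM mu W Q R Gamma phases := st in
    '(SvN mu' W' terms y) <- sliding_von_neumann mu W Q eps;;
    let phases' := rcons phases (Phase Q terms y) in
    stop <- is_zero y;;
    if stop then Ret (RSFM mu' W' Q R Gamma phases') else
    R' <- rescale eps Q R terms;;
    Q' <- inverse R';;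
    rsfm_loop eps T' (RSFM mu' W' Q' R' (Gamma ++ unzip1 terms) phases')
  else Ret st.

Definition rescaling_sfm (V : finType) (T : nat) : prog V (rsfm_state V) :=
  one <- Do (Int 1);;
  d <- Do (Int (20 * #|V|)%N);;
  eps <- Do (Div one d);;
  I <- identity V;;
  zero <- Do (Int 0);;
  fV <- Do (Query [set: V]);;
  neg <- Test fV zero;;
  mfV <- Do (Sub zero fV);;
  rsfm_loop eps T (if neg then RSFM mfV [set: V] I I [::] [::]
                   else RSFM zero set0 I I [::] [::]).

(** * Points given as convex combinations of extreme bases *)

Record combination (V : finType) := Combination {
  comb_point : vec V;
  comb_terms : seq (addr * vec V)   (* coefficients and extreme bases *)
}.

Definition is_base_combination (R : realType) (V : finType)
    (f : {set V} -> int) (s : state R) (c : combination V) : Prop :=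
  [/\ base_polytope R f (vec_at s (comb_point c)),
      (forall i : 'I_(size (comb_terms c)),
         let t := tnth (in_tuple (comb_terms c)) i in
         0 <= val_at s t.1 /\ extreme_base f (vec_at s t.2)),
      \sum_(t <- comb_terms c) val_at s t.1 = 1 &
      vec_at s (comb_point c) =
        \sum_(t <- comb_terms c) val_at s t.1 *: vec_at s t.2].

(* Main.v *)
Require Import Defs.
From mathcomp Require Import all_boot all_order all_algebra.
From mathcomp Require Import all_classical all_reals all_analysis.
From mathcomp Require Import ring lra zify.
From mathcomp Require Import finset.

Set Implicit Arguments.
Unset Strict Implicit.
Unset Printing Implicit Defensive.

Import Order.TTheory GRing.Theory Num.Theory.
Local Open Scope ring_scope.

(** Why the theorem holds.

    The algorithm keeps a value mu = - f(W), and all the vectors g that it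
    generates are greedy vectors of shifted functions f_m with m <= mu
    ([vertex]).  Sliding keeps this true: a positive product <Qy, g> exhibits a
    prefix of negative shifted value, and raising mu to the best prefix makes the
    product nonpositive again ([tri_slide], by summation by parts).  As the
    products are nonpositive, the squared norm of y after k steps is at most 1/k
    ([vn_step]), so a phase takes at most 400 n^2 steps.

    A vector g differs from a base h of f only at the two ends of its ordering, by
    - m and by f(V) + m >= 0.  Hence, if a convex combination of vectors g has l1
    norm at most E, the same combination y of the bases h satisfies
    y^-(V) >= - mu - E = f(W) - E ([neg_part_combination]).  It remains to combine
    the vectors g into a vector of l1 norm at most delta L_f.

    If a phase ends with y = 0, its coefficients give the combination.  Otherwise
    each rescaling multiplies the determinant of the matrix R by at least 9/5
    ([det_rescaled], [scale_growth]), and after O(n log (n / delta)) phases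
    Hadamard's inequality provides a diagonal entry R_vv = b^2 that is at least
    max(2, n / delta)^8 ([thin_direction]).  The column u = R e_v has norm b for
    Q = R^-1, while its own entry at v is b^2.  Going back through the phases, one
    can add to u nonnegative multiples of the vectors g of each phase so that its
    norm never exceeds b, even though the matrix of the norm goes back to the
    identity ([pull_back]); the short combination y that ended the phase is what
    makes this possible.  The same holds for - u.  Adding the two results gives a
    nonnegative combination of the vectors g whose entries are at most 2b, whereas
    its total weight is of order b^2 / L_f, because b^2 at the coordinate v had to
    be cancelled ([thin_combination]).

    The certificate is computed along these lines.  The combination involves the
    vectors of all the phases; an incremental version of Caratheodory's theorem
    ([tri_reduce]) leaves at most n of them at the cost of O(n^2) operations per
    vector.  For each of these, an ordering that generates it is recovered by
    growing a chain of tight sets ([tight_extend]), and the greedy routine for f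
    along this ordering returns the base h.  The inequality on f(S) follows from
    y^-(V) <= y(S) <= f(S). *)

(** * Quadratic forms *)

Section QuadraticForms.
Variables (R : realType) (V : finType).
Implicit Types (x y z g : {ffun V -> R}) (A Q : V -> V -> R).

Definition dotp x y : R := \sum_v x v * y v.
Definition app A x : {ffun V -> R} := [ffun v => \sum_u A v u * x u].
Definition qform A x : R := dotp x (app A x).
Definition sym A := forall u v, A u v = A v u.
Definition posdef A := forall x, x != 0 -> 0 < qform A x.
Definition inverse_pair A Q :=
  (forall x, app Q (app A x) = x) /\ (forall x, app A (app Q x) = x).
Definition idm : V -> V -> R := fun u v => (u == v)%:R.

Lemma dotpC x y : dotp x y = dotp y x.
Proof. by apply: eq_bigr => v _; rewrite mulrC. Qed.

Lemma dotpDr x y z : dotp x (y + z) = dotp x y + dotp x z.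
Proof. by rewrite -big_split; apply: eq_bigr => v _; rewrite ffunE mulrDr. Qed.

Lemma dotpZr x c y : dotp x (c *: y) = c * dotp x y.
Proof. by rewrite /dotp mulr_sumr; apply: eq_bigr => v _; rewrite ffunE mulrCA. Qed.

Lemma dotpDl x y z : dotp (x + y) z = dotp x z + dotp y z.
Proof. by rewrite dotpC dotpDr !(dotpC z). Qed.

Lemma dotpZl x c y : dotp (c *: x) y = c * dotp x y.
Proof. by rewrite dotpC dotpZr dotpC. Qed.

Lemma dotp0r x : dotp x 0 = 0.
Proof. by apply: big1 => v _; rewrite ffunE mulr0. Qed.

Lemma dotpNr x y : dotp x (- y) = - dotp x y.
Proof. by rewrite -scaleN1r dotpZr mulN1r. Qed.

Lemma dotpNl x y : dotp (- x) y = - dotp x y.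
Proof. by rewrite dotpC dotpNr dotpC. Qed.

Lemma dotp_sumr (I : Type) (r : seq I) (F : I -> {ffun V -> R}) x :
  dotp x (\sum_(i <- r) F i) = \sum_(i <- r) dotp x (F i).
Proof.
elim: r => [|i r IH]; first by rewrite !big_nil dotp0r.
by rewrite !big_cons dotpDr IH.
Qed.

Lemma appD A x y : app A (x + y) = app A x + app A y.
Proof.
apply/ffunP=> v; rewrite !ffunE -big_split; apply: eq_bigr => u _.
by rewrite ffunE mulrDr.
Qed.

Lemma appZ A c x : app A (c *: x) = c *: app A x.
Proof.
apply/ffunP=> v; rewrite !ffunE -[RHS]/(c * _) mulr_sumr; apply: eq_bigr => u _.
by rewrite ffunE mulrCA.
Qed.

Lemma appN A x : app A (- x) = - app A x.
Proof. by rewrite -scaleN1r appZ scaleN1r. Qed.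

Lemma app0 A : app A 0 = 0.
Proof. by rewrite -[X in app A X](scale0r 0) appZ scale0r. Qed.

Lemma qform0 A : qform A 0 = 0.
Proof. by rewrite /qform app0 dotp0r. Qed.

Lemma app_id x : app idm x = x.
Proof.
apply/ffunP=> v; rewrite ffunE (bigD1 v) //= /idm eqxx mul1r big1 ?addr0 //.
by move=> u /negPf; rewrite eq_sym => ->; rewrite mul0r.
Qed.

Lemma dotp_app A x y : sym A -> dotp (app A x) y = dotp x (app A y).
Proof.
move=> sA; rewrite /dotp; under eq_bigr do rewrite ffunE mulr_suml.
rewrite exchange_big; apply: eq_bigr => u _ /=; rewrite ffunE mulr_sumr.
by apply: eq_bigr => v _; rewrite sA mulrCA mulrA.
Qed.

Lemma qform_ge0 A x : posdef A -> 0 <= qform A x.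
Proof.
move=> pA; have [->|/pA/ltW//] := eqVneq x 0.
by rewrite qform0.
Qed.

Lemma qformZ A c x : qform A (c *: x) = c ^+ 2 * qform A x.
Proof. by rewrite /qform appZ dotpZl dotpZr mulrA. Qed.

Lemma qformN A x : qform A (- x) = qform A x.
Proof. by rewrite -scaleN1r qformZ sqrrN expr1n mul1r. Qed.

Lemma qformD A x y : sym A ->
  qform A (x + y) = qform A x + 2 * dotp x (app A y) + qform A y.
Proof.
move=> sA; rewrite /qform appD dotpDl !dotpDr -(dotp_app y x sA) dotpC.
by rewrite -(dotpC (app A y)); ring.
Qed.

(** The form is nonnegative at q(y) x - <x, y> y. *)
Lemma cauchy_schwarz A x y : sym A -> posdef A ->
  dotp x (app A y) ^+ 2 <= qform A x * qform A y.
Proof.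
move=> sA pA; have [->|y0] := eqVneq y 0.
  by rewrite qform0 app0 dotp0r mulr0 expr0n.
have qy := pA _ y0; set b := dotp x _.
have := qform_ge0 (qform A y *: x + (- b) *: y) pA.
rewrite qformD // !qformZ appZ dotpZl dotpZr -/b.
have -> : qform A y ^+ 2 * qform A x + 2 * (qform A y * (- b * b)) +
  (- b) ^+ 2 * qform A y = qform A y * (qform A x * qform A y - b ^+ 2) by ring.
by rewrite pmulr_rge0 // subr_ge0.
Qed.

(** Minkowski's inequality, squared. *)
Lemma qform_triangle A x y (a b : R) : sym A -> posdef A -> 0 <= a -> 0 <= b ->
  qform A x <= a ^+ 2 -> qform A y <= b ^+ 2 -> qform A (x + y) <= (a + b) ^+ 2.
Proof.
move=> sA pA a0 b0 qx qy; rewrite qformD //.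
have h : dotp x (app A y) <= a * b.
  rewrite (le_trans (ler_norm _)) // -ler_sqr ?nnegrE ?mulr_ge0 //.
  rewrite real_normK ?num_real // exprMn (le_trans (cauchy_schwarz x y sA pA)) //.
  by rewrite ler_pM // qform_ge0.
by rewrite sqrrD; lra.
Qed.

Lemma sym_id : sym idm.
Proof. by move=> u v; rewrite /idm eq_sym. Qed.

Lemma qform_id x : qform idm x = \sum_v x v ^+ 2.
Proof. by rewrite /qform app_id; apply: eq_bigr => v _; rewrite expr2. Qed.

Lemma posdef_id : posdef idm.
Proof.
move=> x x0; rewrite qform_id lt_neqAle sumr_ge0 ?andbT => [|v _]; last exact: sqr_ge0.
apply: contraNneq x0 => /esym /eqP; rewrite psumr_eq0 => [/allP h|v _]; last exact: sqr_ge0.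
apply/eqP/ffunP=> v; rewrite ffunE; apply/eqP; rewrite -sqrf_eq0.
by have := h v (mem_index_enum v).
Qed.

Lemma inverse_pair_id : inverse_pair idm idm.
Proof. by split=> x; rewrite !app_id. Qed.

Section Inverse.
Variables (A Q : V -> V -> R).
Hypotheses (sA : sym A) (pA : posdef A) (AQ : inverse_pair A Q).

Lemma dotp_inverse x y : dotp (app Q x) y = dotp x (app Q y).
Proof. by rewrite -{1}(AQ.2 y) -dotp_app // AQ.2. Qed.

Lemma app_delta B v : app B [ffun u => (u == v)%:R] = [ffun u => B u v].
Proof.
apply/ffunP=> u; rewrite !ffunE (bigD1 v) //= ffunE eqxx mulr1 big1 ?addr0 //.
by move=> w /negPf wv; rewrite ffunE wv mulr0.
Qed.

Lemma dotp_delta x v : dotp x [ffun u => (u == v)%:R] = x v.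
Proof.
rewrite /dotp (bigD1 v) //= ffunE eqxx mulr1 big1 ?addr0 //.
by move=> w /negPf wv; rewrite ffunE wv mulr0.
Qed.

Lemma sym_inverse : sym Q.
Proof.
move=> u v; have := dotp_inverse [ffun w => (w == v)%:R] [ffun w => (w == u)%:R].
by rewrite dotp_delta dotpC !app_delta dotp_delta !ffunE.
Qed.

Lemma posdef_inverse : posdef Q.
Proof.
move=> x x0; rewrite /qform -{1}(AQ.2 x) dotpC; apply: pA.
by apply: contraNneq x0 => Q0; rewrite -(AQ.2 x) Q0 -(scale0r 0) appZ !scale0r.
Qed.

Lemma qform_app_inverse x : qform Q (app A x) = qform A x.
Proof. by rewrite /qform AQ.1 dotpC. Qed.

(** Cauchy-Schwarz for <x, y> = <x, Q (A y)>. *)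
Lemma dotp_dual x y : dotp x y ^+ 2 <= qform Q x * qform A y.
Proof.
rewrite -{1}(AQ.1 y) -(qform_app_inverse y).
exact: cauchy_schwarz sym_inverse posdef_inverse.
Qed.

End Inverse.

Lemma diag_gt0 A v : posdef A -> 0 < A v v.
Proof.
move=> pA; have /pA : [ffun u => (u == v)%:R] != 0 :> {ffun V -> R}.
  by apply/eqP=> /ffunP/(_ v); rewrite !ffunE eqxx => /eqP; rewrite oner_eq0.
by rewrite /qform app_delta dotpC dotp_delta ffunE.
Qed.

Definition rank1 (A : V -> V -> R) (c : R) g : V -> V -> R :=
  fun u v => A u v + c * (g u * g v).

Lemma app_rank1 A c g x : app (rank1 A c g) x = app A x + (c * dotp g x) *: g.
Proof.
apply/ffunP=> v; transitivity (app A x v + (c * dotp g x) * g v); last by rewrite !ffunE.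
rewrite !ffunE /dotp mulr_sumr mulr_suml -big_split.
by apply: eq_bigr => u _; rewrite /= /rank1; ring.
Qed.

Lemma qform_rank1 A c g x : qform (rank1 A c g) x = qform A x + c * dotp g x ^+ 2.
Proof. by rewrite /qform app_rank1 dotpDr dotpZr (dotpC x g); ring. Qed.

Lemma sym_rank1 A c g : sym A -> sym (rank1 A c g).
Proof. by move=> sA u v; rewrite /rank1 sA (mulrC (g u)). Qed.

Lemma posdef_rank1 A c g : 0 <= c -> posdef A -> posdef (rank1 A c g).
Proof.
move=> c0 pA x x0; rewrite qform_rank1 ltr_wpDr ?pA // mulr_ge0 ?sqr_ge0 //.
Qed.

(** The Sherman-Morrison formula. *)
Lemma inverse_rank1 A Q c g : sym A -> posdef A -> inverse_pair A Q -> 0 <= c ->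
  inverse_pair (rank1 A c g)
               (rank1 Q (- (c / (1 + c * qform Q g))) (app Q g)).
Proof.
move=> sA pA AQ c0.
have d0 : 1 + c * qform Q g != 0.
  by rewrite gt_eqF // ltr_wpDr // mulr_ge0 // qform_ge0 //; apply: posdef_inverse AQ.
split=> x; rewrite !app_rank1 appD appZ ?AQ.1 ?AQ.2 -?addrA.
  rewrite dotpDr dotpZr (dotp_inverse sA AQ) AQ.1 (dotp_inverse sA AQ) -/(qform Q g).
  by rewrite -scalerDl [X in X *: _](_ : _ = 0) ?scale0r ?addr0 //; field.
rewrite dotpDr dotpZr -(dotp_inverse sA AQ) -/(qform Q g) -scalerDl.
by rewrite [X in X *: _](_ : _ = 0) ?scale0r ?addr0 //; field.
Qed.

End QuadraticForms.

(** * Determinants *)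

Section Determinant.
Variables (R : realType).

(** Two factorizations of one block matrix. *)
Lemma det_rank1 n (A Q : 'M[R]_n) (u : 'cV_n) (v : 'rV_n) : A *m Q = 1%:M ->
  \det (A + u *m v) = \det A * (1 + (v *m Q *m u) 0 0).
Proof.
move=> AQ.
have e1 : block_mx 1%:M 0 u 1%:M *m block_mx 1%:M (- v) 0 (A + u *m v) =
  block_mx 1%:M (- v) u A.
  rewrite mulmx_block !mul1mx !mul0mx !mulmx1 ?mulmx0 !addr0 mulmxN.
  by rewrite [- _ + _]addrC addrK.
have e2 : block_mx (1%:M + v *m Q *m u) (- v) 0 A *m block_mx 1%:M 0 (Q *m u) 1%:M =
  block_mx 1%:M (- v) u A.
  rewrite mulmx_block !mul0mx !mulmx1 ?mulmx0 !add0r mulNmx -(mulmxA v) addrK.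
  by rewrite mulmxA AQ mul1mx.
have := congr1 determinant e1; rewrite -e2 !det_mulmx !det_lblock !det_ublock.
rewrite !det1 !mul1r !mulr1 => ->; rewrite mulrC; congr (_ * _).
by rewrite det_mx11 !mxE eqxx.
Qed.

Definition mxform n (A : 'M[R]_n) (x : 'cV_n) : R := (x^T *m A *m x) 0 0.

(** Hadamard's inequality, by induction on the dimension through the Schur
    complement of the first diagonal entry. *)
Lemma hadamard n (A : 'M[R]_n) : A^T = A ->
  (forall x, x != 0 -> 0 < mxform A x) -> 0 < \det A <= \prod_i A i i.
Proof.
elim: n A => [|n IH] A sA pA; first by rewrite det_mx00 big_ord0 ltr01 lexx.
pose a := A 0 0; pose B := (A : 'M[R]_(1 + n, 1 + n)).
have aE : ulsubmx B = a%:M.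
  apply/matrixP=> i j; rewrite !mxE !ord1 eqxx mulr1n.
  by congr (A _ _); apply/val_inj.
pose b := dlsubmx B.
have BT : B^T = B by exact: sA.
have bT : ursubmx B = b^T by rewrite /b trmx_dlsub BT.
pose C := drsubmx B.
have BE : B = block_mx a%:M b^T b C by rewrite -aE -bT submxK.
have a0 : 0 < a.
  have := pA (delta_mx 0 0); rewrite /mxform trmx_delta -rowE -colE !mxE.
  apply; apply/negP=> /eqP/matrixP/(_ 0 0)/eqP.
  by rewrite !mxE eqxx oner_eq0.
pose S := C - a^-1 *: (b *m b^T).
have CT : C^T = C by rewrite /C trmx_drsub BT.
have detA : \det A = a * \det S.
  rewrite -[\det A]/(\det B) BE.
  have -> : block_mx a%:M b^T b C =
     block_mx 1%:M 0 (a^-1 *: b) 1%:M *m block_mx a%:M b^T 0 S.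
    rewrite mulmx_block !mul1mx !mul0mx ?mulmx0 !addr0.
    rewrite -scalemxAl mul_mx_scalar scalerA mulVf ?gt_eqF // scale1r.
    by rewrite -scalemxAl /S addrC subrK.
  by rewrite det_mulmx det_lblock !det1 !mul1r det_ublock det_scalar1.
have S_T : S^T = S.
  by rewrite /S linearB /= CT linearZ /= trmx_mul trmxK.
have S_pos x : x != 0 -> 0 < mxform S x.
  move=> x0; pose t := - (a^-1 *: (b^T *m x)).
  have := pA (col_mx t x).
  have -> : mxform A (col_mx t x) = mxform S x.
    rewrite -[LHS]/(((col_mx t x)^T *m B *m col_mx t x) 0 0) BE /mxform tr_col_mx mul_row_block mul_row_col.
    have -> : t^T *m a%:M + x^T *m b = 0.
      rewrite /t linearN linearZ /= trmx_mul trmxK mulNmx mul_mx_scalar scalerA.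
      by rewrite mulfV ?gt_eqF // scale1r addNr.
    rewrite mul0mx add0r /S mulmxBr /t linearN linearZ /= trmx_mul trmxK mulNmx.
    by rewrite -scalemxAl -scalemxAr mulmxA addrC.
  apply; apply: contraNneq x0 => h; apply/eqP/matrixP=> i j.
  have := congr1 (fun M : 'M[R]_(1 + n, 1) => M (rshift 1 i) j) h.
  by rewrite col_mxEd !mxE => ->.
have /andP[S0 Sle] := IH S S_T S_pos.
rewrite detA mulr_gt0 //= big_ord_recl ler_wpM2l ?(ltW a0) //.
have Sii i : 0 < S i i.
  have := S_pos (delta_mx i 0); rewrite /mxform trmx_delta -rowE -colE !mxE; apply.
  apply/negP=> /eqP/matrixP/(_ i 0)/eqP.
  by rewrite !mxE !eqxx oner_eq0.
apply: le_trans Sle _; apply: ler_prod => i _; rewrite ltW //=.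
rewrite /S !mxE big_ord1 !mxE.
have -> : rshift 1 i = lift ord0 i :> 'I_(n.+1) by apply/val_inj.
by rewrite gerBl mulr_ge0 ?invr_ge0 ?(ltW a0) // -expr2 sqr_ge0.
Qed.

Variable V : finType.
Implicit Types (g : {ffun V -> R}) (A Q : V -> V -> R).

Definition tomx A : 'M[R]_#|V| := \matrix_(i, j) A (enum_val i) (enum_val j).
Definition tocv (x : {ffun V -> R}) : 'cV[R]_#|V| := \col_i x (enum_val i).
Definition formdet A : R := \det (tomx A).

Lemma sum_enum_val (F : V -> R) : \sum_(i < #|V|) F (enum_val i) = \sum_v F v.
Proof. by rewrite [RHS](eq_bigl (mem V)) // [RHS]big_enum_val. Qed.

Lemma tomx_app A x : tomx A *m tocv x = tocv (app A x).
Proof.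
apply/matrixP=> i j; rewrite !mxE ffunE -sum_enum_val.
by apply: eq_bigr => k _; rewrite !mxE.
Qed.

Lemma tr_tocv_mul x y : ((tocv x)^T *m tocv y) 0 0 = dotp x y.
Proof.
by rewrite mxE /dotp -sum_enum_val; apply: eq_bigr => k _; rewrite !mxE.
Qed.

Lemma mxform_tomx A x : mxform (tomx A) (tocv x) = qform A x.
Proof. by rewrite /mxform -mulmxA tomx_app tr_tocv_mul. Qed.

Lemma tomx_inverse A Q : inverse_pair A Q -> tomx A *m tomx Q = 1%:M.
Proof.
move=> [_ AQ]; apply/matrixP=> i j; rewrite !mxE.
have /ffunP/(_ (enum_val i)) := AQ [ffun u => (u == enum_val j)%:R].
rewrite app_delta !ffunE (inj_eq enum_val_inj) => <-; rewrite -sum_enum_val.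
by apply: eq_bigr => k _; rewrite !mxE ffunE.
Qed.

Lemma formdet_rank1 A Q c g : inverse_pair A Q ->
  formdet (rank1 A c g) = formdet A * (1 + c * qform Q g).
Proof.
move=> AQ; rewrite /formdet.
have -> : tomx (rank1 A c g) = tomx A + (c *: tocv g) *m (tocv g)^T.
  by apply/matrixP=> i j; rewrite !mxE big_ord1 !mxE /rank1 mulrA.
rewrite (det_rank1 _ _ (tomx_inverse AQ)); congr (_ * (1 + _)).
by rewrite -scalemxAr mxE -/(mxform _ _) mxform_tomx.
Qed.

Lemma hadamardV A : sym A -> posdef A -> 0 < formdet A <= \prod_v A v v.
Proof.
move=> sA pA; have -> : \prod_v A v v = \prod_i (tomx A) i i.
  by rewrite (eq_bigl (mem V)) // big_enum_val; apply: eq_bigr => i _; rewrite mxE.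
apply: hadamard; first by apply/matrixP=> i j; rewrite !mxE sA.
move=> x x0; pose x' : {ffun V -> R} := [ffun v => x (enum_rank v) 0].
have -> : x = tocv x'.
  by apply/matrixP=> i j; rewrite !mxE ffunE enum_valK ord1.
rewrite mxform_tomx; apply: pA; apply: contraNneq x0 => /ffunP h.
apply/eqP/matrixP=> i j; have := h (enum_val i).
by rewrite !ffunE enum_valK ord1 mxE.
Qed.

Lemma formdetZ (c : R) A : formdet (fun u v => c * A u v) = c ^+ #|V| * formdet A.
Proof.
rewrite /formdet -detZ; congr (\det _); by apply/matrixP=> i j; rewrite !mxE.
Qed.

Lemma formdet_id : formdet (idm R (V := V)) = 1.
Proof.
rewrite /formdet -(det1 R #|V|); congr (\det _); apply/matrixP=> i j.
by rewrite !mxE /idm (inj_eq enum_val_inj).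
Qed.

(** A single rank-one update leaves each remaining quadratic term at least as
    large once it is multiplied by the factor that the determinant gains; this is
    where the Cauchy-Schwarz inequality enters. *)
Lemma formdet_growth A Q (ws : seq ({ffun V -> R} * R)) :
  sym A -> posdef A -> inverse_pair A Q ->
  (forall w, w \in ws -> 0 <= w.2) ->
  formdet A * (1 + \sum_(w <- ws) w.2 * qform Q w.1) <=
  formdet (foldl (fun B w => rank1 B w.2 w.1) A ws).
Proof.
elim: ws A Q => [|[g c] ws IH] A Q sA pA AQ ws0.
  by rewrite big_nil addr0 mulr1.
have c0 : 0 <= c by apply: (ws0 (g, c)); rewrite mem_head.
have sQ := sym_inverse sA AQ; have pQ := posdef_inverse pA AQ.
set B := rank1 A c g; have AQ' := inverse_rank1 g sA pA AQ c0.
set Q' := rank1 Q _ _ in AQ'.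
have := IH B Q' (sym_rank1 _ _ sA) (posdef_rank1 _ c0 pA) AQ'.
have h w : w \in ws -> 0 <= w.2 by move=> wi; apply: ws0; rewrite inE wi orbT.
move/(_ h); apply: le_trans; rewrite (formdet_rank1 _ _ AQ) -mulrA.
have /andP[dA _] := hadamardV sA pA.
rewrite ler_pM2l // big_cons /= mulrDr mulr1 addrA lerD2l mulr_sumr.
rewrite [X in X <= _]big_seq_cond [X in _ <= X]big_seq_cond; apply: ler_sum => -[g' c'].
rewrite andbT => /h /= c'0.
have d0 : 0 < 1 + c * qform Q g by rewrite ltr_wpDr // mulr_ge0 // qform_ge0.
rewrite mulrCA ler_wpM2l // /Q' qform_rank1 (dotp_inverse sA AQ).
set b := dotp g _; have bE : b ^+ 2 <= qform Q g * qform Q g' by exact: cauchy_schwarz.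
have -> : (1 + c * qform Q g) * (qform Q g' + - (c / (1 + c * qform Q g)) * b ^+ 2) =
  qform Q g' + c * (qform Q g * qform Q g' - b ^+ 2) by field; rewrite gt_eqF.
by rewrite lerDl mulr_ge0 // subr_ge0.
Qed.

End Determinant.

(** * Submodular functions and greedy vectors *)

Section Greedy.
Variables (R : realType) (V : finType).
Implicit Types (h : {set V} -> R) (g : {ffun V -> R}) (o p q : seq V).

Definition submod h := forall X Y, h (X :&: Y) + h (X :|: Y) <= h X + h Y.
Definition ordering o := uniq o /\ forall v, v \in o.

(** The greedy vector of [h] for the ordering [o] is the only vector that is
    tight at all the prefixes of [o]. *)
Definition tight h g o :=
  forall p q, o = p ++ q -> \sum_(v <- p) g v = h [set:: p].

Lemma set_rcons p v : [set:: rcons p v] = v |: [set:: p].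
Proof. by apply/setP=> u; rewrite !inE mem_rcons inE. Qed.

Lemma ordering_set o : ordering o -> [set:: o] = [set: V].
Proof. by move=> [_ oV]; apply/setP=> u; rewrite !inE oV. Qed.

Lemma sum_prefix_uniq p (F : V -> R) : uniq p ->
  \sum_(v <- p) F v = \sum_(v in [set:: p]) F v.
Proof.
move=> up; rewrite -[RHS]big_filter; apply: perm_big.
apply: uniq_perm; rewrite ?filter_uniq ?index_enum_uniq // => v.
by rewrite mem_filter mem_index_enum andbT inE.
Qed.

Lemma sum_ordering o (F : V -> R) : ordering o -> \sum_(v <- o) F v = \sum_v F v.
Proof.
move=> oo; rewrite sum_prefix_uniq ?oo.1 // ordering_set //.
by apply: eq_bigl => v; rewrite inE.
Qed.

Lemma tight_sum h g o : ordering o -> tight h g o -> \sum_v g v = h [set: V].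
Proof.
by move=> oo /(_ o [::]); rewrite cats0 -(ordering_set oo) sum_ordering // => ->.
Qed.

Lemma tight_uniq h g g' o : ordering o -> tight h g o -> tight h g' o -> g = g'.
Proof.
move=> [_ oV] t t'; apply/ffunP=> v.
have /splitPr eo : v \in o by [].
case: eo t t' => p q t t'.
have /eqP := t (rcons p v) q (esym (cat_rcons _ _ _)).
rewrite -(t' (rcons p v) q (esym (cat_rcons _ _ _))) !big_rcons /=.
by rewrite (t p (v :: q)) // (t' p (v :: q)) // => /eqP/addrI.
Qed.

(** Along an ordering that increases with [w], summation by parts writes
    <w, g> as a combination with nonpositive coefficients of the values of [h]
    at the proper prefixes. *)
Lemma greedy_abel h g (w : V -> R) o : tight h g o ->
  sorted (fun u v => w u <= w v) o -> h set0 = 0 ->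
  (forall p q, o = p ++ q -> 0 <= h [set:: p]) ->
  forall v0, \sum_(v <- o) w v * g v <= w (last v0 o) * h [set:: o].
Proof.
move=> t + h0 hp v0.
suff H p q : o = p ++ q -> sorted (fun u v => w u <= w v) p ->
    \sum_(v <- p) w v * g v <= w (last v0 p) * h [set:: p].
  by apply: (H o [::]); rewrite cats0.
elim/last_ind: p q => [|p v IH] q oE.
  by rewrite big_nil set_nil h0 mulr0.
have oE' : o = p ++ v :: q by rewrite oE cat_rcons.
have gv : g v = h [set:: rcons p v] - h [set:: p].
  by rewrite -(t _ _ oE) -(t _ _ oE') big_rcons /= addrAC subrr add0r.
rewrite big_rcons /= last_rcons gv.
case: p IH oE oE' gv => [|u p] IH oE oE' gv s.
  by rewrite big_nil set_nil h0 add0r subr0.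
have /IH/(_ _) := oE'; move: s; rewrite rcons_cons /= rcons_path => /andP[s lw].
move/(_ s); have := hp _ _ oE'; set H := h [set:: u :: p]; rewrite mulrBr.
move=> H0 le1; apply: (@le_trans _ _ (w (last u p) * H + (w v * h [set:: rcons (u :: p) v] - w v * H))).
  by rewrite lerD2r.
by rewrite addrCA gerDl subr_le0 ler_wpM2r.
Qed.

(** Along the ordering, the gain g(v) = h(P + v) - h(P) at a prefix P is at most
    the gain of [v] at the smaller set S :&: P. *)
Lemma greedy_le h g o (S : {set V}) : submod h -> h set0 = 0 -> ordering o ->
  tight h g o -> \sum_(v in S) g v <= h S.
Proof.
move=> sm h0 [uo oV] t.
suff H p q : o = p ++ q -> \sum_(v <- p | v \in S) g v <= h (S :&: [set:: p]).
  have := H o [::] (esym (cats0 o)); rewrite (ordering_set (conj uo oV)) setIT.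
  rewrite -big_filter sum_prefix_uniq ?filter_uniq //; apply: le_trans.
  rewrite [X in _ <= X](eq_bigl (mem S)) // => v.
  by rewrite inE mem_filter oV andbT.
elim/last_ind: p q => [|p v IH] q oE.
  by rewrite big_nil set_nil setI0 h0.
have oE' : o = p ++ v :: q by rewrite oE cat_rcons.
have gv : g v = h [set:: rcons p v] - h [set:: p].
  by rewrite -(t _ _ oE) -(t _ _ oE') big_rcons /= addrAC subrr add0r.
have -> : \sum_(u <- rcons p v | u \in S) g u =
  \sum_(u <- p | u \in S) g u + (if v \in S then g v else 0).
  by rewrite -cats1 big_cat big_mkcond /= [X in _ + X]big_mkcond big_seq1 -big_mkcond.
rewrite set_rcons.
have [vS|vS] := boolP (v \in S); last first.
  have -> : S :&: (v |: [set:: p]) = S :&: [set:: p]; last by rewrite addr0; apply: IH oE'.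
  apply/setP=> u; rewrite !inE; case: eqP => [->|//].
  by rewrite (negPf vS).
have := sm (S :&: (v |: [set:: p])) [set:: p].
have -> : S :&: (v |: [set:: p]) :&: [set:: p] = S :&: [set:: p].
  by apply/setP=> u; rewrite !inE; do !case: (_ \in _); rewrite ?orbT ?andbF ?andbT.
have -> : (S :&: (v |: [set:: p])) :|: [set:: p] = v |: [set:: p].
  by apply/setP=> u; rewrite !inE; case: eqP => [->|]; rewrite ?vS //=; do !case: (_ \in _).
move=> le1; have := IH _ oE'; rewrite gv set_rcons; lra.
Qed.

(** Tight sets are closed under union and intersection, so that a tight set can
    be grown by the first element of a tight chain that it misses. *)
Lemma tight_grow h g o (X : {set V}) : submod h -> h set0 = 0 -> ordering o ->
  tight h g o -> \sum_(v in X) g v = h X -> X != [set: V] ->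
  exists2 v, v \notin X & \sum_(u in v |: X) g u = h (v |: X).
Proof.
move=> sm h0 oo t tX XT; have [uo oV] := oo.
have : has (fun v => v \notin X) o.
  apply: contraNT XT => /hasPn hX; apply/eqP/setP=> v; rewrite inE.
  by have := hX v (oV v); rewrite negbK.
have split_first (s : seq V) : has (fun v => v \notin X) s ->
    exists p v q, [/\ s = rcons p v ++ q, v \notin X & ~~ has (fun v => v \notin X) p].
  by case/split_find => v p q vX pX; exists p, v, q.
case/split_first => p [v [q [oE vX pX]]].
exists v => //; apply/eqP; rewrite eq_le (greedy_le _ sm h0 oo t) /=.
have up : uniq (rcons p v) by move: uo; rewrite oE cat_uniq => /andP[].
have subX : [set:: p] \subset X.
  by apply/fintype.subsetP=> u; rewrite inE => /(hasPn pX); rewrite negbK.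
have vp : v \notin p by move: up; rewrite rcons_uniq => /andP[].
have := sm X [set:: rcons p v]; rewrite set_rcons.
have -> : X :|: (v |: [set:: p]) = v |: X.
  by rewrite setUCA (setUidPl subX).
have -> : X :&: (v |: [set:: p]) = [set:: p].
  apply/setP=> u; rewrite !inE; case: eqP => [->|_].
    by rewrite (negPf vX) (negPf vp).
  by rewrite /= andb_idl // => up'; apply: (fintype.subsetP subX); rewrite inE.
rewrite -tX -set_rcons -(t _ _ oE) -(t p (v :: q)) ?oE ?cat_rcons //.
rewrite big_rcons /= big_setU1 //=; lra.
Qed.

End Greedy.

(** * The base polytope and the shifted functions *)

Section Shifted.
Variables (R : realType) (V : finType) (f : {set V} -> int).
Implicit Types (h : {set V} -> R) (g y z : {ffun V -> R}) (o p q : seq V).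
Hypotheses (sf : submodular f) (f0 : f set0 = 0).

Definition toR (S : {set V}) : R := (f S)%:~R.
Definition shift (mu : R) (S : {set V}) : R :=
  if (S == set0) || (S == [set: V]) then 0 else toR S + mu.
Definition unitv (v : V) : {ffun V -> R} := [ffun u => (u == v)%:R].

Lemma toR0 : toR set0 = 0.
Proof. by rewrite /toR f0. Qed.

Lemma shift0 mu : shift mu set0 = 0.
Proof. by rewrite /shift eqxx. Qed.

Lemma shiftT mu : shift mu [set: V] = 0.
Proof. by rewrite /shift eqxx orbT. Qed.

Lemma submod_toR : submod toR.
Proof. by move=> X Y; rewrite /toR -!intrD ler_int sf. Qed.

(** An intersection that becomes empty or a union that becomes [V] deprives the
    left-hand side of [mu], respectively of f(V) + [mu], which are nonnegative. *)
Lemma submod_shift mu : 0 <= mu -> 0 <= toR [set: V] + mu -> submod (shift mu).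
Proof.
move=> mu0 muV X Y; have := submod_toR X Y.
have [->|X0] := eqVneq X set0; first by move=> _; rewrite set0I set0U lexx.
have [->|Y0] := eqVneq Y set0; first by move=> _; rewrite setI0 setU0 addrC lexx.
have [->|XT] := eqVneq X [set: V]; first by move=> _; rewrite setTI setTU addrC lexx.
have [->|YT] := eqVneq Y [set: V]; first by move=> _; rewrite setIT setUT lexx.
have /negPf U0 : X :|: Y != set0.
  by apply: contraNneq X0 => U; rewrite -finset.subset0 -U finset.subsetUl.
have /negPf IT : X :&: Y != [set: V].
  by apply: contraNneq XT => U; rewrite -finset.subTset -U finset.subsetIl.
rewrite /shift (negPf X0) (negPf Y0) (negPf XT) (negPf YT) U0 IT orbF /=.
have := toR0.
have [->|I0] := eqVneq (X :&: Y) set0; have [->|UT] := eqVneq (X :|: Y) [set: V] => /=.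
- lra.
- lra.
- lra.
- lra.
Qed.

Lemma sum_unitv (F : V -> R) v : \sum_u F u * unitv v u = F v.
Proof.
rewrite (bigD1 v) //= ffunE eqxx mulr1 big1 ?addr0 //.
by move=> w /negPf wv; rewrite ffunE wv mulr0.
Qed.

Lemma sum_unitv_seq p v : uniq p -> \sum_(u <- p) unitv v u = (v \in p)%:R.
Proof.
move=> up; have [vp|vp] := boolP (v \in p).
  rewrite (bigD1_seq v) //= ffunE eqxx big1 ?addr0 // => u /negPf uv.
  by rewrite ffunE uv.
rewrite big_seq big1 // => u upp; rewrite ffunE.
by case: eqP upp vp => // -> ->.
Qed.

(** Changing a set function by constants off the two trivial sets only moves the
    first and the last coordinates of its greedy vectors. *)
Lemma tight_change h h' g v1 o (c d : R) : ordering (v1 :: o) ->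
  h set0 = 0 -> h' set0 = 0 -> h' [set: V] = h [set: V] + d ->
  (forall S, S != set0 -> S != [set: V] -> h' S = h S + c) ->
  tight h g (v1 :: o) ->
  tight h' (g + c *: unitv v1 + (d - c) *: unitv (last v1 o)) (v1 :: o).
Proof.
move=> oo h0 h'0 hT hS t p q oE.
have up : uniq p by move: oo.1; rewrite oE cat_uniq => /andP[].
have -> : \sum_(v <- p) (g + c *: unitv v1 + (d - c) *: unitv (last v1 o)) v =
  h [set:: p] + c * (v1 \in p)%:R + (d - c) * (last v1 o \in p)%:R.
  rewrite -!sum_unitv_seq // -(t _ _ oE) !mulr_sumr -!big_split.
  by apply: eq_bigr => u _; rewrite !ffunE.
case: q oE => [|v q] oE.
  have pE : p = v1 :: o by rewrite oE cats0.
  by rewrite pE (ordering_set oo) hT mem_head mem_last /= !mulr1; ring.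
have lp : last v1 o \notin p.
  move: oo.1; rewrite oE cat_uniq => /and3P[_ /hasPn hp _]; apply: hp.
  have -> : last v1 o = last v q; last exact: mem_last.
  by case: p oE {up} => [[-> ->] //|w p [_ ->]]; rewrite last_cat.
rewrite (negPf lp) mulr0 addr0.
case: p oE {up} lp => [|w p] oE lp; first by rewrite set_nil h0 h'0 mulr0 addr0.
have -> : w = v1 by case: oE.
rewrite mem_head mulr1 hS //.
  by apply/set0Pn; exists v1; rewrite inE mem_head.
apply: contraNneq lp => pT; have := in_setT (last v1 o); rewrite -pT inE.
by case: oE => ->.
Qed.

Lemma tight_slide mu theta g v1 o : ordering (v1 :: o) ->
  tight (shift mu) g (v1 :: o) ->
  tight (shift (mu + theta))
    (g + theta *: unitv v1 + (- theta) *: unitv (last v1 o)) (v1 :: o).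
Proof.
move=> oo t; rewrite -(sub0r theta).
apply: tight_change oo (shift0 mu) (shift0 _) _ _ t; first by rewrite !shiftT addr0.
by move=> S /negPf S0 /negPf ST; rewrite /shift S0 ST addrA.
Qed.

Lemma tight_unshift mu g v1 o : ordering (v1 :: o) -> tight (shift mu) g (v1 :: o) ->
  tight toR (g + (- mu) *: unitv v1 + (toR [set: V] - - mu) *: unitv (last v1 o))
    (v1 :: o).
Proof.
move=> oo t; apply: tight_change oo (shift0 mu) toR0 _ _ t; first by rewrite shiftT add0r.
by move=> S /negPf S0 /negPf ST; rewrite /shift S0 ST addrK.
Qed.

Lemma base_tight y o : ordering o -> tight toR y o -> base_polytope R f y.
Proof.
move=> oo t; split; last exact: tight_sum oo t.
by move=> S; apply: greedy_le submod_toR toR0 oo t.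
Qed.

(** A segment around a greedy vector would have to be tight at every prefix. *)
Lemma extreme_tight y o : ordering o -> tight toR y o -> extreme_base f y.
Proof.
move=> oo ty; split; first exact: base_tight oo ty.
move=> a b t [aS aV] [bS bV] /andP[t0 t1] yE.
suff H : tight toR a o /\ tight toR b o.
  by split; apply: tight_uniq oo _ _; [exact: H.1|exact: ty|exact: H.2|exact: ty].
have H p q : o = p ++ q ->
    \sum_(v <- p) a v = toR [set:: p] /\ \sum_(v <- p) b v = toR [set:: p].
  move=> oE; have up : uniq p by move: oo.1; rewrite oE cat_uniq => /andP[].
  have := ty _ _ oE; rewrite yE.
  have -> : \sum_(v <- p) (t *: a + (1 - t) *: b) v =
     t * \sum_(v <- p) a v + (1 - t) * \sum_(v <- p) b v.
    by rewrite !mulr_sumr -big_split; apply: eq_bigr => v _; rewrite !ffunE.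
  have := aS [set:: p]; have := bS [set:: p]; rewrite -!sum_prefix_uniq // -/(toR _).
  move: (\sum_(v <- p) a v) (\sum_(v <- p) b v) (toR _) => x x' r lx' lx e.
  have e' : t * (r - x) + (1 - t) * (r - x') = 0 by lra.
  have h1 : 0 <= t * (r - x) by rewrite mulr_ge0 ?subr_ge0 // ltW.
  have h2 : 0 <= (1 - t) * (r - x') by rewrite mulr_ge0 ?subr_ge0 // ltW.
  have /eqP : t * (r - x) = 0 by lra.
  have /eqP : (1 - t) * (r - x') = 0 by lra.
  rewrite !mulf_eq0 !subr_eq0 (gt_eqF t0) (gt_eqF t1) /=.
  by move=> /eqP-> /eqP->.
by split=> p q oE; case: (H p q oE).
Qed.

(** Bounded above by the set {v}, below by its complement. *)
Lemma base_coord z v : base_polytope R f z ->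
  `|z v| <= `|toR [set v]| + `|toR [set: V]| + `|toR [set~ v]|.
Proof.
move=> [zS zV].
have up := zS [set v]; rewrite big_set1 -/(toR _) in up.
have lo := zS [set~ v]; rewrite -/(toR _) in lo.
have zE : z v + \sum_(u in [set~ v]) z u = toR [set: V].
  rewrite /toR -zV [RHS](bigD1 v) //=; congr (_ + _).
  by apply: eq_bigl => u; rewrite !inE.
have := ler_norm (toR [set v]); have := ler_norm (toR [set~ v]).
have := ler_norm (- toR [set: V]); rewrite normrN.
have := normr_ge0 (toR [set v]); have := normr_ge0 (toR [set~ v]).
have := normr_ge0 (toR [set: V]); move=> *.
rewrite ler_norml; apply/andP; split; lra.
Qed.

Lemma l1_le_max z : base_polytope R f z -> \sum_v `|z v| <= max_l1 R f.
Proof.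
move=> zB; apply: ub_le_sup; last by exists z.
exists (\sum_v (`|toR [set v]| + `|toR [set: V]| + `|toR [set~ v]|)).
by move=> _ [y yB <-]; apply: ler_sum => v _; apply: base_coord.
Qed.

(** The vectors handled by the algorithm: greedy vectors of the functions that
    were current before the shift reached [mu]. *)
Definition vertex (mu : R) g := exists m o,
  [/\ ordering o, tight (shift m) g o, 0 <= m, 0 <= toR [set: V] + m & m <= mu].

Lemma vertex_le mu mu' g : mu <= mu' -> vertex mu g -> vertex mu' g.
Proof.
by move=> le_mu [m [ o [ oo t m0 mV mm]]]; exists m, o; split=> //; apply: le_trans le_mu.
Qed.

Lemma vertex_sum mu g : vertex mu g -> \sum_v g v = 0.
Proof. by move=> [m [ o [oo t _ _ _]]]; rewrite (tight_sum oo t) shiftT. Qed.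

Lemma ordering_cons o : (0 < #|V|)%N -> ordering o -> exists v1 o', o = v1 :: o'.
Proof.
move=> /card_gt0P[v _] [_ oV]; case: o oV => [/(_ v)//|v1 o' _].
by exists v1, o'.
Qed.

(** [h] is the base of [f] that corresponds to the vertex [g] of a shifted base
    polytope. *)
Definition unshifted (mu : R) g (h : {ffun V -> R}) := exists m v1 vn,
  [/\ 0 <= m, 0 <= toR [set: V] + m, m <= mu &
      h = g - m *: unitv v1 + (toR [set: V] + m) *: unitv vn].

Lemma tight_unshifted mu m o g (h : {ffun V -> R}) : (0 < #|V|)%N -> ordering o ->
  tight (shift m) g o -> tight toR h o -> 0 <= m -> 0 <= toR [set: V] + m ->
  m <= mu -> unshifted mu g h.
Proof.
move=> n0 oo tg th m0 mV mm; have [v1 [ o' oE]] := ordering_cons n0 oo; subst o.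
exists m, v1, (last v1 o'); split=> //.
by rewrite (tight_uniq oo th (tight_unshift oo tg)) scaleNr opprK.
Qed.

Lemma vertex_unshift mu g : (0 < #|V|)%N -> vertex mu g ->
  exists2 h, unshifted mu g h & base_polytope R f h.
Proof.
move=> n0 [m [ o [ oo t m0 mV mm]]]; have [v1 [ o' oE]] := ordering_cons n0 oo; subst o.
have th := tight_unshift oo t; eexists; last exact: base_tight oo th.
exact: tight_unshifted n0 oo t th m0 mV mm.
Qed.

(** The base [h] of [g] has norm at most L_f, hence so have mu = - f(W) <= - h(W)
    and f(V) = h(V); the two entries in which [g] and [h] differ add m and f(V) + m. *)
Lemma vertex_l1 mu W g : (0 < #|V|)%N -> vertex mu g -> toR W = - mu ->
  \sum_v `|g v| <= 4 * max_l1 R f.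
Proof.
move=> n0 /(vertex_unshift n0)[h [m [v1 [vn [m0 mV mm hE]]]] hB] fW.
have L1 := l1_le_max hB.
have muL : mu <= max_l1 R f.
  have : - \sum_(v in W) h v <= \sum_v `|h v|.
    rewrite (le_trans (ler_norm _)) // normrN (le_trans (ler_norm_sum _ _ _)) //.
    rewrite [X in _ <= X](bigID (mem W)) /= lerDl.
    by apply: sumr_ge0 => v _.
  by have := hB.1 W; rewrite -/(toR _) fW; lra.
have fVL : toR [set: V] <= max_l1 R f.
  rewrite -[toR _]hB.2; apply: le_trans L1.
  by apply: ler_sum => v _; apply: ler_norm.
have gE : g = h + m *: unitv v1 - (toR [set: V] + m) *: unitv vn.
  by rewrite hE (addrAC (g - _)) subrK addrK.
have e1 v (c : R) : 0 <= c -> \sum_u `|(c *: unitv v) u| = c.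
  move=> c0; rewrite (eq_bigr (fun u => c * unitv v u)); last first.
    by move=> u _; rewrite !ffunE ger0_norm // mulr_ge0.
  exact: (sum_unitv (fun=> c)).
apply: (@le_trans _ _ (\sum_v (`|h v| + `|(m *: unitv v1) v| +
    `|((toR [set: V] + m) *: unitv vn) v|))).
  apply: ler_sum => v _; rewrite gE !ffunE.
  by rewrite (le_trans (ler_normB _ _)) // lerD2r ler_normD.
rewrite !big_split /= !e1 //; lra.
Qed.

Lemma vertex_coord mu W g v : (0 < #|V|)%N -> vertex mu g -> toR W = - mu ->
  `|g v| <= 4 * max_l1 R f.
Proof.
move=> n0 vg fW; apply: le_trans (vertex_l1 n0 vg fW).
by rewrite (bigD1 v) //= lerDl sumr_ge0.
Qed.

(** Replacing the shifted vertices by the bases of [f] they come from lowers the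
    combination by mass at most [mu]. *)
Lemma unshifted_sum mu (ws : seq ({ffun V -> R} * {ffun V -> R} * R)) :
  (forall w, w \in ws -> 0 <= w.2 /\ unshifted mu w.1.1 w.1.2) ->
  exists a : {ffun V -> R}, [/\ forall v, 0 <= a v,
    \sum_v a v <= mu * \sum_(w <- ws) w.2 &
    forall v, (\sum_(w <- ws) w.2 *: w.1.1) v - a v <= (\sum_(w <- ws) w.2 *: w.1.2) v].
Proof.
elim: ws => [_|[[g h] c] ws IH hws].
  exists 0; split=> [v||v]; rewrite ?big_nil ?ffunE ?subr0 ?mulr0 //.
  by rewrite big1 // => v _; rewrite ffunE.
have [|a [a0 aS aL]] := IH; first by move=> w wi; apply: hws; rewrite inE wi orbT.
have /= [c0 [m [v1 [vn [m0 mV mm hE]]]]] := hws _ (mem_head _ _).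
exists (a + (c * m) *: unitv v1); split=> [v||v].
- by rewrite !ffunE addr_ge0 // !mulr_ge0.
- rewrite big_cons /= mulrDr.
  have -> : \sum_v (a + (c * m) *: unitv v1) v = \sum_v a v + c * m.
    rewrite -[X in _ = _ + X](sum_unitv (fun=> c * m) v1) -big_split.
    by apply: eq_bigr => v _; rewrite !ffunE.
  by rewrite addrC lerD // mulrC ler_wpM2r.
rewrite !big_cons /= hE.
rewrite [X in X - _]ffunE [X in _ <= X]ffunE !ffunE /GRing.scale /=.
have := aL v; have : 0 <= c * ((toR [set: V] + m) * (v == vn)%:R) by rewrite !mulr_ge0.
lra.
Qed.

Lemma neg_part_combination mu (E : R) (ws : seq ({ffun V -> R} * {ffun V -> R} * R)) :
  (forall w, w \in ws -> 0 <= w.2 /\ unshifted mu w.1.1 w.1.2) ->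
  \sum_(w <- ws) w.2 = 1 ->
  \sum_v `|(\sum_(w <- ws) w.2 *: w.1.1) v| <= E ->
  - mu <= neg_part (\sum_(w <- ws) w.2 *: w.1.2) [set: V] + E.
Proof.
move=> /unshifted_sum[a [a0 aS aL]] w1 hE; rewrite w1 mulr1 in aS.
have -> : neg_part (\sum_(w <- ws) w.2 *: w.1.2) [set: V] =
   \sum_v Num.min 0 ((\sum_(w <- ws) w.2 *: w.1.2) v).
  by apply: eq_bigl => v; rewrite inE.
have : \sum_v (- `|(\sum_(w <- ws) w.2 *: w.1.1) v| - a v) <=
    \sum_v Num.min 0 ((\sum_(w <- ws) w.2 *: w.1.2) v).
  apply: ler_sum => v _; rewrite le_min; apply/andP; split.
    by have := a0 v; have := normr_ge0 ((\sum_(w <- ws) w.2 *: w.1.1) v); lra.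
  have := aL v; have := ler_norm (- (\sum_(w <- ws) w.2 *: w.1.1) v).
  by rewrite normrN; lra.
rewrite big_split /= !sumrN; lra.
Qed.

Lemma neg_part_le y (S : {set V}) : base_polytope R f y -> neg_part y [set: V] <= toR S.
Proof.
move=> [yS _]; apply: le_trans (yS S).
have -> : neg_part y [set: V] = \sum_v Num.min 0 (y v).
  by apply: eq_bigl => v; rewrite inE.
rewrite (bigID (mem S)) /= -[X in _ <= X]addr0 lerD //.
  by apply: ler_sum => v _; rewrite ge_min lexx orbT.
by apply: sumr_le0 => v _; rewrite ge_min lexx.
Qed.

End Shifted.

(** * Rescaling *)

Section Rescaling.
Variables (R : realType) (V : finType).
Implicit Types (x y z g h : {ffun V -> R}) (A Q : V -> V -> R).
Implicit Types (ts : seq ({ffun V -> R} * R)).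

Definition nrm Q g : R := Num.sqrt (qform Q g).
Definition nv Q g : {ffun V -> R} := [ffun v => g v / nrm Q g].

Lemma nvE Q g : nv Q g = (nrm Q g)^-1 *: g.
Proof. by apply/ffunP=> v; rewrite !ffunE mulrC. Qed.

Lemma nv0 Q : nv Q 0 = 0.
Proof. by rewrite nvE scaler0. Qed.

Lemma nrm_ge0 Q g : 0 <= nrm Q g.
Proof. exact: sqrtr_ge0. Qed.

Lemma sqr_nrm Q g : posdef Q -> nrm Q g ^+ 2 = qform Q g.
Proof. by move=> pQ; rewrite sqr_sqrtr // qform_ge0. Qed.

Lemma nrm_gt0 Q g : posdef Q -> g != 0 -> 0 < nrm Q g.
Proof. by move=> pQ g0; rewrite sqrtr_gt0 pQ. Qed.

Lemma nv_unit Q g : posdef Q -> g != 0 -> qform Q (nv Q g) = 1.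
Proof.
move=> pQ g0; rewrite nvE qformZ -sqr_nrm // -exprMn mulVf ?expr1n //.
by rewrite gt_eqF // nrm_gt0.
Qed.

Lemma nv_eq0 Q g : posdef Q -> (nv Q g == 0) = (g == 0).
Proof.
move=> pQ; apply/eqP/eqP=> [|->]; last exact: nv0.
have [//|g0] := eqVneq g 0; move/(congr1 (qform Q)).
by rewrite nv_unit // qform0 => /eqP; rewrite oner_eq0.
Qed.

(** The state of the von Neumann iteration: a convex combination of normalized
    vectors whose squared norm is at most the inverse of their number. *)
Definition vn_state Q ts y :=
  [/\ forall t, t \in ts -> 0 <= t.2,
      \sum_(t <- ts) t.2 = 1,
      y = \sum_(t <- ts) t.2 *: nv Q t.1,
      qform Q y * (size ts)%:R <= 1 &
      y != 0 -> forall t, t \in ts -> t.1 != 0].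

Lemma vn_init Q g : posdef Q -> vn_state Q [:: (g, 1)] (nv Q g).
Proof.
move=> pQ; split; rewrite ?big_seq1 ?scale1r //.
- by move=> t; rewrite inE => /eqP->.
- rewrite mulr1; have [->|g0] := eqVneq g 0; last by rewrite nv_unit.
  by rewrite nv0 qform0.
- by rewrite nv_eq0 // => g0 t; rewrite inE => /eqP->.
Qed.

Definition vn_lambda Q g y : R :=
  let d := y - nv Q g in dotp d (app Q y) / dotp d (app Q d).

Definition vn_terms ts g (l : R) : seq ({ffun V -> R} * R) :=
  rcons [seq (t.1, (1 - l) * t.2) | t <- ts] (g, l).

(** The point of the segment closest to the origin: when <y, g> <= 0, the
    inverse of the squared norm grows by at least one. *)
Lemma vn_step Q ts g y : sym Q -> posdef Q -> vn_state Q ts y -> y != 0 ->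
  dotp y (app Q g) <= 0 ->
  let l := vn_lambda Q g y in
  vn_state Q (vn_terms ts g l) ((1 - l) *: y + l *: nv Q g).
Proof.
move=> sQ pQ [t0 t1 yE yk ts0] y0 yg l.
pose n := nv Q g; pose a := qform Q y; pose b := dotp y (app Q n).
have a0 : 0 < a by exact: pQ.
have b0 : b <= 0.
  by rewrite /b /n nvE appZ dotpZr mulr_ge0_le0 // invr_ge0 nrm_ge0.
have qd : qform Q (y - n) = a - 2 * b + qform Q n.
  by rewrite qformD // qformN appN dotpNr -/a -/b; ring.
have nd : dotp (y - n) (app Q y) = a - b.
  by rewrite dotpDl dotpNl -/(qform Q y) -/a -(dotp_app n y sQ) dotpC -/b.
have nn : (g == 0) || (qform Q n == 1).
  by have [//|g0] := eqVneq g 0; rewrite nv_unit ?eqxx.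
have n_le1 : 0 <= qform Q n <= 1.
  case/orP: nn => [/eqP g0|/eqP->]; last by rewrite ler01 lexx.
  by rewrite /n g0 nv0 qform0 lexx ler01.
have lE : l = (a - b) / (a - 2 * b + qform Q n) by rewrite /l /vn_lambda nd -qd.
have den0 : 0 < a - 2 * b + qform Q n by lra.
have l0 : 0 <= l by rewrite lE divr_ge0 ?ltW //; lra.
have l1 : 0 <= 1 - l.
  rewrite subr_ge0 lE ler_pdivrMr // mul1r.
  case/orP: nn => [/eqP g0|/eqP->]; last lra.
  have n0 : n = 0 by rewrite /n g0 nv0.
  have bE : b = 0 by rewrite /b n0 app0 dotp0r.
  by rewrite n0 qform0 bE; lra.
have stop : g = 0 -> (1 - l) *: y + l *: n = 0.
  move=> g0; have n0 : n = 0 by rewrite /n g0 nv0.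
  have -> : l = 1.
    by rewrite lE /b n0 app0 dotp0r qform0 mulr0 !subr0 addr0 divff ?gt_eqF.
  by rewrite subrr scale0r n0 scaler0 addr0.
split.
- move=> t; rewrite mem_rcons inE => /orP[/eqP->//|/mapP[t' t'i ->]] /=.
  by rewrite mulr_ge0 // t0.
- rewrite /vn_terms -cats1 big_cat /= big_seq1 big_map /= -mulr_sumr t1; ring.
- rewrite /vn_terms -cats1 big_cat /= big_seq1 big_map /=; congr (_ + _).
  by rewrite {1}yE scaler_sumr; apply: eq_bigr => t _; rewrite scalerA.
- rewrite /vn_terms size_rcons size_map -/n.
  have [g0|g0] := eqVneq g 0.
    by rewrite stop // qform0 mul0r.
  have n1 : qform Q n = 1 by rewrite nv_unit.
  have -> : qform Q ((1 - l) *: y + l *: n) = (a - b ^+ 2) / (a - 2 * b + 1).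
    rewrite qformD // !qformZ appZ dotpZl dotpZr -/a -/b n1 lE n1; field.
    by rewrite n1 in den0; rewrite gt_eqF //; lra.
  rewrite n1 in den0; rewrite mulrAC ler_pdivrMr // mul1r -natr1 mulrDr mulr1.
  have : a * (size ts)%:R <= 1 by [].
  have k0 : 0 <= (size ts)%:R :> R by rewrite ler0n.
  move: ((size ts)%:R) k0 => k k0 ak.
  have : 0 <= b ^+ 2 by exact: sqr_ge0.
  have : 0 <= b ^+ 2 * k by rewrite mulr_ge0 // sqr_ge0.
  by rewrite mulrBl; lra.
- move=> y'0 t; rewrite mem_rcons inE => /orP[/eqP->|/mapP[t' t'i ->]] /=.
    by apply: contraNneq y'0 => g0; rewrite stop.
  exact: ts0.
Qed.

Definition scale_of (eps : R) : R := 1 / ((1 + eps) * (1 + eps)).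
Definition rescaled_mx (eps : R) Q A ts : V -> V -> R := fun u v =>
  scale_of eps * (A u v + \sum_(t <- ts) t.2 / qform Q t.1 * (t.1 u * t.1 v)).

Lemma rank1_sum A (ws : seq ({ffun V -> R} * R)) u v :
  foldl (fun B w => rank1 B w.2 w.1) A ws u v =
  A u v + \sum_(w <- ws) w.2 * (w.1 u * w.1 v).
Proof.
elim: ws A => [|w ws IH] A; first by rewrite big_nil addr0.
by rewrite /= IH big_cons /rank1 addrA.
Qed.

Lemma scale_gt0 eps : 0 <= eps -> 0 < scale_of eps.
Proof. by move=> e0; rewrite divr_gt0 // mulr_gt0 // ltr_wpDr. Qed.

Lemma app_rescaled eps Q A ts z : app (rescaled_mx eps Q A ts) z =
  scale_of eps *: (app A z + \sum_(t <- ts) (t.2 / qform Q t.1 * dotp t.1 z) *: t.1).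
Proof.
apply/ffunP=> v.
have -> : (scale_of eps *: (app A z + \sum_(t <- ts) (t.2 / qform Q t.1 * dotp t.1 z) *: t.1)) v =
  scale_of eps * (\sum_u A v u * z u +
    \sum_(t <- ts) t.2 / qform Q t.1 * (\sum_u t.1 u * z u) * t.1 v).
  by rewrite !ffunE sum_ffunE; congr (_ * (_ + _)); apply: eq_bigr => t _; rewrite ffunE.
rewrite ffunE.
transitivity (\sum_u (scale_of eps * (A v u * z u) + \sum_(t <- ts)
   scale_of eps * (t.2 / qform Q t.1 * (t.1 v * t.1 u) * z u))).
  apply: eq_bigr => u _; rewrite /rescaled_mx -mulr_sumr -mulrDr -mulrA; congr (_ * _).
  by rewrite mulrDl; congr (_ + _); rewrite mulr_suml.
rewrite big_split /= -mulr_sumr mulrDr; congr (_ + _).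
rewrite exchange_big /= mulr_sumr; apply: eq_bigr => t _.
rewrite !(mulr_sumr, mulr_suml); by apply: eq_bigr => u _; ring.
Qed.

Section OneRescaling.
Variables (eps : R) (Q A : V -> V -> R) (ts : seq ({ffun V -> R} * R)).
Variable (y : {ffun V -> R}).
Hypotheses (eps0 : 0 <= eps) (sA : sym A) (pA : posdef A) (AQ : inverse_pair A Q).
Hypotheses (vn : vn_state Q ts y).

Let sQ : sym Q := sym_inverse sA AQ.
Let pQ : posdef Q := posdef_inverse pA AQ.
Let A' := rescaled_mx eps Q A ts.

Let weight_ge0 t : t \in ts -> 0 <= t.2 / qform Q t.1.
Proof. by case: vn => t0 _ _ _ _ /t0 ?; rewrite divr_ge0 // qform_ge0. Qed.

Lemma qform_rescaled z :
  qform A' z = scale_of eps *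
    (qform A z + \sum_(t <- ts) t.2 / qform Q t.1 * dotp t.1 z ^+ 2).
Proof.
rewrite /qform app_rescaled dotpZr dotpDr dotp_sumr; congr (_ * (_ + _)).
by apply: eq_bigr => t _; rewrite dotpZr (dotpC z); ring.
Qed.

Lemma qform_rescaled_ge z : scale_of eps * qform A z <= qform A' z.
Proof.
rewrite qform_rescaled ler_pM2l ?scale_gt0 // lerDl big_seq_cond.
by apply: sumr_ge0 => t; rewrite andbT => /weight_ge0 w0; rewrite mulr_ge0 ?sqr_ge0.
Qed.

Lemma sym_rescaled : sym A'.
Proof.
move=> u v; rewrite /A' /rescaled_mx sA; congr (_ * (_ + _)).
by apply: eq_bigr => t _; rewrite (mulrC (t.1 u)).
Qed.

Lemma posdef_rescaled : posdef A'.
Proof.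
move=> x x0; apply: lt_le_trans (qform_rescaled_ge x).
by rewrite mulr_gt0 ?scale_gt0 ?pA.
Qed.

Lemma det_rescaled : (forall t, t \in ts -> t.1 != 0) ->
  formdet A * (scale_of eps ^+ #|V| * 2) <= formdet A'.
Proof.
move=> ts0; pose ws := [seq (t.1, t.2 / qform Q t.1) | t <- ts].
have -> : formdet A' = scale_of eps ^+ #|V| *
    formdet (foldl (fun B w => rank1 B w.2 w.1) A ws).
  rewrite -formdetZ; congr (\det _); apply/matrixP=> i j; rewrite !mxE rank1_sum.
  by rewrite /A' /rescaled_mx big_map.
rewrite mulrCA ler_wpM2l ?exprn_ge0 ?(ltW (scale_gt0 _)) //.
have h w : w \in ws -> 0 <= w.2 by move=> /mapP[t /weight_ge0 ti ->].
apply: le_trans (formdet_growth sA pA AQ h); rewrite ler_wpM2l //.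
  by rewrite ltW //; case/andP: (hadamardV sA pA).
rewrite (_ : \sum_(w <- ws) _ = 1) // big_map; case: vn => _ <- _ _ _.
rewrite big_seq [RHS]big_seq; apply: eq_bigr => t ti /=.
by rewrite divfK // gt_eqF // pQ // ts0.
Qed.

Definition pull_weight (b : R) (z : {ffun V -> R}) (t : {ffun V -> R} * R) : R :=
  t.2 / qform Q t.1 * (nrm Q t.1 * ((1 + eps) * b) - dotp t.1 z) * scale_of eps.

Variables (Q' : V -> V -> R) (h : {ffun V -> R}) (b : R).
Hypotheses (AQ' : inverse_pair A' Q') (b0 : 0 <= b) (hb : qform Q' h <= b ^+ 2).
Let z := app Q' h.

Let z_le : qform A z <= ((1 + eps) * b) ^+ 2.
Proof.
have e1 : 0 < 1 + eps by rewrite ltr_wpDr.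
have : scale_of eps * qform A z <= b ^+ 2.
  apply: le_trans (qform_rescaled_ge z) _; apply: le_trans hb.
  by rewrite /z -(qform_app_inverse AQ') AQ'.2.
rewrite /scale_of mulrAC mul1r ler_pdivrMr ?mulr_gt0 //.
by rewrite exprMn -expr2 mulrC.
Qed.

Lemma pull_weight_ge0 t : t \in ts -> 0 <= pull_weight b z t.
Proof.
move=> ti; apply: mulr_ge0 (ltW (scale_gt0 eps0)); apply: mulr_ge0 (weight_ge0 ti) _.
rewrite subr_ge0 (le_trans (ler_norm _)) //.
have e1 : 0 <= 1 + eps by rewrite addr_ge0.
rewrite -ler_sqr ?nnegrE ?mulr_ge0 ?nrm_ge0 // real_normK ?num_real //.
rewrite (le_trans (dotp_dual sA pA AQ _ _)) // exprMn sqr_nrm //.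
by rewrite ler_wpM2l // qform_ge0.
Qed.

(** Adding nonnegative multiples of the vectors of one phase to [h] carries a
    bound on its norm back through the rescaling of that phase: the quadratic
    terms <g, z> g of [h] are completed to multiples of the short vector [y]. *)
Lemma pull_back : nrm Q y <= eps ->
  qform Q (h + \sum_(t <- ts) pull_weight b z t *: t.1) <= b ^+ 2.
Proof.
move=> ny; set r := (1 + eps) * b.
have e1 : 0 < 1 + eps by rewrite ltr_wpDr.
have r0 : 0 <= r by rewrite mulr_ge0 // ltW.
have -> : h + \sum_(t <- ts) pull_weight b z t *: t.1 =
    scale_of eps *: (app A z + r *: y).
  have hE : h = app A' z by rewrite /z AQ'.2.
  rewrite {1}hE app_rescaled !scalerDr -addrA; congr (_ + _).
  case: vn => _ _ yE _ _; rewrite yE !scaler_sumr -big_split; apply: eq_bigr => t _ /=.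
  rewrite nvE !scalerA -scalerDl; congr (_ *: _); rewrite /pull_weight -/r.
  rewrite mulrBr mulrBl [X in X + (_ - _)]mulrC addrC subrK.
  have -> : (nrm Q t.1)^-1 = nrm Q t.1 / qform Q t.1.
    have [->|t0] := eqVneq t.1 0; last first.
      by rewrite -sqr_nrm // expr2 invfM mulrA mulfV ?mul1r // gt_eqF // nrm_gt0.
    by rewrite /nrm qform0 sqrtr0 invr0 mul0r.
  by ring.
rewrite qformZ; apply: (@le_trans _ _ (scale_of eps ^+ 2 * (r + r * eps) ^+ 2)).
  rewrite ler_wpM2l ?sqr_ge0 //; apply: qform_triangle => //; first exact: mulr_ge0.
    by rewrite (qform_app_inverse AQ).
  rewrite qformZ [(r * eps) ^+ 2]exprMn ler_wpM2l ?sqr_ge0 // -sqr_nrm //.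
  by rewrite ler_sqr ?nnegrE ?nrm_ge0.
rewrite -exprMn /r /scale_of le_eqVlt; apply/orP; left; apply/eqP; congr (_ ^+ 2).
by field; rewrite gt_eqF.
Qed.

End OneRescaling.

(** What remains once both signs of a thin direction have been pulled back to the
    identity matrix: the two combinations add up to a short vector with a large
    total weight. *)
Lemma thin_combination (b L : R) (u : {ffun V -> R}) v0 (ts1 ts2 : seq ({ffun V -> R} * R)) :
  2 <= b -> u v0 = b ^+ 2 ->
  (forall t, t \in ts1 ++ ts2 -> 0 <= t.2 /\ `|t.1 v0| <= 4 * L) ->
  qform (idm R (V := V)) (u + \sum_(t <- ts1) t.2 *: t.1) <= b ^+ 2 ->
  qform (idm R (V := V)) (- u + \sum_(t <- ts2) t.2 *: t.1) <= b ^+ 2 ->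
  (forall v, `|(\sum_(t <- ts1 ++ ts2) t.2 *: t.1) v| <= 2 * b) /\
  b ^+ 2 <= 4 * L * \sum_(t <- ts1 ++ ts2) t.2.
Proof.
move=> b2 uE hts q1 q2; have b0 : 0 <= b by lra.
have coord (x : {ffun V -> R}) v : qform (idm R (V := V)) x <= b ^+ 2 -> `|x v| <= b.
  move=> qx; rewrite -ler_sqr ?nnegrE // real_normK ?num_real //.
  apply: le_trans qx; rewrite qform_id (bigD1 v) //= lerDl sumr_ge0 // => w _.
  exact: sqr_ge0.
have -> : \sum_(t <- ts1 ++ ts2) t.2 *: t.1 =
    \sum_(t <- ts1) t.2 *: t.1 + \sum_(t <- ts2) t.2 *: t.1 by rewrite big_cat.
split=> [v|].
  have := coord _ v q1; have := coord _ v q2.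
  move: (\sum_(t <- ts1) _) (\sum_(t <- ts2) _) => s1 s2; rewrite !ffunE.
  by rewrite !ler_norml => /andP[? ?] /andP[? ?]; apply/andP; split; lra.
have bound (ts : seq ({ffun V -> R} * R)) :
    (forall t, t \in ts -> 0 <= t.2 /\ `|t.1 v0| <= 4 * L) ->
    `|(\sum_(t <- ts) t.2 *: t.1) v0| <= 4 * L * \sum_(t <- ts) t.2.
  move=> h; rewrite sum_ffunE (le_trans (ler_norm_sum _ _ _)) // mulr_sumr.
  rewrite [X in X <= _]big_seq [X in _ <= X]big_seq; apply: ler_sum => t /h[t0 tL].
  by rewrite ffunE normrM ger0_norm // mulrC ler_wpM2r.
have B1 : forall t, t \in ts1 -> 0 <= t.2 /\ `|t.1 v0| <= 4 * L.
  by move=> t ti; apply: hts; rewrite mem_cat ti.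
have B2 : forall t, t \in ts2 -> 0 <= t.2 /\ `|t.1 v0| <= 4 * L.
  by move=> t ti; apply: hts; rewrite mem_cat ti orbT.
have := bound _ B1; have := bound _ B2.
have := coord _ v0 q1; have := coord _ v0 q2; rewrite big_cat /= mulrDr.
move: (\sum_(t <- ts1) _ *: _) (\sum_(t <- ts2) _ *: _) => s1 s2; rewrite !ffunE uE.
rewrite !ler_norml => /andP[? ?] /andP[? ?] /andP[? ?] /andP[? ?].
have : 0 <= b * (b - 2) by rewrite mulr_ge0 // subr_ge0.
by rewrite mulrBr -expr2; lra.
Qed.

End Rescaling.

(** * Gauss-Jordan inversion *)

Section GaussJordan.
Variables (R : realType) (V : finType).
Implicit Types (x y p : {ffun V -> R}) (A M : V -> V -> R) (K : seq V).

Definition pivot_mx M (k : V) : V -> V -> R := fun i j =>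
  if i == k then if j == k then 1 / M k k else 0 - M k j * (1 / M k k)
  else if j == k then M i k * (1 / M k k)
  else M i j - M i k * (M k j * (1 / M k k)).

Definition mix K x y : {ffun V -> R} := [ffun v => if v \in K then x v else y v].

(** After the pivots in [K], the matrix maps the vector that consists of the
    outputs of [A] in [K] and of its inputs outside [K] to the vector of the
    remaining inputs and outputs; the former vectors fill the space. *)
Definition exchanged A K M :=
  (forall x, app M (mix K (app A x) x) = mix K x (app A x)) /\
  (forall p, exists x, mix K (app A x) x = p).

Lemma exchanged_pivot A K M k : posdef A -> k \notin K -> exchanged A K M ->
  0 < M k k /\ exchanged A (rcons K k) (pivot_mx M k).
Proof.
move=> pA kK [hM sM].
have Mkk : 0 < M k k.
  (* The input x whose mixed vector is e_k has <x, A x> = M k k. *)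
  have [x xE] := sM [ffun u => (u == k)%:R].
  have x0 : x != 0.
    have := congr1 (fun p : {ffun V -> R} => p k) xE; rewrite !ffunE (negPf kK) eqxx.
    by apply: contra_eq_neq => ->; rewrite ffunE eq_sym oner_eq0.
  have <- : app A x k = M k k.
    have := congr1 (fun p : {ffun V -> R} => p k) (hM x); rewrite xE app_delta !ffunE.
    by rewrite (negPf kK).
  have := pA _ x0; rewrite /qform /dotp (bigD1 k) //= big1 => [|v vk].
    have := congr1 (fun p : {ffun V -> R} => p k) xE; rewrite !ffunE (negPf kK) eqxx.
    by move=> ->; rewrite addr0 mul1r.
  have := congr1 (fun p : {ffun V -> R} => p v) xE; rewrite !ffunE (negPf vk).
  by case: (v \in K) => ->; rewrite ?mul0r ?mulr0.
split=> //; have Mk0 : M k k != 0 by rewrite gt_eqF.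
have expand (N : V -> V -> R) (q : {ffun V -> R}) i :
    app N q i = N i k * q k + \sum_(j | j != k) N i j * q j.
  by rewrite ffunE (bigD1 k).
have mixK (x y : {ffun V -> R}) v : v != k -> mix (rcons K k) x y v = mix K x y v.
  by move=> /negPf vk; rewrite !ffunE mem_rcons inE vk.
have mixk (x y : {ffun V -> R}) : mix (rcons K k) x y k = x k.
  by rewrite ffunE mem_rcons inE eqxx.
have mixk' (x y : {ffun V -> R}) : mix K x y k = y k by rewrite ffunE (negPf kK).
split=> [x|p].
  set z := app A x.
  have hk : z k = M k k * x k + \sum_(j | j != k) M k j * mix K z x j.
    have := congr1 (fun p : {ffun V -> R} => p k) (hM x).
    by rewrite -/z expand !mixk' => <-.
  have sumE i : \sum_(j | j != k) pivot_mx M k i j * mix (rcons K k) z x j =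
     \sum_(j | j != k) pivot_mx M k i j * mix K z x j.
    by apply: eq_bigr => j jk; rewrite mixK.
  apply/ffunP=> i; rewrite expand sumE mixk.
  have [->|ik] := eqVneq i k.
    rewrite mixk /pivot_mx !eqxx (eq_bigr (fun j => - (1 / M k k) * (M k j * mix K z x j))).
      by rewrite -mulr_sumr {1}hk; field.
    by move=> j /negPf jk; rewrite jk; ring.
  rewrite mixK // -(hM x) -/z expand mixk' /pivot_mx (negPf ik) eqxx.
  rewrite (eq_bigr (fun j => M i j * mix K z x j -
      M i k * (1 / M k k) * (M k j * mix K z x j))).
    by rewrite sumrB -mulr_sumr {1}hk; field.
  by move=> j /negPf jk; rewrite jk; ring.
pose s := \sum_(j | j != k) M k j * p j.
have [x xE] := sM [ffun v => if v == k then (p k - s) / M k k else p v].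
exists x; apply/ffunP=> v; have [->|vk] := eqVneq v k; last first.
  by rewrite mixK // xE ffunE (negPf vk).
rewrite mixk; have := congr1 (fun p : {ffun V -> R} => p k) (hM x).
rewrite mixk' expand xE ffunE eqxx => <-.
rewrite (eq_bigr (fun j => M k j * p j)); last by move=> j /negPf jk; rewrite ffunE jk.
by rewrite -/s; field.
Qed.

Lemma exchanged0 A : exchanged A [::] A.
Proof.
have h x y : mix [::] x y = y by apply/ffunP=> v; rewrite ffunE.
by split=> x; [rewrite !h|exists x; rewrite h].
Qed.

Lemma exchanged_full A M : exchanged A (enum V) M -> inverse_pair A M.
Proof.
have h x y : mix (enum V) x y = x by apply/ffunP=> v; rewrite ffunE mem_enum.
move=> [h1 h2]; have MA x : app M (app A x) = x by have := h1 x; rewrite !h.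
by split=> // p; have [x] := h2 p; rewrite h => <-; rewrite MA.
Qed.

Lemma inverse_foldl A : posdef A -> inverse_pair A (foldl pivot_mx A (enum V)).
Proof.
move=> pA; apply: exchanged_full.
have : uniq (enum V) by exact: enum_uniq.
elim/last_ind: (enum V) => [_|s k IH]; first exact: exchanged0.
rewrite rcons_uniq => /andP[ks /IH ex]; rewrite -cats1 foldl_cat /= cats1.
by case: (exchanged_pivot pA ks ex).
Qed.

End GaussJordan.

(** * The number of rescalings *)

Section Phases.
Variable R : realType.

Definition eps_of (n : nat) : R := 1 / (20 * n)%N%:R.

Lemma bernoulli (e : R) k : 0 <= e <= 1 -> 1 - k%:R * e <= (1 - e) ^+ k.
Proof.
move=> /andP[e0 e1]; elim: k => [|k IH]; first by rewrite mul0r subr0.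
rewrite exprS; apply: (@le_trans _ _ ((1 - e) * (1 - k%:R * e))).
  have k0 : 0 <= k%:R :> R by rewrite ler0n.
  have : 0 <= k%:R * (e * e) by rewrite !mulr_ge0.
  by rewrite -natr1; lra.
by rewrite ler_wpM2l ?subr_ge0.
Qed.

Lemma eps_of_gt0 n : (0 < n)%N -> 0 < eps_of n.
Proof. by move=> n0; rewrite divr_gt0 // ltr0n muln_gt0. Qed.

(** Each rescaling doubles the determinant up to the factor (1 + eps)^(-2n), which
    is at least (1 - eps)^(2n) >= 1 - 2 n eps = 9/10. *)
Lemma scale_growth n : (0 < n)%N -> 9 / 5 <= scale_of (eps_of n) ^+ n * 2.
Proof.
move=> n0; have e0 := eps_of_gt0 n0; set e := eps_of n in e0 *.
have ne : n%:R * e = 1 / 20.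
  rewrite /e /eps_of natrM; field; by rewrite pnatr_eq0 -lt0n.
have e1 : e <= 1.
  have : 1 * e <= n%:R * e by rewrite ler_wpM2r ?(ltW e0) // ler1n.
  by rewrite ne; lra.
have : 9 / 10 <= (1 - e) ^+ (2 * n).
  apply: le_trans (bernoulli _ _); last by rewrite (ltW e0).
  by rewrite natrM -mulrA ne; lra.
have -> : scale_of e ^+ n = ((1 + e)^-1) ^+ (2 * n).
  by rewrite exprM /scale_of -expr2 mul1r exprVn.
have : (1 - e) ^+ (2 * n) <= (1 + e)^-1 ^+ (2 * n).
  apply: lerXn2r; rewrite ?nnegrE ?subr_ge0 ?invr_ge0 ?addr_ge0 ?(ltW e0) //.
  rewrite -div1r ler_pdivlMr ?addr_gt0 //.
  by have : 0 <= e * e by [rewrite mulr_ge0 // ltW]; lra.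
lra.
Qed.

(** As ln (9/5) >= 4/9, this many factors 9/5 make up max(2, n / delta)^(8n). *)
Definition nb_phases (n : nat) (delta : R) : nat :=
  (Num.truncn (18 * n%:R * safe_log (n%:R / delta))).+1.

Lemma safe_log_ge (x : R) : 1 / 2 <= safe_log x.
Proof.
apply: (@le_trans _ _ (ln 2)); last first.
  by rewrite /safe_log ler_ln ?posrE ?lt_max ?ltr0n // le_max lexx.
have : ln (1 + (- (1 / 2))) <= - (1 / 2) :> R by apply: le_ln1Dx; lra.
have -> : 1 + - (1 / 2) = 2^-1 :> R by lra.
by rewrite lnV ?posrE //; lra.
Qed.

Lemma nb_phases_le n (delta : R) : (0 < n)%N ->
  (nb_phases n delta)%:R <= 20 * n%:R * safe_log (n%:R / delta).
Proof.
move=> n0; have l := safe_log_ge (n%:R / delta).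
have n1 : 1 <= n%:R :> R by rewrite ler1n.
have nl : 1 / 2 <= n%:R * safe_log (n%:R / delta).
  by rewrite -[X in X <= _]mul1r ler_pM //; lra.
rewrite /nb_phases -natr1.
have : (Num.truncn (18 * n%:R * safe_log (n%:R / delta)))%:R <=
    18 * n%:R * safe_log (n%:R / delta) by rewrite truncn_le; lra.
by lra.
Qed.

Lemma nb_phases_growth n (delta : R) : (0 < n)%N ->
  Num.max 2 (n%:R / delta) ^+ (8 * n) <= (9 / 5) ^+ nb_phases n delta.
Proof.
move=> n0; set m := Num.max _ _.
have m0 : 0 < m by rewrite lt_max ltr0n.
rewrite -ler_ln ?posrE ?exprn_gt0 // !lnXn //.
have l95 : 4 / 9 <= ln (9 / 5) :> R.
  have : ln (1 + (- (4 / 9))) <= - (4 / 9) :> R by apply: le_ln1Dx; lra.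
  have -> : 1 + - (4 / 9) = (9 / 5)^-1 :> R by lra.
  by rewrite lnV ?posrE //; lra.
have lm : 1 / 2 <= ln m by exact: safe_log_ge.
have : 18 * n%:R * ln m < (nb_phases n delta)%:R.
  by rewrite /nb_phases /safe_log -/m truncnS_gt.
move=> tl; rewrite -(mulr_natr (ln m)) -(mulr_natr (ln (9 / 5))) natrM.
apply: (@le_trans _ _ (4 / 9 * (nb_phases n delta)%:R)); last by rewrite ler_wpM2r.
by lra.
Qed.

End Phases.

(** * A program logic with cost bounds *)

Fixpoint rel2 (A B : Type) (P : A -> B -> Prop) (l : seq A) (m : seq B) : Prop :=
  match l, m with
  | [::], [::] => True
  | a :: l', b :: m' => P a b /\ rel2 P l' m'
  | _, _ => False
  end.

Section Rel2.
Variables (A B : Type).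
Implicit Types (P : A -> B -> Prop) (l : seq A) (m : seq B).

Lemma rel2_size P l m : rel2 P l m -> size l = size m.
Proof. by elim: l m => [|a l IH] [|b m] //= [_ /IH->]. Qed.

Lemma rel2_imp P P' l m : (forall a b, P a b -> P' a b) -> rel2 P l m -> rel2 P' l m.
Proof. by move=> h; elim: l m => [|a l IH] [|b m] //= [/h ? /IH]. Qed.

Lemma rel2_cat P l l' m m' : rel2 P l m -> rel2 P l' m' -> rel2 P (l ++ l') (m ++ m').
Proof. by move=> + h; elim: l m => [|a l IH] [|b m] //= [? /IH]. Qed.

Lemma rel2_rcons P l m a b : rel2 P l m -> P a b -> rel2 P (rcons l a) (rcons m b).
Proof. by move=> h ab; rewrite -!cats1; apply: rel2_cat. Qed.

Lemma rel2_rconsP P l m b : rel2 P l (rcons m b) ->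
  exists l' a, [/\ l = rcons l' a, rel2 P l' m & P a b].
Proof.
elim: l m => [|a l IH] [|b' m] //=.
  by case: l {IH} => [|a' l] [ab //] _; exists [::], a.
by move=> [ab /IH[l' [a' [-> lm ab']]]]; exists (a :: l'), a'.
Qed.

Lemma rel2_sum (R : nmodType) P l m (F : A -> R) (G : B -> R) : rel2 P l m ->
  (forall a b, P a b -> F a = G b) -> \sum_(a <- l) F a = \sum_(b <- m) G b.
Proof.
move=> + h; elim: l m => [|a l IH] [|b m] //=; first by rewrite !big_nil.
by move=> [/h ab /IH lm]; rewrite !big_cons ab lm.
Qed.

End Rel2.

Lemma rel2_map_r (A B C : Type) (P : A -> C -> Prop) (F : B -> C) l m :
  rel2 (fun a b => P a (F b)) l m -> rel2 P l (map F m).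
Proof. by elim: l m => [|a l IH] [|b m] //= [? /IH]. Qed.

Lemma rel2_choice (A B C : Type) (P : A -> B -> C -> Prop) l m :
  rel2 (fun a b => exists c, P a b c) l m ->
  exists us : seq (B * C), map fst us = m /\ rel2 (fun a u => P a u.1 u.2) l us.
Proof.
elim: l m => [|a l IH] [|b m] //=; first by exists [::].
by move=> [[c abc] /IH[us [<- h]]]; exists ((b, c) :: us).
Qed.

Lemma rel2_all (A : Type) (B : eqType) (P : A -> B -> Prop) (Q : B -> Prop) l m :
  rel2 P l m -> (forall a b, P a b -> Q b) -> forall b, b \in m -> Q b.
Proof.
move=> + h; elim: l m => [|a l IH] [|b m] //= [/h Qb /IH hm] c.
by rewrite inE => /orP[/eqP->|/hm].
Qed.

Lemma rel2_and (A : Type) (B : eqType) (P : A -> B -> Prop) (Q : B -> Prop) l m :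
  rel2 P l m -> (forall b, b \in m -> Q b) -> rel2 (fun a b => P a b /\ Q b) l m.
Proof.
elim: l m => [|a l IH] [|b m] //= [h1 h2] h.
split; first by split=> //; apply: h; rewrite mem_head.
by apply: IH => // w' wi; apply: h; rewrite inE wi orbT.
Qed.

Lemma rel2_tnth (A B : Type) (P : A -> B -> Prop) (Q : A -> Prop) l m :
  rel2 P l m -> (forall a b, P a b -> Q a) -> forall i, Q (tnth (in_tuple l) i).
Proof.
move=> h hQ i; rewrite (tnth_nth (tnth (in_tuple l) i)) /=.
have : (i < size l)%N by exact: ltn_ord.
move: (tnth _ i) (nat_of_ord i) => a0 {}i.
by elim: l m i h => [|a l IH] [|b m] [|i] //= [ab lm]; [move=> _; apply: hQ ab|apply: IH lm].
Qed.

Lemma rel2_refl (A : Type) (l : seq A) : rel2 eq l l.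
Proof. by elim: l. Qed.

(** A single term for the dimension, as an atom of cost expressions. *)
Definition dim (V : finType) : nat := #|V|.

Section Logic.
Variables (R : realType) (V : finType) (f : {set V} -> int).
Implicit Types (s : state R) (c q : nat).

Definition ext s s' := exists l, Defs.mem s' = Defs.mem s ++ l.

Lemma ext_refl s : ext s s.
Proof. by exists [::]; rewrite cats0. Qed.

Lemma ext_trans s1 s2 s3 : ext s1 s2 -> ext s2 s3 -> ext s1 s3.
Proof. by move=> [l h] [l' h']; exists (l ++ l'); rewrite h' h catA. Qed.

(** Requiring the address to be allocated makes the assertion stable when the
    memory grows. *)
Definition has_val s (a : addr) (x : R) := (a < size (Defs.mem s))%N /\ val_at s a = x.
Definition has_vec s (v : vec V) (x : V -> R) := forall u, has_val s (v u) (x u).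
Definition has_mat s (M : mat V) (X : V -> V -> R) := forall u, has_vec s (M u) (X u).

Lemma has_ext s s' a x : ext s s' -> has_val s a x -> has_val s' a x.
Proof.
move=> [l h] [lt_a xE]; rewrite /has_val /val_at h size_cat nth_cat lt_a.
by split; first exact: ltn_addr.
Qed.

Lemma vec_ext s s' v x : ext s s' -> has_vec s v x -> has_vec s' v x.
Proof. by move=> e h u; apply: has_ext e (h u). Qed.

Lemma mat_ext s s' M X : ext s s' -> has_mat s M X -> has_mat s' M X.
Proof. by move=> e h u; apply: vec_ext e (h u). Qed.

Lemma iter_wp_mono (S B : Type) body (Q Q' : B -> state R -> Prop) (x : S) s :
  (forall b s', Q b s' -> Q' b s') -> iter_wp body Q x s -> iter_wp body Q' x s.
Proof.
move=> h; elim=> {}x {}s P hb _ IH hQ.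
by apply: (IterStep hb) => // b s' /hQ/h.
Qed.

Lemma wp_mono (A : Type) (p : prog V A) s (Q Q' : A -> state R -> Prop) :
  (forall a s', Q a s' -> Q' a s') -> wp f p s Q -> wp f p s Q'.
Proof.
elim: p s Q Q' => [B b|B C p IHp k IHk|S B body IH x|i|a b|] s Q Q' h /=.
- exact: h.
- by apply: IHp => b s'; apply: IHk.
- exact: iter_wp_mono.
- exact: h.
- exact: h.
- by move=> hb b; apply: h.
Qed.

(** Total correctness with additive bounds on the cost. That the memory only grows
    is part of the conclusion, so that earlier assertions remain available. *)
Definition tri (A : Type) (p : prog V A) s c q (P : A -> state R -> Prop) :=
  wp f p s (fun r s' => [/\ ext s s', (ops s' <= ops s + c)%N,
                            (queries s' <= queries s + q)%N & P r s']).

Lemma tri_imp (A : Type) (p : prog V A) s c q c' q' (P P' : A -> state R -> Prop) :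
  tri p s c q P -> (c <= c')%N -> (q <= q')%N ->
  (forall r s', ext s s' -> P r s' -> P' r s') -> tri p s c' q' P'.
Proof.
move=> h cc qq hP; apply: wp_mono h => r s' [e hc hq Pr]; split=> //; last exact: hP.
  by lia.
by lia.
Qed.

Lemma tri_cost (A : Type) (p : prog V A) s c q c' q' (P : A -> state R -> Prop) :
  tri p s c q P -> (c <= c')%N -> (q <= q')%N -> tri p s c' q' P.
Proof. by move=> h cc qq; apply: tri_imp h cc qq _. Qed.

Lemma tri_ret (A : Type) (x : A) s c q (P : A -> state R -> Prop) :
  P x s -> tri (Ret x) s c q P.
Proof. by move=> Px; split; rewrite ?leq_addr //; apply: ext_refl. Qed.

Lemma tri_bind (A B : Type) (p : prog V A) (k : A -> prog V B) s c q c1 q1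
    (P1 : A -> state R -> Prop) (P : B -> state R -> Prop) :
  tri p s c1 q1 P1 ->
  (forall r s', ext s s' -> P1 r s' -> tri (k r) s' (c - c1) (q - q1) P) ->
  (c1 <= c)%N -> (q1 <= q)%N -> tri (Bind p k) s c q P.
Proof.
move=> h hk cc qq; apply: wp_mono h => r s' [e hc hq Pr].
apply: wp_mono (hk r s' e Pr) => r' s'' [e' hc' hq' Pr'].
by split=> //; [exact: ext_trans e e'|lia|lia].
Qed.

(** The form of [tri_bind] for long programs: the costs are synthesized, to be
    compared with a bound once at the end. *)
Lemma tri_seq (A B : Type) (p : prog V A) (k : A -> prog V B) s c1 q1 c2 q2
    (P1 : A -> state R -> Prop) (P : B -> state R -> Prop) :
  tri p s c1 q1 P1 ->
  (forall r s', ext s s' -> P1 r s' -> tri (k r) s' c2 q2 P) ->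
  tri (Bind p k) s (c1 + c2) (q1 + q2) P.
Proof.
move=> h hk; apply: tri_bind h _ _ _; rewrite ?leq_addr // => r s' e Pr.
by rewrite !addKn; apply: hk.
Qed.

Lemma tri_done (A : Type) (x : A) s (P : A -> state R -> Prop) :
  P x s -> tri (Ret x) s 0 0 P.
Proof. exact: tri_ret. Qed.

Lemma tri_bind_ret (A B : Type) (p : prog V A) (k : A -> B) s c q
    (P : B -> state R -> Prop) :
  tri p s c q (fun r => P (k r)) -> tri (Bind p (fun r => Ret (k r))) s c q P.
Proof. by move=> h; apply: wp_mono h. Qed.

Lemma tri_do (i : instr V) s : (if i is Query _ then False else True) ->
  tri (Do i) s 1 0 (fun a s' => has_val s' a (Defs.eval f s i)).
Proof.
move=> hi; have e s' : Defs.mem s' = rcons (Defs.mem s) (Defs.eval f s i) ->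
    ext s s' /\ has_val s' (size (Defs.mem s)) (Defs.eval f s i).
  move=> h; split; first by exists [:: Defs.eval f s i]; rewrite cats1.
  by rewrite /has_val /val_at h size_rcons ltnSn nth_rcons ltnn eqxx.
rewrite /tri /=; have [e1 e2] : ext s (exec f s i) /\
    has_val (exec f s i) (size (Defs.mem s)) (Defs.eval f s i) by apply: e; case: (i).
by split=> //; case: i hi {e e1 e2} => //= *; rewrite ?addn1 ?addn0.
Qed.

Lemma tri_query (X : {set V}) s :
  tri (Do (Query X)) s 0 1 (fun a s' => has_val s' a (toR R f X)).
Proof.
split=> /=; rewrite ?addn0 ?addn1 //.
  by exists [:: (f X)%:~R]; rewrite cats1.
by rewrite /has_val /val_at /= size_rcons ltnSn nth_rcons ltnn eqxx.
Qed.

Lemma tri_int (z : int) s : tri (Do (Int z)) s 1 0 (fun a s' => has_val s' a z%:~R).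
Proof. exact: (@tri_do (Int z)). Qed.

Lemma tri_add s a b x y : has_val s a x -> has_val s b y ->
  tri (Do (Add a b)) s 1 0 (fun r s' => has_val s' r (x + y)).
Proof. by move=> [_ <-] [_ <-]; apply: (@tri_do (Add a b)). Qed.

Lemma tri_sub s a b x y : has_val s a x -> has_val s b y ->
  tri (Do (Defs.Sub a b)) s 1 0 (fun r s' => has_val s' r (x - y)).
Proof. by move=> [_ <-] [_ <-]; apply: (@tri_do (Defs.Sub a b)). Qed.

Lemma tri_mul s a b x y : has_val s a x -> has_val s b y ->
  tri (Do (Mul a b)) s 1 0 (fun r s' => has_val s' r (x * y)).
Proof. by move=> [_ <-] [_ <-]; apply: (@tri_do (Mul a b)). Qed.

Lemma tri_div s a b x y : has_val s a x -> has_val s b y ->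
  tri (Do (Div a b)) s 1 0 (fun r s' => has_val s' r (x / y)).
Proof. by move=> [_ <-] [_ <-]; apply: (@tri_do (Div a b)). Qed.

Lemma tri_sqrt s a x : has_val s a x ->
  tri (Do (Sqrt a)) s 1 0 (fun r s' => has_val s' r (Num.sqrt x)).
Proof. by move=> [_ <-]; apply: (@tri_do (Sqrt a)). Qed.

Lemma tri_test s a b x y : has_val s a x -> has_val s b y ->
  tri (Test a b) s 1 0 (fun r _ => r = (x < y)).
Proof.
move=> [_ <-] [_ <-]; split=> //=; rewrite ?addn0 ?addn1 //.
by exists [::]; rewrite cats0.
Qed.

Lemma tri_flip s c q : tri Flip s c q (fun _ _ => True).
Proof. by move=> b; split; rewrite ?leq_addr //; apply: ext_refl. Qed.

Lemma tri_foldM (A B : Type) (F : A -> B -> prog V A) (I : seq B -> A -> state R -> Prop)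
    l x s c q :
  (forall d b r x' s', l = d ++ b :: r -> ext s s' -> I d x' s' ->
     tri (F x' b) s' c q (I (rcons d b))) ->
  I [::] x s -> tri (foldM F x l) s (size l * c) (size l * q) (I l).
Proof.
move=> hF I0; suff H d r y s' : l = d ++ r -> ext s s' -> I d y s' ->
    tri (foldM F y r) s' (size r * c) (size r * q) (I l) by apply: (H [::]) => //; apply: ext_refl.
elim: r d y s' => [|b r IH] d y s' lE e Iy /=.
  by apply: tri_ret; rewrite lE cats0.
apply: tri_bind (hF _ _ _ _ _ lE e Iy) _ _ _; rewrite ?mulSn ?leq_addr //.
move=> y' s'' e' Iy'; rewrite !addKn; apply: IH Iy'; first by rewrite lE cat_rcons.
exact: ext_trans e e'.
Qed.

Lemma tri_foldM_rel (A B G : Type) (F : A -> B -> prog V A) (r : state R -> B -> G -> Prop)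
    (I : seq G -> A -> state R -> Prop) l m x s c q :
  (forall s1 s2 b g, ext s1 s2 -> r s1 b g -> r s2 b g) ->
  rel2 (r s) l m ->
  (forall d g u b x' s', m = d ++ g :: u -> ext s s' -> r s' b g -> I d x' s' ->
     tri (F x' b) s' c q (I (rcons d g))) ->
  I [::] x s -> tri (foldM F x l) s (size l * c) (size l * q) (I m).
Proof.
move=> mr + hF I0.
suff hind d m' s' y : m = d ++ m' -> ext s s' -> rel2 (r s') l m' -> I d y s' ->
    tri (foldM F y l) s' (size l * c) (size l * q) (I m).
  by move=> lm; apply: (hind [::] m) => //; apply: ext_refl.
elim: l d m' s' y => [|b l IH] d [|g m'] s' y mE e //=.
  by move=> _ Iy; apply: tri_ret; rewrite mE cats0.
move=> [bg lm] Iy; apply: tri_bind (hF _ _ _ _ _ _ mE e bg Iy) _ _ _; rewrite ?mulSn ?leq_addr //.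
move=> y' s'' e' Iy'; rewrite !addKn; apply: IH Iy'; first by rewrite mE cat_rcons.
  exact: ext_trans e e'.
by apply: rel2_imp lm => b' g'; apply: mr.
Qed.

Lemma tri_mapM (A B G H : Type) (F : A -> prog V B) (r : state R -> A -> G -> Prop)
    (r' : state R -> B -> H -> Prop) (phi : G -> H) l m s c q :
  (forall s1 s2 a g, ext s1 s2 -> r s1 a g -> r s2 a g) ->
  (forall s1 s2 b h, ext s1 s2 -> r' s1 b h -> r' s2 b h) ->
  (forall a g s', ext s s' -> r s' a g ->
     tri (F a) s' c q (fun b s'' => r' s'' b (phi g))) ->
  rel2 (r s) l m ->
  tri (mapM F l) s (size l * c) (size l * q) (fun k s' => rel2 (r' s') k (map phi m)).
Proof.
move=> mr mr' hF; suff hind s0 : ext s s0 -> rel2 (r s0) l m ->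
    tri (mapM F l) s0 (size l * c) (size l * q) (fun k s' => rel2 (r' s') k (map phi m)).
  by apply: hind; apply: ext_refl.
elim: l m s0 => [|a l IH] [|g m] s0 e //=; first by move=> _; apply: tri_ret.
move=> [ag lm]; apply: tri_bind (hF _ _ _ e ag) _ _ _; rewrite ?mulSn ?leq_addr //.
move=> b s1 e1 bg; rewrite !addKn.
apply: tri_bind_ret; apply: tri_imp (IH m s1 (ext_trans e e1) _) _ _ _ => //.
  by apply: rel2_imp lm => a' g'; apply: mr.
by move=> k s2 e2 km; split=> //; apply: mr' e2 _.
Qed.

Lemma tri_gen (A : Type) (d : A) (F : V -> prog V A) (P : V -> A -> state R -> Prop) s c q :
  (forall v a s1 s2, ext s1 s2 -> P v a s1 -> P v a s2) ->
  (forall v s', ext s s' -> tri (F v) s' c q (P v)) ->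
  tri (gen d F) s (dim V * c) (dim V * q) (fun x s' => forall v, P v (x v) s').
Proof.
move=> mP hF; rewrite /dim cardE.
pose I (l : seq V) (x : V -> A) (s' : state R) := forall v, v \in l -> P v (x v) s'.
have h : tri (gen d F) s (size (enum V) * c) (size (enum V) * q) (I (enum V)).
  apply: tri_foldM => // l b r x s' _ e Ix.
  apply: tri_bind_ret; apply: tri_imp (hF b _ e) _ _ _ => // a s1 e1 Pa v.
  rewrite mem_rcons inE /upd.
  by case: eqP => [->|_] //= /Ix; apply: mP.
apply: tri_imp h _ _ _ => // x s' _ Ix v; apply: Ix; exact: mem_enum.
Qed.

Lemma tri_genv (F : V -> prog V addr) (x : V -> R) s c q :
  (forall v s', ext s s' -> tri (F v) s' c q (fun a s'' => has_val s'' a (x v))) ->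
  tri (genv F) s (dim V * c) (dim V * q) (fun v s' => has_vec s' v x).
Proof.
move=> hF; apply: (@tri_gen _ 0%N F (fun v a s' => has_val s' a (x v))) => //.
by move=> v a s1 s2; apply: has_ext.
Qed.

Lemma tri_genm (F : V -> V -> prog V addr) (X : V -> V -> R) s c q :
  (forall u v s', ext s s' -> tri (F u v) s' c q (fun a s'' => has_val s'' a (X u v))) ->
  tri (genm F) s (dim V * (dim V * c)) (dim V * (dim V * q)) (fun M s' => has_mat s' M X).
Proof.
move=> hF; apply: (@tri_gen _ (fun=> 0%N) _ (fun v a s' => has_vec s' a (X v))).
  by move=> v a s1 s2; apply: vec_ext.
by move=> v s' e; apply: tri_genv => u s'' e'; apply: hF; apply: ext_trans e e'.
Qed.

Lemma tri_sumM (A B : Type) (F : A -> prog V addr) (r : state R -> A -> B -> Prop)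
    (phi : B -> R) l m s c q :
  (forall s1 s2 a g, ext s1 s2 -> r s1 a g -> r s2 a g) ->
  (forall a b s', ext s s' -> r s' a b ->
     tri (F a) s' c q (fun x s'' => has_val s'' x (phi b))) ->
  rel2 (r s) l m ->
  tri (sumM F l) s (size l * c.+1).+1 (size l * q)
    (fun x s' => has_val s' x (\sum_(b <- m) phi b)).
Proof.
move=> mr hF lm; apply: tri_bind (tri_int 0 s) _ _ _ => // z s0 e0 z0.
rewrite subSS !subn0.
suff H (t : R) s1 acc : ext s s1 -> has_val s1 acc t -> rel2 (r s1) l m ->
    tri (foldM (fun acc a => (t <- F a;; Do (Add acc t))%prog) acc l) s1
      (size l * c.+1) (size l * q)
      (fun x s' => has_val s' x (t + \sum_(b <- m) phi b)).
  rewrite -[\sum_(b <- m) phi b]add0r; apply: H => //.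
  by apply: rel2_imp lm => a b; apply: mr.
elim: l m t s1 acc {lm z s0 e0 z0} => [|a l IH] [|b m] t s1 acc e ha //=.
  by move=> _; apply: tri_ret; rewrite big_nil addr0.
move=> [ab lm]; apply: (@tri_bind _ _ _ _ _ _ _ c.+1 q (fun x s' => has_val s' x (t + phi b))).
- apply: tri_bind (hF _ _ _ e ab) _ _ _ => [x s2 e2 hx||] //.
  by apply: tri_cost (tri_add (has_ext e2 ha) hx) _ _; rewrite ?subSnn ?subnn.
- move=> acc' s2 e2 h2; rewrite mulSn addKn mulSn addKn big_cons addrA.
  apply: IH => //; first exact: ext_trans e e2.
  by apply: rel2_imp lm => a' b'; apply: mr.
- by rewrite mulSn leq_addr.
- by rewrite mulSn leq_addr.
Qed.

(** Loops are proved total by a variant [k] that bounds the number of further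
    iterations. *)
Lemma tri_iter (S B : Type) (body : S -> prog V (S + B)) (I : nat -> S -> state R -> Prop)
    (P : B -> state R -> Prop) k x s c q :
  (forall k x s', ext s s' -> I k x s' -> tri (body x) s' c q (fun r s'' =>
     match r with
     | inl x' => exists2 k', k = k'.+1 & I k' x' s''
     | inr b => P b s''
     end)) ->
  I k x s -> tri (Iter body x) s (k.+1 * c) (k.+1 * q) P.
Proof.
move=> hb; suff H s0 x0 : ext s s0 -> I k x0 s0 ->
    tri (Iter body x0) s0 (k.+1 * c) (k.+1 * q) P by apply: H; apply: ext_refl.
elim: k s0 x0 => [|k IH] s0 x0 e I0; apply: IterStep (hb _ _ _ e I0) _ _ => /=.
- by move=> x' s' [_ _ _ []].
- by move=> b s' [e1 h1 h2 Pb]; split=> //; rewrite ?mul1n.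
- move=> x' s' [e1 h1 h2 [k' [<-] I']].
  apply: iter_wp_mono (IH _ _ (ext_trans e e1) I') => b s2 [e2 h3 h4 Pb].
  by split=> //; [exact: ext_trans e1 e2|rewrite mulSn; lia|rewrite mulSn; lia].
- move=> b s' [e1 h1 h2 Pb]; split=> //; rewrite mulSn; lia.
Qed.

End Logic.

(** Transports the assertions on the memory to an extension. *)
Ltac carry E :=
  match type of E with ext ?s ?s' => repeat match goal with
  | H : has_val s _ _ |- _ => apply (has_ext E) in H
  | H : has_vec s _ _ |- _ => apply (vec_ext E) in H
  | H : has_mat s _ _ |- _ => apply (mat_ext E) in H
  end end.


(** * Vector and matrix programs *)

Section VectorPrograms.
Variables (R : realType) (V : finType) (f : {set V} -> int).
Implicit Types (s : state R).
Local Notation n := (dim V).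
Local Notation "'tri' p s c q P" := (tri f p s c%N q%N P) (at level 10, p, s, c, q, P at level 9).

Lemma size_enumV : size (enum V) = n.
Proof. by rewrite /dim cardE. Qed.

Lemma tri_dot s x y (X Y : V -> R) : has_vec s x X -> has_vec s y Y ->
  tri (dot x y) s (2 * n + 1) 0 (fun a s' => has_val s' a (\sum_v X v * Y v)).
Proof.
move=> hx hy; rewrite -(big_enum _ _ _ (fun v => X v * Y v)) /=.
have := @tri_sumM R V f _ _ (fun v => Do (Mul (x v) (y v))) (fun=> eq)
  (fun v => X v * Y v) (enum V) (enum V) s 1 0.
rewrite size_enumV => h; apply: (tri_cost (h _ _ _)); rewrite ?muln0 //; last by lia.
  by move=> a b s' e <-; carry e; apply: tri_mul.
exact: rel2_refl.
Qed.

Lemma tri_mulmv s M x X (Y : {ffun V -> R}) : has_mat s M X -> has_vec s x Y ->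
  tri (mulmv M x) s (2 * (n * n) + n) 0 (fun v s' => has_vec s' v (app X Y)).
Proof.
move=> hM hx.
have h : tri (mulmv M x) s (n * (2 * n + 1)) (n * 0) (fun v s' => has_vec s' v (app X Y)).
  apply: tri_genv => v s' e; carry e; rewrite ffunE; apply: tri_dot => //.
by apply: tri_cost h _ _; lia.
Qed.

Lemma tri_inner s M x y X (Y Z : {ffun V -> R}) : has_mat s M X -> has_vec s x Y ->
  has_vec s y Z ->
  tri (Defs.inner M x y) s (2 * (n * n) + 3 * n + 1) 0
    (fun a s' => has_val s' a (dotp Y (app X Z))).
Proof.
move=> hM hx hy; apply: tri_bind (tri_mulmv hM hy) _ _ _; rewrite ?subn0; try lia.
by move=> v s' e hv; carry e; apply: tri_cost (tri_dot hx hv) _ _; lia.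
Qed.

Lemma tri_normQ s M x X (Y : {ffun V -> R}) : has_mat s M X -> has_vec s x Y ->
  tri (normQ M x) s (2 * (n * n) + 3 * n + 2) 0 (fun a s' => has_val s' a (nrm X Y)).
Proof.
move=> hM hx; apply: tri_bind (tri_inner hM hx hx) _ _ _; try lia.
by move=> v s' e hv; apply: tri_cost (tri_sqrt f hv) _ _; lia.
Qed.

Lemma tri_normalize s M x X (Y : {ffun V -> R}) : has_mat s M X -> has_vec s x Y ->
  tri (Defs.normalize M x) s (2 * (n * n) + 4 * n + 2) 0
    (fun v s' => has_vec s' v (nv X Y)).
Proof.
move=> hM hx; apply: tri_bind (tri_normQ hM hx) _ _ _; try lia.
move=> l s' e hl; carry e; apply: (@tri_cost _ _ _ _ _ _ (n * 1) (n * 0)); try lia.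
by apply: tri_genv => v s'' e'; carry e'; rewrite ffunE; apply: tri_div.
Qed.

Lemma tri_is_zero s x (X : {ffun V -> R}) : has_vec s x X ->
  tri (is_zero x) s (2 * n + 1) 0 (fun b _ => b = (X == 0)).
Proof.
move=> hx; apply: tri_bind (tri_int f 0 s) _ _ _; try lia.
move=> z s' e hz; carry e.
have h : tri (foldM (fun b v => lt <- Test (x v) z;; gt <- Test z (x v);;
     Ret [&& b, ~~ lt & ~~ gt])%prog true (enum V)) s' (size (enum V) * 2) (size (enum V) * 0)
    (fun b _ => b = all (fun v => X v == 0) (enum V)).
  apply: (tri_foldM (I := fun d b _ => b = all (fun v => X v == 0) d)) => //.
  move=> d v r b s1 _ e1 ->; carry e1.
  apply: tri_bind (tri_test f (hx v) hz) _ _ _ => // c s2 e2 ->; carry e2.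
  apply: tri_bind (tri_test f hz (hx v)) _ _ _ => // c' s3 e3 ->.
  by apply: tri_ret; rewrite all_rcons /= -!leNgt [RHS]andbC eq_le [(X v <= 0) && _]andbC.
rewrite size_enumV in h; apply: tri_imp h _ _ _; try lia.
move=> b s1 _ ->; apply/allP/eqP => [h|->].
  by apply/ffunP=> v; rewrite ffunE; apply/eqP/h; rewrite mem_enum.
by move=> v _; rewrite ffunE.
Qed.

Lemma tri_identity s :
  tri (identity V) s (n * n) 0 (fun M s' => has_mat s' M (idm R (V := V))).
Proof.
apply: (@tri_cost _ _ _ _ _ _ (n * (n * 1)) (n * (n * 0))); try lia.
apply: tri_genm => u v s' e; apply: tri_imp (tri_int f _ s') _ _ _ => // a s'' _.
by rewrite /idm; case: (u == v).
Qed.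

Lemma tri_pivot s M X k : has_mat s M X ->
  tri (pivot M k) s (3 * (n * n) + 3) 0 (fun N s' => has_mat s' N (pivot_mx X k)).
Proof.
move=> hM; apply: tri_bind (tri_int f 1 s) _ _ _; try lia.
move=> one s1 e1 h1; carry e1; apply: tri_bind (tri_int f 0 s1) _ _ _; try lia.
move=> z s2 e2 hz; carry e2; apply: tri_bind (tri_div f h1 (hM k k)) _ _ _; try lia.
move=> p s3 e3 hp; carry e3.
apply: (@tri_cost _ _ _ _ _ _ (n * (n * 3)) (n * (n * 0))); try lia.
apply: tri_genm => i j s4 e4; carry e4; rewrite /pivot_mx.
have [ik|ik] := eqVneq i k; have [jk|jk] := eqVneq j k.
- exact: tri_ret.
- apply: tri_bind (tri_mul f (hM k j) hp) _ _ _ => // t s5 e5 ht; carry e5.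
  by apply: tri_cost (tri_sub f hz ht) _ _.
- by apply: tri_cost (tri_mul f (hM i k) hp) _ _.
- apply: tri_bind (tri_mul f (hM k j) hp) _ _ _ => // t s5 e5 ht; carry e5.
  apply: tri_bind (tri_mul f (hM i k) ht) _ _ _ => // t' s6 e6 ht'; carry e6.
  by apply: tri_cost (tri_sub f (hM i j) ht') _ _.
Qed.

Lemma tri_inverse s M X : has_mat s M X ->
  tri (inverse M) s (3 * (n * n * n) + 3 * n) 0
    (fun N s' => has_mat s' N (foldl (@pivot_mx R V) X (enum V))).
Proof.
move=> hM.
have h : tri (inverse M) s (size (enum V) * (3 * (n * n) + 3)) (size (enum V) * 0)
    (fun N s' => has_mat s' N (foldl (@pivot_mx R V) X (enum V))).
  apply: (tri_foldM (I := fun d N s' => has_mat s' N (foldl (@pivot_mx R V) X d))) => //.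
  move=> d k r N s' _ _ hN; rewrite -cats1 foldl_cat /=; exact: tri_pivot.
by rewrite size_enumV in h; apply: tri_cost h _ _; lia.
Qed.

(** ** Orderings *)

Lemma tri_insertM (A : eqType) (le : A -> A -> prog V bool) (r : rel A) a l s c :
  (forall s' b, ext s s' ->
     tri (le a b) s' c 0 (fun t _ => if t then r a b else r b a)) ->
  tri (insertM le a l) s (size l * c) 0 (fun l' _ =>
      [/\ perm_eq l' (a :: l), sorted r l -> sorted r l' &
        forall b, r b a -> path r b l -> path r b l']).
Proof.
elim: l s => [|b l IH] s hle /=.
  by apply: tri_ret; split=> //= b ->.
apply: tri_bind (hle _ b (ext_refl s)) _ _ _; rewrite ?mulSn; try lia.
move=> [] s' e hab.
  by apply: tri_ret; split=> //= [->|b' -> /andP[_ ->]]; rewrite hab.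
rewrite addKn; apply: tri_bind_ret; apply: tri_imp (IH s' _) _ _ _ => //.
  by move=> s2 b2 e2; apply: hle; apply: ext_trans e e2.
move=> l' s2 _ [pl sl pathl]; split=> [|/pathl|b' _ /= /andP[-> /pathl]]; try exact.
rewrite -(perm_cons b) in pl; apply: perm_trans pl _.
by apply/permP=> P /=; rewrite addnCA.
Qed.

Lemma tri_sortM (A : eqType) (le : A -> A -> prog V bool) (r : rel A) l s c :
  (forall s' a b, ext s s' ->
     tri (le a b) s' c 0 (fun t _ => if t then r a b else r b a)) ->
  tri (sortM le l) s (size l * (size l * c)) 0 (fun l' _ => perm_eq l' l /\ sorted r l').
Proof.
move=> hle; rewrite -[0%N](muln0 (size l)).
apply: (tri_foldM (I := fun d l' _ => perm_eq l' d /\ sorted r l')) => //.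
move=> d b q l' s' lE e [pl sl].
have hi := @tri_insertM A le r b l' s' c; apply: tri_imp (hi _) _ _ _ => //.
- by move=> s2 a e2; apply: hle; apply: ext_trans e e2.
- rewrite leq_mul2r (perm_size pl) lE size_cat leq_addr orbT //.
- move=> l2 s2 _ [pl2 sl2 _]; split; last exact: sl2.
  by rewrite (perm_trans pl2) // -cats1 perm_sym perm_catC /= perm_cons perm_sym.
Qed.

Lemma perm_ordering (o : seq V) : perm_eq o (enum V) -> ordering o.
Proof.
move=> po; split; first by rewrite (perm_uniq po) enum_uniq.
by move=> v; rewrite (perm_mem po) mem_enum.
Qed.

Lemma tri_leM s a b (x y : R) : has_val s a x -> has_val s b y ->
  tri (leM V a b) s 2 0 (fun t _ => if t then x <= y else y <= x).
Proof.
move=> ha hb; apply: tri_bind (tri_test f ha hb) _ _ _ => // lt s1 e1 ->; carry e1.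
case: ltrP => [xy|yx]; first by apply: tri_ret; rewrite ltW.
apply: tri_bind (tri_test f hb ha) _ _ _ => // gt s2 e2 ->.
case: ltrP => [yx'|xy]; first by apply: tri_ret.
by apply: tri_imp (tri_flip f _ 0 0) _ _ _ => // -[].
Qed.

Lemma tri_order_by s w (W : V -> R) : has_vec s w W ->
  tri (order_by w) s (2 * (n * n)) 0 (fun o _ =>
    ordering o /\ sorted (fun u v => W u <= W v) o).
Proof.
move=> hw; have := @tri_sortM V (fun u v => leM V (w u) (w v)) (fun u v => W u <= W v)
  (enum V) s 2; rewrite size_enumV => h.
apply: tri_imp (h _) _ _ _; try lia.
  by move=> s' u v e; carry e; apply: tri_leM.
by move=> o s' _ [/perm_ordering].
Qed.

Lemma tri_any_order s : tri (any_order V) s 0 0 (fun o _ => ordering o).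
Proof.
have := @tri_sortM V (fun u v => Flip) (fun _ _ => true) (enum V) s 0.
rewrite size_enumV => h; apply: tri_imp (h _) _ _ _; rewrite ?muln0 //.
  by move=> s' u v e; apply: tri_imp (tri_flip f _ 0 0) _ _ _ => // -[].
by move=> o s' _ [/perm_ordering].
Qed.

(** ** The greedy routine *)

Lemma tri_shifted s mu (m : R) X : has_val s mu m ->
  tri (shifted mu X) s 1 1 (fun a s' => has_val s' a (shift f m X)).
Proof.
move=> hm; rewrite /shifted /shift; case: ifP => _.
  exact: tri_cost (tri_int f 0 s) _ _.
apply: tri_bind (tri_query f X s) _ _ _ => // a s' e ha; carry e.
by apply: tri_cost (tri_add f ha hm) _ _.
Qed.

Lemma tri_greedy (h : {set V} -> prog V addr) (H : {set V} -> R) o s c :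
  H set0 = 0 -> ordering o ->
  (forall X s', ext s s' -> tri (h X) s' c 1 (fun a s'' => has_val s'' a (H X))) ->
  tri (greedy h o) s (n * c.+1 + c) (n + 1) (fun x s' =>
    exists2 g : {ffun V -> R}, has_vec s' x g & tight H g o).
Proof.
move=> H0 [uo oV] hh; have so : size o = n.
  rewrite /dim -(card_uniqP uo); apply: eq_card => v; rewrite oV; exact: erefl.
apply: tri_bind (hh set0 s (ext_refl s)) _ _ _; try lia.
move=> h0 s0 e0 hh0; rewrite addnK addnK.
pose I (d : seq V) (a : {set V} * addr * (V -> addr)) (s' : state R) :=
  [/\ a.1.1 = [set:: d], has_val s' a.1.2 (H a.1.1) &
      exists g : {ffun V -> R}, (forall v, v \in d -> has_val s' (a.2 v) (g v)) /\
        forall p q, d = p ++ q -> \sum_(v <- p) g v = H [set:: p]].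
have loop : tri (foldM (fun '(X, hX, x) v =>
      (let X' := v |: X in
      hX' <- h X';;
      d <- Do (Defs.Sub hX' hX);;
      Ret (X', hX', upd x v d))%prog) (set0, h0, fun=> 0%N) o) s0 (size o * c.+1) (size o * 1) (I o).
  apply: tri_foldM; last first.
    split; [by rewrite set_nil|exact: hh0|].
    exists 0; split=> // -[|//] q _; by rewrite big_nil set_nil H0.
  move=> d v r [[X hX] x] s1 oE e1 [/= XE hX1 [g [gx gd]]].
  apply: tri_bind (hh (v |: X) s1 (ext_trans e0 e1)) _ _ _; try lia.
  move=> hX' s2 e2 h2; carry e2.
  apply: tri_bind (tri_sub f h2 hX1) _ _ _; try lia.
  move=> a s3 e3 h3; carry e3; apply: tri_ret; split=> //=.
    by rewrite set_rcons XE.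
  have vd : v \notin d.
    by move: uo; rewrite oE cat_uniq => /and3P[_ /hasPn/(_ v (mem_head _ _))].
  exists [ffun u => if u == v then H (v |: X) - H X else g u]; split=> [u|p q].
    rewrite mem_rcons inE ffunE /upd; case: eqP => //= _ /gx gu.
    exact: has_ext e3 (has_ext e2 gu).
  case/lastP: q => [|q w]; last first.
    rewrite -rcons_cat => /rcons_inj[dE _]; rewrite -(gd p q dE).
    apply: eq_big_seq => u up; rewrite ffunE; case: eqP => // uv.
    by move: vd; rewrite dE mem_cat -uv up.
  rewrite cats0 => <-; rewrite -cats1 big_cat big_seq1 /= ffunE eqxx cats1 set_rcons.
  have -> : \sum_(u <- d) [ffun u => if u == v then H (v |: X) - H X else g u] u = H X.
    rewrite XE -(gd d [::]) ?cats0 //; apply: eq_big_seq => u ud; rewrite ffunE.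
    by case: eqP => // uv; rewrite -uv ud in vd.
  by rewrite XE addrC subrK.
rewrite so muln1 in loop; apply: tri_bind loop _ _ _; try lia.
move=> [[X hX] x] s1 _ [_ _ [g [gx gt]]] /=; apply: tri_ret.
by exists g => // v; apply: gx.
Qed.

Lemma tri_min_set (h : {set V} -> prog V addr) (H : {set V} -> R) o s c :
  ordering o ->
  (forall X s', ext s s' -> tri (h X) s' c 1 (fun a s'' => has_val s'' a (H X))) ->
  tri (min_set h o) s (n * (c + 2) + c) (n + 1) (fun W _ =>
    [/\ H W <= H set0, forall p q, o = p ++ q -> H W <= H [set:: p] &
        W = set0 \/ exists p q, o = p ++ q /\ W = [set:: p]]).
Proof.
move=> [uo oV] hh; have so : size o = n.
  rewrite /dim -(card_uniqP uo); apply: eq_card => v; rewrite oV; exact: erefl.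
apply: tri_bind (hh set0 s (ext_refl s)) _ _ _; try lia.
move=> h0 s0 e0 hh0; rewrite addnK addnK.
pose I (d : seq {set V}) (a : {set V} * addr) (s' : state R) :=
  [/\ has_val s' a.2 (H a.1), H a.1 <= H set0, forall X, X \in d -> H a.1 <= H X &
      a.1 = set0 \/ a.1 \in d].
have loop : tri (foldM (fun '(X, hX) X' =>
      (hX' <- h X';;
      c <- leM V hX hX';;
      Ret (if c then (X, hX) else (X', hX')))%prog) (set0, h0) (prefixes o)) s0
    (size (prefixes o) * (c + 2)) (size (prefixes o) * 1) (I (prefixes o)).
  apply: tri_foldM; last by split=> //; left.
  move=> d X' r [X hX] s1 _ e1 [/= hX1 le0 led Xd].
  apply: tri_bind (hh X' s1 (ext_trans e0 e1)) _ _ _; try lia.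
  move=> hX' s2 e2 h2; carry e2.
  apply: tri_bind (tri_leM hX1 h2) _ _ _; try lia.
  move=> b s3 e3 hb; carry e3; apply: tri_ret; case: b hb => hb; split=> //=.
  - by move=> Y; rewrite mem_rcons inE => /orP[/eqP->|/led].
  - by case: Xd => [->|Xd]; [left|right]; rewrite ?mem_rcons ?inE ?Xd ?orbT.
  - exact: le_trans hb le0.
  - move=> Y; rewrite mem_rcons inE => /orP[/eqP->|/led] //; exact: le_trans.
  - by right; rewrite mem_rcons mem_head.
rewrite size_map size_iota so muln1 in loop; apply: tri_bind loop _ _ _; try lia.
move=> [X hX] s1 _ [/= _ le0 led Xd]; apply: tri_ret; split=> //.
  move=> p q oE; case: p oE => [|v p] oE; first by rewrite set_nil.
  apply: led; apply/mapP; exists (size p).+1; last by rewrite oE take_size_cat.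
  by rewrite mem_iota oE size_cat /=; lia.
case: Xd => [|/mapP[i _ ->]]; [by left|right].
by exists (take i o), (drop i o); rewrite cat_take_drop.
Qed.

End VectorPrograms.

(** * Sliding von Neumann *)

Section SlidingVonNeumann.
Variables (R : realType) (V : finType) (f : {set V} -> int).
Hypothesis n_gt0 : (0 < #|V|)%N.
Implicit Types (s : state R) (ts : seq ({ffun V -> R} * R)).
Local Notation n := (dim V).
Local Notation "'tri' p s c q P" := (tri f p s c%N q%N P)
  (at level 10, p, s, c, q, P at level 9).

Definition has_term s (t : vec V * addr) (g : {ffun V -> R} * R) :=
  has_vec s t.1 g.1 /\ has_val s t.2 g.2.
Definition has_terms s (l : seq (vec V * addr)) ts := rel2 (has_term s) l ts.

Lemma term_ext s s' t g : ext s s' -> has_term s t g -> has_term s' t g.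
Proof. by move=> e [h1 h2]; split; [exact: vec_ext e h1|exact: has_ext e h2]. Qed.

Lemma terms_ext s s' l ts : ext s s' -> has_terms s l ts -> has_terms s' l ts.
Proof. by move=> e; apply: rel2_imp => t g; apply: term_ext. Qed.

Lemma dim_gt0 : (0 < n)%N.
Proof. exact: n_gt0. Qed.

Lemma greedy_le0 m g o (w : V -> R) : ordering o -> tight (shift f m) g o ->
  sorted (fun u v => w u <= w v) o ->
  (forall p q, o = p ++ q -> 0 <= shift f m [set:: p]) -> \sum_v w v * g v <= 0.
Proof.
move=> oo t so hp; have [v0 _] := card_gt0P n_gt0.
have := greedy_abel t so (shift0 f m) hp v0.
by rewrite (ordering_set oo) shiftT mulr0 sum_ordering.
Qed.

(** A positive product exhibits a violated prefix, hence a smaller minimizer; the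
    slide then makes every prefix nonnegative again. *)
Lemma tri_slide s mu m o gv (g : {ffun V -> R}) (w : V -> R) : has_val s mu m -> has_vec s gv g ->
  ordering o -> tight (shift f m) g o -> sorted (fun u v => w u <= w v) o ->
  0 < \sum_v w v * g v ->
  tri (slide mu o gv) s (3 * n + 7) (n + 3) (fun r s' => exists m' (g' : {ffun V -> R}),
    [/\ has_val s' r.1.1 m', toR R f r.1.2 = - m' /\ m <= m', has_vec s' r.2 g',
        tight (shift f m') g' o & \sum_v w v * g' v <= 0]).
Proof.
move=> hmu hg oo t so pos; have n0 := dim_gt0.
have hmin := @tri_min_set R V f (shifted mu) (shift f m) o s 1 oo.
apply: tri_cost.
apply: tri_seq (hmin _) _.
  by move=> X s' e; carry e; exact: tri_shifted.
move=> W s1 e1 [W0 Wp WE]; carry e1.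
have Wneg : shift f m W < 0.
  rewrite ltNge; apply/negP=> W_ge0; move: pos; rewrite ltNge => /negP; apply.
  by apply: greedy_le0 oo t so _ => p q /Wp; apply: le_trans.
have /norP[Wn0 WnT] : ~~ ((W == set0) || (W == [set: V])).
  by apply/negP=> h; move: Wneg; rewrite /shift h ltxx.
have WE' : shift f m W = toR R f W + m by rewrite /shift (negPf Wn0) (negPf WnT).
apply: tri_seq (tri_int f 0 s1) _.
move=> zero s2 e2 hz; carry e2; apply: tri_seq (tri_shifted f W hmu) _.
move=> a s3 e3 ha; carry e3; apply: tri_seq (tri_sub f hz ha) _.
move=> theta s4 e4 hth; carry e4; apply: tri_seq (tri_query f W s4) _.
move=> fW s5 e5 hfW; carry e5; apply: tri_seq (tri_sub f hz hfW) _.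
move=> mu' s6 e6 hmu'; carry e6; move: hth hmu'; rewrite !mulr0z !sub0r => hth hmu'.
have mE : - toR R f W = m + - shift f m W by rewrite WE'; ring.
have [v1 [ o' oE]] := ordering_cons n_gt0 oo; subst o.
apply: tri_seq (tri_add f (hg v1) hth) _.
move=> b s7 e7 hb; carry e7.
have hg' : has_vec s7 (upd gv v1 b) (fun u => g u + (if u == v1 then - shift f m W else 0)).
  move=> u; rewrite /upd; case: eqP => [->|_]; first exact: hb.
  by rewrite addr0; apply: hg.
apply: tri_seq (tri_sub f (hg' (last v1 o')) hth) _.
move=> b' s8 e8 hb'; carry e8; apply: tri_done => /=.
have t' := tight_slide (- shift f m W) oo t; rewrite -mE in t'.
exists (- toR R f W); eexists; split; [exact: hmu'| | |exact: t'|].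
- by rewrite opprK; split=> //; rewrite mE lerDl oppr_ge0 ltW.
- move=> u; rewrite {1}/upd !ffunE; case: eqP => [->|_].
    move: hb'; rewrite /= /GRing.scale /= mulr1 opprK.
    by case: eqP => _; rewrite ?mulr1 ?mulr0.
  have := hg' u; rewrite /= /GRing.scale /= mulr0 addr0.
  by case: eqP => _; rewrite ?mulr1 ?mulr0.
apply: greedy_le0 oo t' so _ => p q /Wp Wle; rewrite /shift.
case: ifP => // h; move: Wle; rewrite WE' {1}/shift h.
by lra.
all: lia.
Qed.

Definition svn_bound : nat := 400 * (n * n).

Definition svn_inv (Q : V -> V -> R) (m0 : R) s (st : svn_state V) (m : R) ts (y : {ffun V -> R}) :=
  [/\ has_val s (svn_mu st) m /\ has_terms s (svn_terms st) ts,
      has_vec s (svn_y st) y, toR R f (svn_W st) = - m /\ m0 <= m,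
      vn_state Q ts y & forall t, t \in ts -> vertex f m t.1].

(** The bound of [vn_state] on the norm leaves room for less than 1 / eps^2 vectors. *)
Lemma svn_size (Q : V -> V -> R) ts (y : {ffun V -> R}) : posdef Q -> vn_state Q ts y ->
  eps_of R n < nrm Q y -> (size ts < svn_bound)%N.
Proof.
move=> pQ [_ _ _ hk _] lt_e; have n0 : 0 < n%:R :> R by rewrite ltr0n dim_gt0.
rewrite -(ltr_nat R); set k := (size ts)%:R in hk *.
have e2 : eps_of R n ^+ 2 < qform Q y.
  by rewrite -sqr_nrm // ltr_sqr ?nnegrE ?nrm_ge0 // ltW // eps_of_gt0 // dim_gt0.
have eE : eps_of R n ^+ 2 * (svn_bound)%:R = 1.
  rewrite /eps_of /svn_bound !natrM.
  have -> : 400%:R = 20%:R * 20%:R :> R by rewrite -natrM.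
  by field; rewrite gt_eqF.
have k0 : 0 <= k by rewrite ler0n.
have [//|le_k] := ltP k; have k1 : 0 < k.
  by apply: lt_le_trans le_k; rewrite ltr0n /svn_bound !muln_gt0 dim_gt0.
have : eps_of R n ^+ 2 * k < qform Q y * k by rewrite ltr_pM2r.
have : eps_of R n ^+ 2 * (svn_bound)%:R <= eps_of R n ^+ 2 * k by rewrite ler_wpM2l ?sqr_ge0.
by rewrite eE; lra.
Qed.

Lemma bound_ge : [/\ (0 < n)%N, (n <= n * n)%N & (100 * (n * n) <= svn_bound)%N].
Proof.
have n0 := dim_gt0; split=> //; first by rewrite leq_pmulr.
by rewrite /svn_bound; lia.
Qed.

Lemma tri_svn_step (Q : V -> V -> R) m0 s Qa ea st m ts y : sym Q -> posdef Q ->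
  0 <= m0 -> 0 <= toR R f [set: V] + m0 ->
  has_mat s Qa Q -> has_val s ea (eps_of R n) -> svn_inv Q m0 s st m ts y ->
  (size ts <= svn_bound)%N ->
  tri (svn_step Qa ea st) s (2 * svn_bound) (6 * n) (fun r s' =>
    match r with
    | inl st' => (size ts < svn_bound)%N /\ exists m' ts' y',
        size ts' = (size ts).+1 /\ svn_inv Q m0 s' st' m' ts' y'
    | inr st' => nrm Q y <= eps_of R n /\ svn_inv Q m0 s' st' m ts y
    end).
Proof.
move=> sQ pQ m00 mV hQ he [[]]; case: st => mu W terms ya /= hmu hts hy [WE mm] vn vx szK.
have [n1 nn nK] := bound_ge.
apply: tri_cost.
apply: tri_seq (tri_normQ f hQ hy) _.
move=> ny s1 e1 hny; have hts1 := terms_ext e1 hts; carry e1.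
apply: tri_seq (tri_test f he hny) _.
move=> c s2 e2 cE; have hts2 := terms_ext e2 hts1; carry e2.
case: ltrP cE => [lt_e|ge_e] -> /=; last first.
  apply: tri_ret.
  by split.
have sz := svn_size pQ vn lt_e.
have y0 : y != 0.
  apply: contraTneq lt_e => ->; rewrite /nrm qform0 sqrtr0 -leNgt ltW //.
  by rewrite eps_of_gt0.
apply: tri_seq (tri_mulmv f hQ hy) _.
move=> Qy s3 e3 hQy; have hts3 := terms_ext e3 hts2; carry e3.
apply: tri_seq (tri_order_by f hQy) _.
move=> o s4 e4 [oo so]; have hts4 := terms_ext e4 hts3; carry e4.
have hgr := @tri_greedy R V f (shifted mu) (shift f m) o s4 1 (shift0 f m) oo.
apply: tri_seq (hgr _) _.
  by move=> X s' e; carry e; exact: tri_shifted.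
move=> ga s5 e5 [g hg tg]; have hts5 := terms_ext e5 hts4; carry e5.
apply: tri_seq (tri_int f 0 s5) _.
move=> zero s6 e6 hz; have hts6 := terms_ext e6 hts5; carry e6.
apply: tri_seq (tri_inner f hQ hy hg) _.
move=> ca s7 e7 hc; have hts7 := terms_ext e7 hts6; carry e7.
apply: tri_seq (tri_test f hz hc) _.
move=> pos s8 e8 posE; have hts8 := terms_ext e8 hts7; carry e8.
have dE (g' : {ffun V -> R}) : \sum_v app Q y v * g' v = dotp y (app Q g').
  by rewrite -(dotp_app y g' sQ).
have hslide : tri (if pos then slide mu o ga else Ret (mu, W, ga)) s8 (3 * n + 7) (n + 3)
   (fun r s' => exists m' (g' : {ffun V -> R}),
    [/\ has_val s' r.1.1 m', toR R f r.1.2 = - m' /\ m <= m', has_vec s' r.2 g',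
        tight (shift f m') g' o & \sum_v app Q y v * g' v <= 0]).
  rewrite posE mulr0z; case: ltrP => [c0|c0].
    by apply: tri_slide hmu hg oo tg so _; rewrite dE.
  by apply: tri_ret; exists m, g; split=> //; rewrite dE.
apply: tri_seq hslide _.
move=> [[mu' W'] ga'] s9 e9 /= [m' [g' [hmu' [WE' mm'] hg' tg' c0]]].
rewrite dE in c0; have hts9 := terms_ext e9 hts8; carry e9.
apply: tri_seq (tri_normalize f hQ hg') _.
move=> h s10 e10 hh; have hts10 := terms_ext e10 hts9; carry e10.
have hsub : tri (genv (fun v => Do (Defs.Sub (ya v) (h v)))) s10 (n * 1) (n * 0)
    (fun d s' => has_vec s' d (y - nv Q g')).
  apply: tri_genv => v s' e; carry e; apply: tri_imp (tri_sub f (hy v) (hh v)) _ _ _ => //.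
  by move=> r s'' _; rewrite !ffunE.
apply: tri_seq hsub _.
move=> d s11 e11 hd; have hts11 := terms_ext e11 hts10; carry e11.
apply: tri_seq (tri_inner f hQ hd hy) _.
move=> num s12 e12 hnum; have hts12 := terms_ext e12 hts11; carry e12.
apply: tri_seq (tri_inner f hQ hd hd) _.
move=> den s13 e13 hden; have hts13 := terms_ext e13 hts12; carry e13.
apply: tri_seq (tri_div f hnum hden) _.
move=> la s14 e14; rewrite -/(vn_lambda Q g' y); set l := vn_lambda Q g' y => hl.
have hts14 := terms_ext e14 hts13; carry e14.
apply: tri_seq (tri_int f 1 s14) _.
move=> one s15 e15; rewrite mulr1z => hone; have hts15 := terms_ext e15 hts14; carry e15.
apply: tri_seq (tri_sub f hone hl) _.
move=> ka s16 e16 hk; have hts16 := terms_ext e16 hts15; carry e16.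
have hy' : tri (genv (fun v => a <- Do (Mul ka (ya v));; b <- Do (Mul la (h v));;
     Do (Add a b)))%prog s16 (n * 3) (n * 0)
    (fun y' s' => has_vec s' y' ((1 - l) *: y + l *: nv Q g')).
  apply: tri_genv => v s' e; carry e.
  apply: tri_bind (tri_mul f hk (hy v)) _ _ _ => // a s'' e'' ha; carry e''.
  apply: tri_bind (tri_mul f hl (hh v)) _ _ _ => // b s3' e3' hb; carry e3'.
  by apply: tri_imp (tri_add f ha hb) _ _ _ => // r s4' _; rewrite !ffunE.
apply: tri_seq hy' _.
move=> ya' s17 e17 hya'; have hts17 := terms_ext e17 hts16; carry e17.
have hmap := @tri_mapM R V f _ _ _ _ (fun '(gi, xi) => xi' <- Do (Mul ka xi);; Ret (gi, xi'))%prog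
  has_term
  has_term
  (fun t => (t.1, (1 - l) * t.2)) terms ts s17 1 0.
apply: tri_seq (hmap _ _ _ hts17) _.
- by move=> ? ? ? ?; apply: term_ext.
- by move=> ? ? ? ?; apply: term_ext.
- move=> [gi xi] [G X] s' e [/= h1 h2]; carry e; apply: tri_bind_ret.
  apply: tri_imp (tri_mul f hk h2) _ _ _ => // r s'' e'' hr; split=> //=.
  exact: vec_ext e'' h1.
- move=> terms' s18 e18 hts18; carry e18; apply: tri_done; split=> //.
  exists m', (vn_terms ts g' l), ((1 - l) *: y + l *: nv Q g').
  split; first by rewrite /vn_terms size_rcons size_map.
  split=> //=.
  + by split=> //; apply: rel2_rcons.
  + by split=> //; apply: le_trans mm mm'.
  + exact: vn_step.
  + move=> t; rewrite mem_rcons inE => /orP[/eqP->|/mapP[t' /vx vt ->]] /=.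
      exists m', o; split=> //.
      * exact: le_trans m00 (le_trans mm mm').
      * by apply: le_trans mV _; rewrite lerD2l (le_trans mm).
    exact: vertex_le mm' vt.
all: have := rel2_size hts; lia.
Qed.

Lemma tri_svn (Q : V -> V -> R) s Qa ea mu m W : sym Q -> posdef Q ->
  0 <= m -> 0 <= toR R f [set: V] + m -> toR R f W = - m -> has_val s mu m ->
  has_mat s Qa Q -> has_val s ea (eps_of R n) ->
  tri (sliding_von_neumann mu W Qa ea) s (3 * (svn_bound * svn_bound)) (7 * (svn_bound * n))
    (fun st s' => exists m' ts y, [/\ svn_inv Q m s' st m' ts y,
        nrm Q y <= eps_of R n & (size ts <= svn_bound)%N]).
Proof.
move=> sQ pQ m0 mV WE hmu hQ he; have [n1 nn nK] := bound_ge.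
have KK : (100 * (n * n) * 100 <= svn_bound * svn_bound)%N by rewrite leq_mul //; lia.
have Kn : (100 * n <= svn_bound * n)%N by rewrite leq_mul2r; lia.
have K1 : (svn_bound <= svn_bound * svn_bound)%N by rewrite leq_pmulr //; lia.
apply: tri_cost.
apply: tri_seq (tri_any_order f s) _.
move=> o s1 e1 oo; carry e1.
have hgr := @tri_greedy R V f (shifted mu) (shift f m) o s1 1 (shift0 f m) oo.
apply: tri_seq (hgr _) _.
  by move=> X s' e; carry e; exact: tri_shifted.
move=> ga s2 e2 [g hg tg]; carry e2; apply: tri_seq (tri_int f 1 s2) _.
move=> x1 s3 e3; rewrite mulr1z => hx1; carry e3.
apply: tri_seq (tri_normalize f hQ hg) _.
move=> ya s4 e4 hy; carry e4.
pose I k (st : svn_state V) s' := exists m' ts y,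
  (size ts + k)%N = svn_bound /\ svn_inv Q m s' st m' ts y.
pose st0 := SvN mu W [:: (ga, x1)] ya.
have I0 : I (svn_bound.-1) st0 s4.
  exists m, [:: (g, 1)], (nv Q g); split; first by rewrite /=; lia.
  split=> //=; first exact: vn_init.
  by move=> t; rewrite inE => /eqP-> /=; exists m, o.
apply: (tri_iter (k := svn_bound.-1) (I := I) (c := (2 * svn_bound)%N) (q := (6 * n)%N) _ I0).
- move=> k st s5 e5 [m' [ts [y [sz inv]]]]; carry e5.
  apply: tri_imp (tri_svn_step sQ pQ m0 mV hQ he inv _) _ _ _ => //; first by lia.
  move=> [st'|st'] s6 e6.
    move=> [lt_sz [m2 [ts2 [y2 [sz2 inv2]]]]]; exists k.-1; first by lia.
    by exists m2, ts2, y2; split=> //; lia.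
  by move=> [ny inv']; exists m', ts, y; split=> //; lia.
all: rewrite prednK; nia.
Qed.

End SlidingVonNeumann.

(** * Rescaling-SFM *)

Fixpoint all_prop (A : Type) (P : A -> Prop) (l : seq A) : Prop :=
  if l is a :: l' then P a /\ all_prop P l' else True.

Lemma all_prop_rcons (A : Type) (P : A -> Prop) l a :
  all_prop P l -> P a -> all_prop P (rcons l a).
Proof. by elim: l => [|b l IH] //= [Pb /IH h] /h. Qed.

Lemma all_prop_rconsP (A : Type) (P : A -> Prop) l a :
  all_prop P (rcons l a) -> all_prop P l /\ P a.
Proof. by elim: l => [|b l IH] /= [Pb] // /IH[]. Qed.

Lemma all_prop_imp (A : Type) (P P' : A -> Prop) l :
  (forall a, P a -> P' a) -> all_prop P l -> all_prop P' l.
Proof. by move=> h; elim: l => [|b l IH] //= [/h ? /IH]. Qed.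

Section RescalingSFM.
Variables (R : realType) (V : finType) (f : {set V} -> int).
Hypotheses (n_gt0 : (0 < #|V|)%N) (f0 : f set0 = 0).
Implicit Types (s : state R) (ts : seq ({ffun V -> R} * R)) (Q A : V -> V -> R).
Local Notation n := (dim V).
Local Notation K := (svn_bound V).
Local Notation eps := (eps_of R n).
Local Notation "'tri' p s c q P" := (tri f p s c%N q%N P)
  (at level 10, p, s, c, q, P at level 9).

(** The values behind the record [phase], in the order of its fields. *)
Definition vphase := ((V -> V -> R) * seq ({ffun V -> R} * R) * {ffun V -> R})%type.

Definition has_phase s (p : phase V) (w : vphase) :=
  [/\ has_mat s (ph_Q p) w.1.1, has_terms s (ph_terms p) w.1.2 &
      has_vec s (ph_y p) w.2].

Lemma phase_ext s s' p w : ext s s' -> has_phase s p w -> has_phase s' p w.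
Proof.
move=> e [h1 h2 h3]; split; [exact: mat_ext e h1|exact: terms_ext e h2|].
exact: vec_ext e h3.
Qed.

Lemma phases_ext s s' l ws : ext s s' -> rel2 (has_phase s) l ws -> rel2 (has_phase s') l ws.
Proof. by move=> e; apply: rel2_imp => p w; apply: phase_ext. Qed.

(** The history of the rescalings, which the certificate goes through backwards. *)
Inductive rescalings : seq vphase -> (V -> V -> R) -> (V -> V -> R) -> Prop :=
| Rescalings0 : rescalings [::] (idm R (V := V)) (idm R (V := V))
| RescalingsS ws Q A ts y : rescalings ws Q A -> vn_state Q ts y ->
    nrm Q y <= eps -> y != 0 ->
    let A' := rescaled_mx eps Q A ts in
    rescalings (rcons ws (Q, ts, y)) (foldl (@pivot_mx R V) A' (enum V)) A'.

Lemma rescalings_inv ws Q A : rescalings ws Q A ->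
  [/\ sym A, posdef A, inverse_pair A Q & (9 / 5) ^+ size ws <= formdet A].
Proof.
elim=> {ws Q A} [|ws Q A ts y _ [sA pA AQ dA] vn ny y0 A'].
  by split; [exact: sym_id|exact: posdef_id|exact: inverse_pair_id|rewrite formdet_id].
have e0 : 0 <= eps by rewrite ltW // eps_of_gt0.
have pA' : posdef A' by apply: posdef_rescaled vn.
split=> //; first exact: sym_rescaled.
  exact: inverse_foldl.
have [_ _ _ _ /(_ y0) ts0] := vn.
apply: le_trans (det_rescaled e0 sA pA AQ vn ts0).
by rewrite size_rcons exprSr ler_pM ?exprn_ge0 // scale_growth.
Qed.

Definition phase_ok (m : R) (w : vphase) :=
  (size w.1.2 <= K)%N /\ forall t, t \in w.1.2 -> vertex f m t.1.

Lemma phase_ok_le m m' w : m <= m' -> phase_ok m w -> phase_ok m' w.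
Proof. by move=> mm [h1 h2]; split=> // t /h2; apply: vertex_le. Qed.

(** A run that found the origin needs no history: its last phase suffices. *)
Definition rsfm_final T s (st : rsfm_state V) (m : R) (ws : seq vphase) :=
  [/\ toR R f (out_W st) = - m /\ (size ws <= T)%N,
      rel2 (has_phase s) (out_phases st) ws,
      all_prop (phase_ok m) ws &
      (exists Q A, [/\ rescalings ws Q A, size ws = T, has_mat s (out_Q st) Q &
                       has_mat s (out_R st) A]) \/
      (exists ws' Q ts, [/\ ws = rcons ws' (Q, ts, 0), sym Q, posdef Q &
                            vn_state Q ts 0])].

Lemma tri_rescale s ea Qa Aa terms Q A ts : has_val s ea eps -> has_mat s Qa Q ->
  has_mat s Aa A -> has_terms s terms ts -> (size ts <= K)%N ->
  tri (rescale ea Qa Aa terms) s (20 * (K * (n * n))) 0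
    (fun M s' => has_mat s' M (rescaled_mx eps Q A ts)).
Proof.
move=> he hQ hA hts sz; have [n1 nn nK] := bound_ge n_gt0.
apply: tri_cost; first apply: tri_seq (tri_int f 1 s) _.
  move=> one s1 e1; rewrite mulr1z => hone; have hts1 := terms_ext e1 hts; carry e1.
  apply: tri_seq (tri_add f hone he) _ => ea1 s2 e2 h2; have hts2 := terms_ext e2 hts1; carry e2.
  apply: tri_seq (tri_mul f h2 h2) _ => ea2 s3 e3 h3; have hts3 := terms_ext e3 hts2; carry e3.
  apply: tri_seq (tri_div f hone h3) _ => sc s4 e4; rewrite -/(scale_of eps) => hsc.
  have hts4 := terms_ext e4 hts3; carry e4.
  have hmap := @tri_mapM R V f _ _ _ _
    (fun '(g, x) => n2 <- Defs.inner Qa g g;; c <- Do (Div x n2);; Ret (g, c))%prog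
    (@has_term R V)
    (@has_term R V)
    (fun t => (t.1, t.2 / qform Q t.1)) terms ts s4 (2 * (n * n) + 3 * n + 2) 0.
  apply: tri_seq (hmap _ _ _ hts4) _.
  - by move=> ? ? ? ?; apply: term_ext.
  - by move=> ? ? ? ?; apply: term_ext.
  - move=> [g x] [G X] s' e [/= h5 h6]; carry e.
    apply: tri_cost; first apply: tri_seq (tri_inner f hQ h5 h5) _.
      move=> n2 s5 e5 hn2; carry e5; apply: tri_seq (tri_div f h6 hn2) _.
      by move=> c s6 e6 hc; carry e6; apply: tri_done; split.
    by lia.
    by lia.
  move=> weighted s5 e5 hw; carry e5.
  pose tsw := [seq (t.1, t.2 / qform Q t.1) | t <- ts].
  have szw : (size weighted <= K)%N by rewrite (rel2_size hw) size_map.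
  apply: (tri_genm (c := (K * 3 + 3)%N) (q := 0%N)) => u v s6 e6.
  have hw6 := terms_ext e6 hw; carry e6.
  have hsum := @tri_sumM R V f _ _
    (fun '(g, c) => a <- Do (Mul (g u) (g v));; Do (Mul c a))%prog
    (@has_term R V)
    (fun t => t.2 * (t.1 u * t.1 v)) weighted tsw s6 2 0.
  apply: tri_cost; first apply: tri_seq (hsum _ _ hw6) _.
  - by move=> ? ? ? ?; apply: term_ext.
  - move=> [g c] [G C] s' e [/= h7 h8]; carry e.
    apply: tri_bind (tri_mul f (h7 u) (h7 v)) _ _ _ => // a s7 e7 ha; carry e7.
    exact: tri_mul.
  - move=> t s7 e7 ht; carry e7; apply: tri_seq (tri_add f (hA u v) ht) _ => r s8 e8 hr.
    carry e8; apply: tri_imp (tri_mul f hsc hr) (leqnn _) (leqnn _) _ => x s9 _.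
    by rewrite /rescaled_mx big_map.
  - apply: (@leq_trans ((K * 3).+1 + 2)%N); last by lia.
    by rewrite leq_add2r ltnS leq_mul2r; apply/orP; right; exact: szw.
  - by lia.
- have -> : size terms = size ts by exact: rel2_size hts.
  have : (size ts * (n * n) <= K * (n * n))%N by rewrite leq_mul2r sz orbT.
  have : (n <= K)%N by lia.
  nia.
- by lia.
Qed.

Lemma tri_rsfm_loop T s ea st m ws Q A : has_val s ea eps ->
  has_val s (out_mu st) m -> toR R f (out_W st) = - m -> 0 <= m ->
  0 <= toR R f [set: V] + m -> rescalings ws Q A -> has_mat s (out_Q st) Q ->
  has_mat s (out_R st) A -> rel2 (has_phase s) (out_phases st) ws ->
  all_prop (phase_ok m) ws ->
  tri (rsfm_loop ea T st) s (T * (4 * (K * K))) (T * (7 * (K * n)))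
    (fun st' s' => exists m' ws', rsfm_final (size ws + T) s' st' m' ws').
Proof.
have [n1 nn nK] := bound_ge n_gt0.
elim: T s st m ws Q A => [|T IH] s st m ws Q A he hmu WE m0 mV run hQ hA hph ok /=.
  apply: tri_ret; exists m, ws; split=> //; first by rewrite addn0.
  by left; exists Q, A; rewrite addn0.
case: st hmu WE hQ hA hph => mu W Qa Aa Gamma phs /= hmu WE hQ hA hph.
have [sA pA AQ _] := rescalings_inv run.
have sQ := sym_inverse sA AQ; have pQ := posdef_inverse pA AQ.
apply: tri_cost; first apply: tri_seq (tri_svn n_gt0 sQ pQ m0 mV WE hmu hQ he) _.
- move=> [mu' W' terms ya] s1 e1 [m' [ts [y [[[/= hmu' hts] hy [WE' mm] vn vx] ny sz]]]].
  have hph1 := phases_ext e1 hph; carry e1.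
  have m'0 : 0 <= m' by apply: le_trans mm.
  have m'V : 0 <= toR R f [set: V] + m' by apply: le_trans mV _; rewrite lerD2l.
  have ok' : all_prop (phase_ok m') (rcons ws (Q, ts, y)).
    apply: all_prop_rcons; last by split.
    by apply: all_prop_imp ok => w; apply: phase_ok_le.
  apply: tri_seq (tri_is_zero f hy) _ => stop s2 e2 stopE.
  have hts2 := terms_ext e2 hts; have hph2 := phases_ext e2 hph1; carry e2.
  have hph3 : rel2 (has_phase s2) (rcons phs (Phase Qa terms ya)) (rcons ws (Q, ts, y)).
    by apply: rel2_rcons.
  move: stopE; have [y0|y0] := eqVneq y 0 => ->.
    apply: tri_ret; exists m', (rcons ws (Q, ts, y)); split=> //.
      by split=> //; rewrite size_rcons; lia.
    by right; exists ws, Q, ts; rewrite -y0.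
  apply: tri_seq (tri_rescale he hQ hA hts2 sz) _ => A' s3 e3 hA'.
  have hph4 := phases_ext e3 hph3; carry e3.
  apply: tri_seq (tri_inverse f hA') _ => Q' s4 e4 hQ'.
  have hph5 := phases_ext e4 hph4; carry e4.
  have := IH s4 (RSFM mu' W' Q' A' (Gamma ++ unzip1 terms) (rcons phs (Phase Qa terms ya)))
    m' (rcons ws (Q, ts, y)) _ _ he hmu' WE' m'0 m'V (RescalingsS run vn ny y0) hQ' hA' hph5 ok'.
  by rewrite size_rcons addSnnS => h; exact: h.
- rewrite mulSn; have : (K * (100 * (n * n)) <= K * K)%N by rewrite leq_mul2l nK orbT.
  have : (n * (n * n) <= K * (n * n))%N by rewrite leq_mul2r; apply/orP; right; lia.
  have : (n * n <= K * (n * n))%N by rewrite leq_pmull //; lia.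
  have : (K <= K * (n * n))%N by rewrite leq_pmulr //; lia.
  nia.
- by rewrite mulSn; lia.
Qed.

Lemma tri_rescaling_sfm T s :
  tri (rescaling_sfm V T) s (T.+1 * (4 * (K * K))) (T.+1 * (7 * (K * n)))
    (fun st s' => exists m ws, rsfm_final T s' st m ws).
Proof.
have [n1 nn nK] := bound_ge n_gt0.
apply: tri_cost; first apply: tri_seq (tri_int f 1 s) _.
- move=> one s1 e1; rewrite mulr1z => hone; carry e1.
  apply: tri_seq (tri_int f _ s1) _ => d s2 e2 hd; carry e2.
  apply: tri_seq (tri_div f hone hd) _ => ea s3 e3 he; carry e3.
  apply: tri_seq (tri_identity f s3) _ => I s4 e4 hI; carry e4.
  apply: tri_seq (tri_int f 0 s4) _ => zero s5 e5; rewrite mulr0z => hz; carry e5.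
  apply: tri_seq (tri_query f [set: V] s5) _ => fV s6 e6 hfV; carry e6.
  apply: tri_seq (tri_test f hfV hz) _ => neg s7 e7 negE; carry e7.
  apply: tri_seq (tri_sub f hz hfV) _ => mfV s8 e8 hm; carry e8.
  have he' : has_val s8 ea eps by exact: he.
  move: negE; case: ltrP => [fV0|fV0] ->.
    apply: (@tri_rsfm_loop T s8 ea _ (0 - toR R f [set: V]) [::]
             (idm R (V := V)) (idm R (V := V))) => //=.
    + by rewrite sub0r opprK.
    + by rewrite sub0r oppr_ge0 ltW.
    + by rewrite sub0r addrN.
    + exact: Rescalings0.
  apply: (@tri_rsfm_loop T s8 ea _ 0 [::]
             (idm R (V := V)) (idm R (V := V))) => //=.
  + by rewrite toR0 // oppr0.
  + by rewrite addr0.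
  + exact: Rescalings0.
- rewrite mulSn; have : (100 * (n * n) * 1 <= K * K)%N by rewrite leq_mul //; lia.
  nia.
- by rewrite mulSn; have : (0 < K * n)%N by [rewrite muln_gt0 n1 andbT; lia]; lia.
Qed.

End RescalingSFM.

(** * Sparse conic combinations *)

Section Basis.
Variables (R : realType) (V : finType).
Implicit Types (g a b t : {ffun V -> R}) (c : V -> R) (M : V -> V -> R).
Implicit Types (B : V -> option {ffun V -> R}).

(** On vectors of zero sum, adding 1 to each coordinate turns conic combinations
    with a prescribed total weight into plain conic combinations. *)
Definition lift1 g : {ffun V -> R} := [ffun v => g v + 1].

Definition column B v := if B v is Some g then lift1 g else unitv R v.

(** The invariant of the reduction. The third clause says that [M] inverts the
    matrix of columns, in the form in which this is used. *)
Definition basis_of B c M t :=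
  [/\ forall v, 0 <= c v, forall v, B v = None -> c v = 0,
      forall a, a = \sum_v app M a v *: column B v &
      t = \sum_v c v *: column B v].

Definition candidate B (d : V -> R) v := (d v < 0) || ((0 < d v) && ~~ isSome (B v)).

Lemma basis_init : basis_of (fun=> None) (fun=> 0) (idm R (V := V)) 0.
Proof.
split=> // [a|]; last by rewrite big1 // => v _; rewrite scale0r.
rewrite app_id; apply/ffunP=> u; rewrite sum_ffunE.
rewrite -[LHS](sum_unitv a u); apply: eq_bigr => v _.
by rewrite !ffunE eq_sym.
Qed.

Section Insert.
Variables (B : V -> option {ffun V -> R}) (c : V -> R) (M : V -> V -> R).
Variables (t g : {ffun V -> R}) (x : R).
Hypotheses (bt : basis_of B c M t).
Let a := lift1 g.
Let d := app M a.

Lemma ratio_ge0 v : candidate B d v -> 0 <= 0 - c v / d v.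
Proof.
have [c0 cN _ _] := bt; rewrite sub0r; case/orP => [dv|/andP[dv]].
  by rewrite -mulrN -invrN divr_ge0 // oppr_ge0 ltW.
by case E: (B v) => [//|] _; rewrite cN // mul0r oppr0.
Qed.

(** A coordinate can only become negative if it decreases, and a unit vector may
    not enter the combination at all: these are the two kinds of candidates. *)
Lemma ratio_step (r : R) : 0 <= r ->
  (forall v, candidate B d v -> r <= 0 - c v / d v) ->
  (forall v, 0 <= c v + r * d v) /\ (forall v, B v = None -> c v + r * d v = 0).
Proof.
have [c0 cN _ _] := bt; move=> r0 hr; split=> v.
  have [dv|dv] := ltP (d v) 0; last by rewrite addr_ge0 // mulr_ge0.
  have := hr v; rewrite /candidate dv => /(_ isT); rewrite sub0r -mulNr.
  by rewrite ler_ndivlMr //; lra.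
move=> Bv; rewrite cN // add0r; have [->|d0] := eqVneq (d v) 0; first by rewrite mulr0.
have := hr v; rewrite /candidate Bv /= andbT -neq_lt d0 => /(_ isT).
rewrite cN // mul0r subr0 => r0'; have -> : r = 0 by lra.
by rewrite mul0r.
Qed.

Lemma basis_drop : 0 <= x -> (forall v, candidate B d v -> x <= 0 - c v / d v) ->
  basis_of B (fun v => c v + x * d v) M (t + x *: a).
Proof.
move=> x0 hx; have [h1 h2] := ratio_step x0 hx; have [c0 cN hM tE] := bt.
split=> //; rewrite {1}tE [in x *: a](hM a) scaler_sumr -big_split.
by apply: eq_bigr => v _; rewrite scalerDl scalerA.
Qed.

Definition exchange_mx (v : V) : V -> V -> R := fun u w =>
  if u == v then M v w / d v else M u w - d u * (M v w / d v).

Lemma basis_swap v : let r := 0 - c v / d v in candidate B d v ->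
  (forall u, candidate B d u -> r <= 0 - c u / d u) -> r < x ->
  basis_of (fun u => if u == v then Some g else B u)
    (fun u => if u == v then x - r else c u + r * d u) (exchange_mx v) (t + x *: a).
Proof.
move=> r cv hr rx; have r0 : 0 <= r by exact: ratio_ge0.
have [h1 h2] := ratio_step r0 hr; have [c0 cN hM tE] := bt.
have dv : d v != 0 by move: cv; rewrite /candidate neq_lt; case/orP => [->//|/andP[->]]; rewrite orbT.
have rest (k : V -> R) : \sum_(u | u != v) k u *: column B u =
    \sum_u k u *: column B u - k v *: column B v.
  by rewrite [X in _ = X - _](bigD1 v) //= addrAC subrr add0r.
have swapE (k : V -> R) (k' : V -> R) : (forall u, u != v -> k' u = k u) ->
    \sum_u k' u *: column (fun u => if u == v then Some g else B u) u =
    k' v *: a + (\sum_u k u *: column B u - k v *: column B v).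
  move=> hk; rewrite (bigD1 v) //= {1}/column eqxx; congr (_ + _); rewrite -rest.
  by apply: eq_bigr => u uv; rewrite hk // /column (negPf uv).
split.
- by move=> u; case: eqP => _ //; rewrite subr_ge0 ltW.
- by move=> u; case: eqP => // _; apply: h2.
- move=> b; pose e := app M b v / d v.
  have ME u : app (exchange_mx v) b u = if u == v then e else app M b u - d u * e.
    rewrite ffunE /exchange_mx; case: eqP => _.
      by rewrite /e [app M b v]ffunE mulr_suml; apply: eq_bigr => w _; ring.
    rewrite /e [app M b v]ffunE [app M b u]ffunE mulr_suml mulr_sumr -sumrB.
    by apply: eq_bigr => w _; ring.
  rewrite (swapE (fun u => app M b u - d u * e)); last first.
    by move=> u /negPf uv; rewrite ME uv.
  rewrite ME eqxx.
  have -> : \sum_u (app M b u - d u * e) *: column B u = b - e *: a.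
    rewrite [in RHS](hM b) [in e *: a](hM a) scaler_sumr -sumrB; apply: eq_bigr => u _.
    by rewrite scalerBl scalerA (mulrC e).
  have -> : app M b v - d v * e = 0 by rewrite /e; field.
  by rewrite scale0r subr0 addrC subrK.
- rewrite (swapE (fun u => c u + r * d u)); last by move=> u /negPf->.
  rewrite eqxx.
  have -> : \sum_u (c u + r * d u) *: column B u = t + r *: a.
    rewrite {1}tE [in r *: a](hM a) scaler_sumr -big_split; apply: eq_bigr => u _.
    by rewrite scalerDl scalerA.
  have -> : c v + r * d v = 0 by rewrite /r; field.
  by rewrite scale0r subr0 addrCA -scalerDl subrK.
Qed.

End Insert.

Lemma lift1_sum (ws : seq ({ffun V -> R} * R)) :
  \sum_(w <- ws) w.2 *: lift1 w.1 =
  \sum_(w <- ws) w.2 *: w.1 + (\sum_(w <- ws) w.2) *: ([ffun=> 1] : {ffun V -> R}).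
Proof.
rewrite scaler_suml -big_split; apply: eq_bigr => w _; rewrite /= -scalerDr.
by congr (_ *: _); apply/ffunP=> v; rewrite !ffunE.
Qed.

Lemma lift1_inj (ws ws' : seq ({ffun V -> R} * R)) : (0 < #|V|)%N ->
  (forall w, w \in ws ++ ws' -> \sum_v w.1 v = 0) ->
  \sum_(w <- ws) w.2 *: lift1 w.1 = \sum_(w <- ws') w.2 *: lift1 w.1 ->
  \sum_(w <- ws) w.2 = \sum_(w <- ws') w.2 /\
  \sum_(w <- ws) w.2 *: w.1 = \sum_(w <- ws') w.2 *: w.1.
Proof.
move=> n0 h0; rewrite !lift1_sum => e.
have mass (us : seq ({ffun V -> R} * R)) : (forall w, w \in us -> \sum_v w.1 v = 0) ->
  \sum_v (\sum_(w <- us) w.2 *: w.1 + (\sum_(w <- us) w.2) *: ([ffun=> 1] : {ffun V -> R})) v =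
  #|V|%:R * \sum_(w <- us) w.2.
  move=> hu; under eq_bigr => v _ do rewrite ffunE.
  rewrite big_split /= [X in X + _](_ : _ = 0).
    rewrite add0r (eq_bigr (fun=> \sum_(w <- us) w.2)).
      by rewrite sumr_const mulr_natl.
    by move=> v _; rewrite !ffunE -[_ *: _]/(_ * _) mulr1.
  under eq_bigr => v _ do rewrite sum_ffunE.
  rewrite exchange_big /= big_seq big1 // => w wi.
  under eq_bigr => v _ do rewrite ffunE.
  by rewrite -mulr_sumr hu ?mulr0.
have e1 : \sum_(w <- ws) w.2 = \sum_(w <- ws') w.2.
  have n0' : #|V|%:R != 0 :> R by rewrite pnatr_eq0 -lt0n.
  apply: (mulfI n0'); rewrite -!mass ?e // => w wi; apply: h0; rewrite mem_cat wi ?orbT //.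
by split=> //; move: e; rewrite e1 => /addIr.
Qed.

End Basis.

Section Reduction.
Variables (V : finType).
Local Open Scope prog_scope.

Definition best (F : V -> prog V addr) (l : seq V) : prog V (option (V * addr)) :=
  foldM (fun b v =>
    a <- F v;;
    if b is Some (_, c) then lt <- Test a c;; Ret (if lt then Some (v, a) else b)
    else Ret (Some (v, a))) None l.

Definition filterM (P : V -> prog V bool) (l : seq V) : prog V (seq V) :=
  foldM (fun r v => b <- P v;; Ret (if b then v :: r else r)) [::] l.

(** An empty slot stands for the unit vector of its index. *)
Record basis := Basis {
  slot : V -> option (vec V);
  coef : vec V;
  coord : mat V
}.

(** One step of the simplex method: move along the direction that trades the
    current combination for the new vector until it has received its weight or
    some coordinate vanishes. *)
Definition insert (b : basis) (t : vec V * addr) : prog V basis :=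
  let: (g, x) := t in
  one <- Do (Int 1);;
  zero <- Do (Int 0);;
  a <- genv (fun v => Do (Add (g v) one));;
  d <- mulmv (coord b) a;;
  cand <- filterM (fun v =>
    neg <- Test (d v) zero;; pos <- Test zero (d v);;
    Ret (neg || (pos && ~~ isSome (slot b v)))) (enum V);;
  m <- best (fun v => q <- Do (Div (coef b v) (d v));; Do (Defs.Sub zero q)) cand;;
  swap <- (if m is Some (v, r) then
             lt <- Test r x;; Ret (if lt then Some (v, r) else None)
           else Ret None);;
  if swap is Some (v, r) then
    x' <- Do (Defs.Sub x r);;
    c <- genv (fun u => t <- Do (Mul r (d u));; Do (Add (coef b u) t));;
    p <- genv (fun w => Do (Div (coord b v w) (d v)));;
    M <- genm (fun u w =>
      if u == v then Ret (p w)
      else (t <- Do (Mul (d u) (p w));; Do (Defs.Sub (coord b u w) t)));;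
    Ret (Basis (upd (slot b) v (Some g)) (upd c v x') M)
  else
    c <- genv (fun u => t <- Do (Mul x (d u));; Do (Add (coef b u) t));;
    Ret (Basis (slot b) c (coord b)).

Definition reduce (l : seq (vec V * addr)) : prog V (seq (vec V * addr)) :=
  M <- identity V;;
  zero <- Do (Int 0);;
  b <- foldM insert (Basis (fun=> None) (fun=> zero) M) l;;
  Ret (pmap (fun v => omap (fun g => (g, coef b v)) (slot b v)) (enum V)).

Variables (R : realType) (f : {set V} -> int).
Implicit Types (s : state R).
Local Notation n := (dim V).
Local Notation "'tri' p s c q P" := (tri f p s c%N q%N P)
  (at level 10, p, s, c, q, P at level 9).

Lemma tri_best F (phi : V -> R) l s c q :
  (forall v s', ext s s' -> v \in l ->
    tri (F v) s' c q (fun a s'' => has_val s'' a (phi v))) ->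
  tri (best F l) s (size l * (c + 1)) (size l * q) (fun r s' =>
    if r is Some (v, a) then
      [/\ v \in l, has_val s' a (phi v) & forall u, u \in l -> phi v <= phi u]
    else l = [::]).
Proof.
move=> hF; apply: (tri_foldM (I := fun (d : seq V) (r : option (V * addr)) s' =>
   if r is Some (v, a) then
      [/\ v \in d, has_val s' a (phi v) & forall u, u \in d -> phi v <= phi u]
    else d = [::])) => // d v r b s1 lE e1 I1.
apply: tri_bind (hF v s1 e1 _) _ _ _; rewrite ?leq_addr //.
  by rewrite lE mem_cat mem_head orbT.
move=> a s2 e2 ha; case: b I1 => [[u c']|] I1; last first.
  apply: tri_ret; rewrite I1; split=> //= [|w]; first by rewrite mem_head.
  by rewrite inE => /eqP->.
have [ud hu le_u] := I1; carry e2; rewrite addnC addnK subnn.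
apply: tri_bind (tri_test f ha hu) _ _ _ => // lt s3 e3 ->; carry e3.
apply: tri_ret; case: ltrP => [vu|uv]; split=> //.
- by rewrite mem_rcons mem_head.
- move=> w; rewrite mem_rcons inE => /orP[/eqP->//|/le_u].
  exact: le_trans (ltW vu).
- by rewrite mem_rcons inE ud orbT.
- by move=> w; rewrite mem_rcons inE => /orP[/eqP->//|/le_u].
Qed.

Lemma tri_filterM P (p : pred V) l s c q :
  (forall v s', ext s s' -> tri (P v) s' c q (fun b _ => b = p v)) ->
  tri (filterM P l) s (size l * c) (size l * q) (fun r _ =>
    (size r <= size l)%N /\ forall v, (v \in r) = (v \in l) && p v).
Proof.
move=> hP; apply: (tri_foldM (I := fun (d : seq V) (r : seq V) _ =>
  (size r <= size d)%N /\ forall v, (v \in r) = (v \in d) && p v)) => //.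
move=> d v r b s1 _ e1 [sz h]; rewrite -(addn0 c) -(addn0 q).
apply: tri_bind_ret; apply: tri_imp (hP v s1 e1) _ _ _; rewrite ?addn0 //.
move=> t s2 _ ->; split=> [|u].
  by rewrite size_rcons; case: (p v) => //=; apply: leqW.
rewrite mem_rcons inE; case pv: (p v); rewrite ?inE h.
  by case: eqP => [->|]; rewrite ?pv.
by case: eqP => [->|]; rewrite ?pv ?andbF.
Qed.

End Reduction.

Section ReductionSpec.
Variables (R : realType) (V : finType) (f : {set V} -> int).
Hypothesis n_gt0 : (0 < #|V|)%N.
Implicit Types (s : state R) (B : V -> option {ffun V -> R}).
Local Notation n := (dim V).
Local Notation K := (svn_bound V).
Local Notation "'tri' p s c q P" := (tri f p s c%N q%N P)
  (at level 10, p, s, c, q, P at level 9).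

Definition has_slots s (sl : V -> option (vec V)) B := forall v,
  match sl v, B v with
  | Some g, Some G => has_vec s g G
  | None, None => True
  | _, _ => False
  end.

Lemma slots_ext s s' sl B : ext s s' -> has_slots s sl B -> has_slots s' sl B.
Proof.
by move=> e h v; have := h v; case: (sl v) (B v) => [g|] [G|] //; apply: vec_ext.
Qed.

Lemma slots_isSome s sl B v : has_slots s sl B -> isSome (sl v) = isSome (B v).
Proof. by move=> /(_ v); case: (sl v) (B v) => [g|] [G|]. Qed.

Definition has_basis s (b : basis V) B c M :=
  [/\ has_slots s (slot b) B, has_vec s (coef b) c & has_mat s (coord b) M].

Lemma basis_ext s s' b B c M : ext s s' -> has_basis s b B c M -> has_basis s' b B c M.
Proof.
by move=> e [h1 h2 h3]; split; [exact: slots_ext e h1|exact: vec_ext e h2|exact: mat_ext e h3].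
Qed.

Lemma tri_insert s b B c M (t G : {ffun V -> R}) g x X : has_basis s b B c M ->
  basis_of B c M t -> has_vec s g G -> has_val s x X -> 0 <= X ->
  tri (insert b (g, x)) s (30 * (n * n)) 0 (fun b' s' => exists B' c' M',
    [/\ has_basis s' b' B' c' M', basis_of B' c' M' (t + X *: lift1 G) &
        forall v H, B' v = Some H -> H = G \/ exists u, B u = Some H]).
Proof.
move=> hb bt hg hx X0; have [n1 nn _] := bound_ge n_gt0.
apply: tri_cost; first apply: tri_seq (tri_int f 1 s) _.
- move=> one s1 e1; rewrite mulr1z => hone; have hb1 := basis_ext e1 hb; carry e1.
  apply: tri_seq (tri_int f 0 s1) _ => zero s2 e2; rewrite mulr0z => hz.
  have hb2 := basis_ext e2 hb1; carry e2.
  have ha : tri (genv (fun v => Do (Add (g v) one))) s2 (n * 1) (n * 0)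
      (fun a s' => has_vec s' a (lift1 G)).
    apply: tri_genv => v s' e; carry e; rewrite ffunE; exact: tri_add.
  apply: tri_seq ha _ => a s3 e3 ha; have hb3 := basis_ext e3 hb2; carry e3.
  have [hsl hc hM] := hb3.
  apply: tri_seq (tri_mulmv f hM ha) _ => d s4 e4; set D := app M _ => hd.
  have hsl4 := slots_ext e4 hsl; carry e4.
  have hf := @tri_filterM V R f (fun v => neg <- Test (d v) zero;; pos <- Test zero (d v);;
    Ret (neg || (pos && ~~ isSome (slot b v))))%prog (candidate B D) (enum V) s4 2 0.
  apply: tri_seq (hf _) _ => [v s' e|cand s5 e5 [szc candE]].
    carry e; apply: tri_bind (tri_test f (hd v) hz) _ _ _ => // neg s5 e5 ->; carry e5.
    apply: tri_bind (tri_test f hz (hd v)) _ _ _ => // pos s6 e6 ->.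
    by apply: tri_ret; rewrite (slots_isSome v hsl4).
  have hsl5 := slots_ext e5 hsl4; carry e5; rewrite size_enumV in szc.
  have hbest := @tri_best V R f (fun v => q <- Do (Div (coef b v) (d v));;
    Do (Defs.Sub zero q))%prog (fun v => 0 - c v / D v) cand s5 2 0.
  have hbest' : tri (best (fun v => q <- Do (Div (coef b v) (d v));;
      Do (Defs.Sub zero q))%prog cand) s5 (n * 3) 0 (fun r s' =>
    if r is Some (v, a) then
      [/\ v \in cand, has_val s' a (0 - c v / D v) &
          forall u, u \in cand -> 0 - c v / D v <= 0 - c u / D u]
    else cand = [::]).
    apply: tri_cost (hbest _) _ _; rewrite ?muln0 ?leq_mul //.
    move=> v s' e _; carry e; apply: tri_bind (tri_div f (hc v) (hd v)) _ _ _ => // q s6 e6 hq.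
    by carry e6; apply: tri_sub.
  apply: tri_seq hbest' _ => m s6 e6 hm; have hsl6 := slots_ext e6 hsl5; carry e6.
  have hswap : tri (if m is Some (v, r) then
      (lt <- Test r x;; Ret (if lt then Some (v, r) else None))%prog else Ret None) s6 1 0
    (fun r s' => match r with
     | Some (v, a) => [/\ candidate B D v, has_val s' a (0 - c v / D v),
         (forall u, candidate B D u -> 0 - c v / D v <= 0 - c u / D u) &
         0 - c v / D v < X]
     | None => forall u, candidate B D u -> X <= 0 - c u / D u
     end).
    case: m hm => [[v r] [vc hr hmin]|c0]; last first.
      by apply: tri_ret => u cu; have := candE u; rewrite c0 in_nil mem_enum cu.
    apply: tri_bind (tri_test f hr hx) _ _ _ => // lt s7 e7 ->; carry e7; apply: tri_ret.
    have inc u : (u \in cand) = candidate B D u by rewrite candE mem_enum.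
    case: ltrP => h; first by split=> // [|u]; rewrite -inc //; apply: hmin.
    by move=> u; rewrite -inc => /hmin; apply: le_trans.
  apply: tri_seq hswap _ => swap s7 e7 hs; have hsl7 := slots_ext e7 hsl6; carry e7.
  case: swap hs => [[v r] [cv hr hmin rX]|hmin].
    apply: tri_seq (tri_sub f hx hr) _ => x' s8 e8 hx'; have hsl8 := slots_ext e8 hsl7; carry e8.
    have hc' : tri (genv (fun u => t <- Do (Mul r (d u));; Do (Add (coef b u) t))%prog) s8
        (n * 2) (n * 0) (fun a s' => has_vec s' a (fun u => c u + (0 - c v / D v) * D u)).
      apply: tri_genv => u s' e; carry e.
      apply: tri_bind (tri_mul f hr (hd u)) _ _ _ => // q s9 e9 hq; carry e9; exact: tri_add.
    apply: tri_seq hc' _ => c' s9 e9 hc'; have hsl9 := slots_ext e9 hsl8; carry e9.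
    have hp : tri (genv (fun w => Do (Div (coord b v w) (d v)))) s9 (n * 1) (n * 0)
        (fun a s' => has_vec s' a (fun w => M v w / D v)).
      by apply: tri_genv => u s' e; carry e; exact: tri_div (hM v u) (hd v).
    apply: tri_seq hp _ => p s10 e10 hp; have hsl10 := slots_ext e10 hsl9; carry e10.
    have hM' : tri (genm (fun u w => if u == v then Ret (p w)
      else (t <- Do (Mul (d u) (p w));; Do (Defs.Sub (coord b u w) t)))%prog) s10
        (n * (n * 2)) (n * (n * 0)) (fun N s' => has_mat s' N (exchange_mx M G v)).
      apply: tri_genm => u w s' e; carry e; rewrite /exchange_mx; case: eqP => _.
        exact: tri_ret (hp w).
      apply: tri_bind (tri_mul f (hd u) (hp w)) _ _ _ => // q s11 e11 hq; carry e11.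
      exact: tri_sub (hM u w) hq.
    apply: tri_seq hM' _ => N s11 e11 hN; have hsl11 := slots_ext e11 hsl10; carry e11.
    apply: tri_done.
    exists (fun u => if u == v then Some G else B u),
      (fun u => if u == v then X - (0 - c v / D v) else c u + (0 - c v / D v) * D u),
      (exchange_mx M G v); split; last 2 first.
    - have h := basis_swap bt cv hmin rX; exact: h.
    - by move=> u H; case: eqP => [_ [<-]|_ Bu]; [left|right; exists u].
    - split=> //= u; rewrite /upd; case: eqP => _ //; exact: hsl11 u.
  have hc' : tri (genv (fun u => t <- Do (Mul x (d u));; Do (Add (coef b u) t))%prog) s7
      (n * 2) (n * 0) (fun a s' => has_vec s' a (fun u => c u + X * D u)).
    apply: tri_genv => u s' e; carry e.
    apply: tri_bind (tri_mul f hx (hd u)) _ _ _ => // q s8 e8 hq; carry e8; exact: tri_add.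
  apply: (@tri_cost _ _ _ _ _ _ (n * 2)%N (n * 0)%N).
  + apply: tri_bind_ret; apply: tri_imp hc' _ _ _ => // c' s8 e8 hc'.
    have hsl8 := slots_ext e8 hsl7; carry e8.
    exists B, (fun u => c u + X * D u), M; split=> //; first exact: basis_drop.
    by move=> v H BvH; right; exists v.
  + by lia.
  + by lia.
- by rewrite size_enumV; lia.
- by rewrite size_enumV; lia.
Qed.

Lemma rel2_pmap s (sl : V -> option (vec V)) B (b : vec V) (c : V -> R) l :
  has_slots s sl B -> has_vec s b c ->
  has_terms s (pmap (fun v => omap (fun g => (g, b v)) (sl v)) l)
              (pmap (fun v => omap (fun g => (g, c v)) (B v)) l).
Proof.
move=> hsl hb; elim: l => [//|v l IH]; rewrite /has_terms /=.
have := hsl v; case: (sl v) (B v) => [g|] [G|] //= hg.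
by split; [split; [exact: hg|exact: hb]|exact: IH].
Qed.

Lemma big_pmap_option (A : nmodType) (F : V -> option ({ffun V -> R} * R))
    (G : {ffun V -> R} * R -> A) l :
  \sum_(w <- pmap F l) G w = \sum_(v <- l) (if F v is Some w then G w else 0).
Proof.
elim: l => [|v l IH]; first by rewrite !big_nil.
by rewrite big_cons /=; case: (F v) => [w|] /=; rewrite ?big_cons IH ?add0r.
Qed.

(** Caratheodory's theorem for vectors of zero sum. *)
Lemma tri_reduce s l (ws : seq ({ffun V -> R} * R)) : has_terms s l ws ->
  (forall w, w \in ws -> 0 <= w.2 /\ \sum_v w.1 v = 0) ->
  tri (reduce l) s (size l * (30 * (n * n)) + n * n + 1) 0 (fun l' s' => exists ws',
    [/\ has_terms s' l' ws', (size ws' <= n)%N,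
        forall w, w \in ws' -> 0 <= w.2 /\ exists2 w0, w0 \in ws & w0.1 = w.1,
        \sum_(w <- ws') w.2 = \sum_(w <- ws) w.2 &
        \sum_(w <- ws') w.2 *: w.1 = \sum_(w <- ws) w.2 *: w.1]).
Proof.
move=> hl hws; apply: tri_cost; first apply: tri_seq (tri_identity f s) _.
- move=> M s1 e1 hM; have hl1 := terms_ext e1 hl; carry e1.
  apply: tri_seq (tri_int f 0 s1) _ => zero s2 e2; rewrite mulr0z => hz.
  have hl2 := terms_ext e2 hl1; carry e2.
  pose I (d : seq ({ffun V -> R} * R)) (b : basis V) s' := exists B c N,
    [/\ has_basis s' b B c N, basis_of B c N (\sum_(w <- d) w.2 *: lift1 w.1) &
        forall v H, B v = Some H -> exists2 w0, w0 \in d & w0.1 = H].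
  have hloop : tri (foldM (@insert V) (Basis (fun=> None) (fun=> zero) M) l) s2
     (size l * (30 * (n * n))) (size l * 0) (I ws).
    refine (tri_foldM_rel (r := @has_term R V) _ hl2 _ _).
    - by move=> ? ? ? ?; apply: term_ext.
    - move=> d [G X] u [g x] b s3 wsE e3 [/= hg hx] [B [c [N [hb bt hB]]]].
      have /hws[X0 _] : (G, X) \in ws by rewrite wsE mem_cat mem_head orbT.
      apply: tri_imp (tri_insert hb bt hg hx X0) _ _ _ => //.
      move=> b' s4 _ [B' [c' [N' [hb' bt' hB']]]]; exists B', c', N'; split=> //.
        by rewrite -cats1 big_cat big_seq1.
      move=> v H /hB'[->|[v' /hB[w0 w0d <-]]].
        by exists (G, X); rewrite ?mem_rcons ?mem_head.
      by exists w0; rewrite // mem_rcons inE w0d orbT.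
    - exists (fun=> None), (fun=> 0), (idm R (V := V)); split=> //.
        by split=> // v; apply: hz.
      by rewrite big_nil; apply: basis_init.
  apply: tri_seq hloop _ => b s3 e3 [B [c [N [[hsl hc hN] [c0 cN hcol tE] hB]]]].
  carry e3; apply: tri_done; set ws' := pmap (fun v => omap (fun g => (g, c v)) (B v)) (enum V).
  have ws'P w : w \in ws' -> 0 <= w.2 /\ exists2 w0, w0 \in ws & w0.1 = w.1.
    rewrite mem_pmap => /mapP[v _]; case E: (B v) => [g|//] [->] /=; split; first exact: c0.
    exact: hB E.
  have [e1' e2'] : \sum_(w <- ws') w.2 = \sum_(w <- ws) w.2 /\
      \sum_(w <- ws') w.2 *: w.1 = \sum_(w <- ws) w.2 *: w.1.
    apply: lift1_inj => //.
      move=> w; rewrite mem_cat => /orP[/ws'P[_ [w0 /hws[_ h] <-]] //|/hws[]//].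
    rewrite tE big_pmap_option big_enum; apply: eq_bigr => v _.
    by rewrite /column; case E: (B v) => [g|] //=; rewrite cN // scale0r.
  exists ws'; split=> //; first exact: rel2_pmap.
  by rewrite size_pmap (leq_trans (count_size _ _)) // size_enumV.
- by lia.
- by lia.
Qed.

End ReductionSpec.

(** * Bases of f from shifted vertices *)

Section Recovery.
Variables (V : finType).
Local Open Scope prog_scope.

(** The tight chain of a vertex of a shifted base polytope is recovered without
    knowing the shift: the next element is one for which f(X + v) - g(X + v) is
    smallest. *)
Definition order_of (g : vec V) : prog V (seq V) :=
  foldM (fun p _ =>
    m <- best (fun v =>
           q <- Do (Query (v |: [set:: p]));;
           t <- sumM (fun u => Ret (g u)) (v :: p);;
           Do (Defs.Sub q t)) [seq v <- enum V | v \notin p];;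
    Ret (if m is Some (v, _) then rcons p v else p)) [::] (enum V).

Definition to_bases (l : seq (vec V * addr)) : prog V (combination V) :=
  total <- sumM (fun t => Ret t.2) l;;
  ts <- mapM (fun '(g, x) =>
    o <- order_of g;;
    h <- greedy (fun S => Do (Query S)) o;;
    c <- Do (Div x total);;
    Ret (c, h)) l;;
  pt <- genv (fun v => sumM (fun '(c, h) => Do (Mul c (h v))) ts);;
  Ret (Combination pt ts).

Variables (R : realType) (f : {set V} -> int).
Hypotheses (n_gt0 : (0 < #|V|)%N) (sf : submodular f) (f0 : f set0 = 0).
Implicit Types (s : state R) (g : {ffun V -> R}).
Local Notation n := (dim V).
Local Notation K := (svn_bound V).
Local Notation "'tri' p s c q P" := (tri f p s c%N q%N P)
  (at level 10, p, s, c, q, P at level 9).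

(** All the values f(X + u) - g(X + u) with X + u <> V are at least - m, and the
    tight chain of [g] shows that one of them equals - m. *)
Lemma tight_extend m g o (p : seq V) v : ordering o -> tight (shift f m) g o ->
  0 <= m -> 0 <= toR R f [set: V] + m -> uniq p ->
  \sum_(u in [set:: p]) g u = shift f m [set:: p] -> v \notin p ->
  (forall u, u \notin p ->
     toR R f (v |: [set:: p]) - \sum_(w in v |: [set:: p]) g w <=
     toR R f (u |: [set:: p]) - \sum_(w in u |: [set:: p]) g w) ->
  \sum_(u in v |: [set:: p]) g u = shift f m (v |: [set:: p]).
Proof.
move=> oo t m0 mV up tp vp hmin; have sm := submod_shift sf f0 m0 mV.
have [vT|vT] := eqVneq (v |: [set:: p]) [set: V].
  rewrite vT shiftT -[RHS](shiftT f m) -(tight_sum oo t).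
  by apply: eq_bigl => u; rewrite inE.
have pT : [set:: p] != [set: V].
  by apply: contraNneq vp => pT; have := in_setT v; rewrite -pT inE.
have [u up' tu] := tight_grow sm (shift0 f m) oo t tp pT.
have {}up' : u \notin p by move: up'; rewrite inE.
have n0 w : w |: [set:: p] != set0.
  by apply/set0Pn; exists w; rewrite !inE eqxx.
have uT : u |: [set:: p] != [set: V].
  apply: contraNneq vT => uT; rewrite eqEcard finset.subsetT /= -uT.
  by rewrite !cardsU1 !inE vp up'.
have := greedy_le (v |: [set:: p]) sm (shift0 f m) oo t.
have := hmin u up'; move: tu.
rewrite /shift !(negPf (n0 _)) (negPf vT) (negPf uT) /= => -> h1 h2.
by apply/eqP; rewrite eq_le h2 /=; lra.
Qed.

Lemma tri_order_of s ga g m o : has_vec s ga g -> ordering o ->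
  tight (shift f m) g o -> 0 <= m -> 0 <= toR R f [set: V] + m ->
  tri (order_of ga) s (n * (n * (n + 4))) (n * n) (fun p _ =>
    ordering p /\ tight (shift f m) g p).
Proof.
move=> hg oo t m0 mV.
pose I (d p : seq V) (s' : state R) := [/\ size p = size d, uniq p &
  forall q r, p = q ++ r -> \sum_(v <- q) g v = shift f m [set:: q]].
have hloop : tri (order_of ga) s (size (enum V) * (n * (n + 4))) (size (enum V) * n) (I (enum V)).
  apply: tri_foldM; last first.
    by split=> // -[|//] r _; rewrite big_nil set_nil shift0.
  move=> d b r p s1 VE e1 [sz up tp].
  have szp : (size p < n)%N by rewrite sz -(size_enumV V) VE size_cat /= addnS ltnS leq_addr.
  carry e1; set l := [seq v <- enum V | v \notin p].
  have szl : (size l <= n)%N by rewrite -(size_enumV V) size_filter count_size.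
  have hbest := @tri_best V R f (fun v => q <- Do (Query (v |: [set:: p]));;
       t <- sumM (fun u => Ret (ga u)) (v :: p);; Do (Defs.Sub q t))%prog
       (fun v => toR R f (v |: [set:: p]) - \sum_(u in v |: [set:: p]) g u) l s1 (n + 3) 1.
  have hphi v s2 : ext s1 s2 -> v \in l -> tri (q <- Do (Query (v |: [set:: p]));;
       t <- sumM (fun u => Ret (ga u)) (v :: p);; Do (Defs.Sub q t))%prog s2 (n + 3) 1
       (fun a s3 => has_val s3 a (toR R f (v |: [set:: p]) - \sum_(u in v |: [set:: p]) g u)).
    move=> e2; rewrite mem_filter => /andP[vp _]; carry e2.
    have vpE : [set:: v :: p] = v |: [set:: p] by apply/setP=> u; rewrite !inE.
    apply: tri_cost; first apply: tri_seq (tri_query f _ s2) _.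
    - move=> q s3 e3 hq; carry e3.
      have hsum := @tri_sumM R V f _ _ (fun u => Ret (ga u)) (fun=> eq) g (v :: p) (v :: p) s3 0 0.
      apply: tri_seq (hsum _ _ (rel2_refl _)) _ => //.
        by move=> a c s4 e4 <-; carry e4; apply: tri_ret.
      move=> x s4 e4; rewrite sum_prefix_uniq /= ?vp // vpE => hx; carry e4.
      exact: tri_sub.
    - by rewrite /=; lia.
    - by rewrite /=; lia.
  apply: (@tri_cost _ _ _ _ _ _ (size l * (n + 3 + 1))%N (size l * 1)%N).
  - apply: tri_bind_ret; apply: tri_imp (hbest hphi) _ _ _ => // [[[v a]|]] s2 _.
      move=> [vl _ hmin]; have vp : v \notin p by move: vl; rewrite mem_filter => /andP[].
      split; [by rewrite !size_rcons sz|by rewrite rcons_uniq vp|].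
      move=> q r'; case/lastP: r' => [|r' w]; last first.
        by rewrite -rcons_cat => /rcons_inj[pE _]; apply: tp pE.
      rewrite cats0 => <-; rewrite sum_prefix_uniq ?rcons_uniq ?vp // set_rcons.
      apply: (tight_extend oo t m0 mV) (up) _ (vp) _.
        by have := tp p [::]; rewrite cats0 sum_prefix_uniq // => ->.
      by move=> u up'; apply: hmin; rewrite mem_filter up' mem_enum.
    move=> l0; exfalso.
    have : [set:: p] = [set: V].
      apply/setP=> u; rewrite !inE; have := in_nil u; rewrite -l0 mem_filter mem_enum andbT.
      by move/negbFE.
    move=> pT; have : #|[set:: p]| = size p by rewrite cardsE; apply/card_uniqP.
    by rewrite pT cardsT => nE; move: szp; rewrite -nE ltnn.
  - by rewrite addn3 addn1 leq_mul //; lia.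
  - by rewrite muln1.
rewrite size_enumV in hloop; apply: tri_imp hloop _ _ _ => // p s1 _ [sz up tp].
split=> //; split=> // v.
have pT : [set:: p] = [set: V].
  apply/eqP; rewrite eqEcard finset.subsetT cardsT cardsE.
  by rewrite (card_uniqP up) sz size_enumV leqnn.
by have := in_setT v; rewrite -pT inE.
Qed.

(** The vertex is kept next to the base that it yields: the error of the
    combination is measured on the vertices. *)
Definition has_base s (t : addr * vec V) (u : {ffun V -> R} * {ffun V -> R} * R) :=
  has_val s t.1 u.2 /\ has_vec s t.2 u.1.2.

Lemma base_ext s s' t u : ext s s' -> has_base s t u -> has_base s' t u.
Proof. by move=> e [h1 h2]; split; [exact: has_ext e h1|exact: vec_ext e h2]. Qed.

Lemma tri_to_bases s l (ws : seq ({ffun V -> R} * R)) mu : has_terms s l ws ->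
  (size ws <= n)%N -> (forall w, w \in ws -> vertex f mu w.1) ->
  tri (to_bases l) s (30 * (n * n * (n * n))) (4 * (n * n * n)) (fun c s' =>
    exists us : seq ({ffun V -> R} * {ffun V -> R} * R),
    [/\ [seq (u.1.1, u.2) | u <- us] =
          [seq (w.1, w.2 / \sum_(w <- ws) w.2) | w <- ws],
        forall u, u \in us -> unshifted f mu u.1.1 u.1.2 /\ extreme_base f u.1.2,
        has_vec s' (comb_point c) (\sum_(u <- us) u.2 *: u.1.2) &
        rel2 (has_base s') (comb_terms c) us]).
Proof.
move=> hl sz hws; have [n1 nn _] := bound_ge n_gt0.
have szl : (size l <= n)%N by rewrite (rel2_size hl).
have n2 : (n * n <= n * n * n)%N by rewrite leq_pmulr.
have n3 : (n * n * n <= n * n * (n * n))%N by rewrite leq_mul2l nn orbT.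
set L := \sum_(w <- ws) w.2.
have hsum := @tri_sumM R V f _ _ (fun t : vec V * addr => Ret t.2) (@has_term R V)
  (fun w => w.2) l ws s 0 0.
apply: (@tri_cost _ _ _ _ _ _ (n + 1 + (n * (n * (n * (n + 4)) + 2 * n + 2) + n * (3 * n + 1)))%N
   (0 + (n * (n * n + n + 2) + 0))%N); try lia.
apply: tri_seq.
  apply: tri_cost (hsum _ _ hl) _ _; [|  |lia|lia].
    by move=> ? ? ? ?; apply: term_ext.
  by move=> [g x] [G X] s1 e [_ h]; apply: tri_ret.
move=> total s1 e1 /= htot; have hl1 := terms_ext e1 hl; carry e1.
have hl2 : rel2 (fun t w => has_term s1 t w /\ vertex f mu w.1) l ws.
  exact: rel2_and.
pose Rs s' (t : addr * vec V) (w : {ffun V -> R} * R) := exists H : {ffun V -> R},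
  [/\ has_val s' t.1 (w.2 / L), has_vec s' t.2 H, unshifted f mu w.1 H &
      extreme_base f H].
have hmap := @tri_mapM R V f _ _ _ _ (fun '(g, x) =>
    o <- order_of g;;
    h <- greedy (fun S => Do (Query S)) o;;
    c <- Do (Div x total);;
    Ret (c, h)) (fun s' t w => has_term s' t w /\ vertex f mu w.1) Rs id l ws s1
    (n * (n * (n + 4)) + 2 * n + 2) (n * n + n + 2).
apply: tri_seq.
  apply: tri_cost (hmap _ _ _ hl2) _ _.
  - by move=> s2 s3 t w e [h1 h2]; split=> //; apply: term_ext e h1.
  - move=> s2 s3 t w e [H [h1 h2 h3 h4]]; exists H; split=> //; first exact: has_ext e h1.
    exact: vec_ext e h2.
  - move=> [g x] [G X] s2 e2 [[/= hg hx] [m [ o [ oo tg m0 mV mm]]]]; carry e2.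
    apply: tri_cost; first apply: tri_seq (tri_order_of hg oo tg m0 mV) _.
    + move=> p s3 e3 [op tp]; carry e3.
      have hgr := @tri_greedy R V f (fun S => Do (Query S)) (toR R f) p s3 0 (toR0 R f0) op.
      apply: tri_seq (hgr _) _; first by move=> S s' e; apply: tri_query.
      move=> h s4 e4 [H hH tH]; carry e4.
      apply: tri_seq (tri_div f hx htot) _ => c s5 e5 hc; carry e5; apply: tri_done.
      exists H; split=> //=; last exact: extreme_tight op tH.
      exact: tight_unshifted n_gt0 op tp tH m0 mV mm.
    + by lia.
    + by lia.
  - by rewrite leq_mul2r szl orbT.
  - by rewrite leq_mul2r szl orbT.
move=> ts s2 e2; rewrite map_id => /rel2_choice[vs [vsE hvs]]; carry e2.
pose us := [seq (v.1.1, v.2, v.1.2 / L) | v <- vs].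
have hus : rel2 (fun t u => has_base s2 t u /\
    (unshifted f mu u.1.1 u.1.2 /\ extreme_base f u.1.2)) ts us.
  by apply: rel2_map_r; apply: rel2_imp hvs => t [[g x] H] [h1 h2 h3 h4].
have husb : rel2 (has_base s2) ts us by apply: rel2_imp hus => t u [].
have szt : (size ts <= n)%N by rewrite (rel2_size hus) size_map -(size_map fst) vsE.
have hpt : tri (genv (fun v => sumM (fun '(c, h) => Do (Mul c (h v))) ts)) s2
    (n * (2 * n + 1)) (n * 0)
    (fun a s' => has_vec s' a (\sum_(u <- us) u.2 *: u.1.2)).
  apply: tri_genv => v s3 e3; rewrite sum_ffunE.
  have hs := @tri_sumM R V f _ _ (fun '(c, h) => Do (Mul c (h v))) has_base
    (fun u => (u.2 *: u.1.2) v) ts us s3 1 0.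
  apply: tri_cost (hs _ _ _) _ _; [| | |by rewrite addn1 ltnS mulnC leq_mul2l szt|by rewrite muln0].
  - by move=> ? ? ? ?; apply: base_ext.
  - move=> [c h] [[g H] x] s4 e4 [/= hc hh]; rewrite ffunE; exact: tri_mul hc (hh v).
  - by apply: rel2_imp husb => t u; apply: base_ext.
apply: (@tri_cost _ _ _ _ _ _ (n * (2 * n + 1))%N (n * 0)%N); try lia.
apply: tri_bind_ret; apply: tri_imp hpt _ _ _ => // pt s3 e3 hpt; exists us; split=> //=.
- by rewrite -vsE -!map_comp; apply: eq_map => u.
- exact: rel2_all hus (fun t u h => h.2).
- by apply: rel2_imp husb => t u; apply: base_ext.
Qed.

End Recovery.

(** * Nearly vanishing combinations of the vectors of the run *)

Section Weights.
Variable V : finType.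
Local Open Scope prog_scope.

(** A zero vector is a vanishing combination on its own; its normalization is zero
    too, so that its coefficient [x] cannot serve as a weight. *)
Definition exact_weights (Q : mat V) (l : seq (vec V * addr)) :
    prog V (seq (vec V * addr)) :=
  mapM (fun '(g, x) =>
    z <- is_zero g;;
    if z then one <- Do (Int 1);; Ret (g, one)
    else (r <- normQ Q g;; c <- Do (Div x r);; Ret (g, c))) l.

Definition pull_phase (sc rho : addr) (a : mat V * vec V * seq (vec V * addr))
    (p : phase V) : prog V (mat V * vec V * seq (vec V * addr)) :=
  let: (Q', h, acc) := a in
  z <- mulmv Q' h;;
  l <- mapM (fun '(g, x) =>
    n2 <- Defs.inner (ph_Q p) g g;;
    w <- Do (Div x n2);;
    r <- Do (Sqrt n2);;
    rr <- Do (Mul r rho);;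
    gz <- dot g z;;
    d <- Do (Defs.Sub rr gz);;
    wd <- Do (Mul w d);;
    c <- Do (Mul wd sc);;
    Ret (g, c)) (ph_terms p);;
  h' <- genv (fun v => t <- sumM (fun '(g, c) => Do (Mul c (g v))) l;; Do (Add (h v) t));;
  Ret (ph_Q p, h', l ++ acc).

Definition pull (sc rho : addr) (Q : mat V) (h : vec V) (phs : seq (phase V)) :
    prog V (seq (vec V * addr)) :=
  r <- foldM (pull_phase sc rho) (Q, h, [::]) phs;; Ret r.2.

(** The weights obtained by carrying both signs of a thin direction, a column of
    the final matrix with the largest diagonal entry, back through the phases. *)
Definition thin_weights (Q A : mat V) (phs : seq (phase V)) :
    prog V (seq (vec V * addr)) :=
  one <- Do (Int 1);;
  d <- Do (Int (20 * #|V|)%N);;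
  eps <- Do (Div one d);;
  zero <- Do (Int 0);;
  m <- best (fun v => Do (Defs.Sub zero (A v v))) (enum V);;
  if m is Some (v, _) then
    b <- Do (Sqrt (A v v));;
    e1 <- Do (Add one eps);;
    rho <- Do (Mul e1 b);;
    e2 <- Do (Mul e1 e1);;
    sc <- Do (Div one e2);;
    h <- genv (fun w => Do (Defs.Sub zero (A w v)));;
    l1 <- pull sc rho Q (fun w => A w v) phs;;
    l2 <- pull sc rho Q h phs;;
    Ret (l1 ++ l2)
  else Ret [::].

Definition weights (out : rsfm_state V) : prog V (seq (vec V * addr)) :=
  let phs := rev (out_phases out) in
  if phs is p :: _ then
    z <- is_zero (ph_y p);;
    if z then exact_weights (ph_Q p) (ph_terms p)
    else thin_weights (out_Q out) (out_R out) phs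
  else Ret [::].

Variables (R : realType) (f : {set V} -> int).
Hypotheses (n_gt0 : (0 < #|V|)%N).
Implicit Types (s : state R) (ts : seq ({ffun V -> R} * R)) (Q A : V -> V -> R).
Local Notation n := (dim V).
Local Notation K := (svn_bound V).
Local Notation eps := (eps_of R n).
Local Notation "'tri' p s c q P" := (tri f p s c%N q%N P)
  (at level 10, p, s, c, q, P at level 9).

Definition exact_weight Q (t : {ffun V -> R} * R) : R :=
  if t.1 == 0 then 1 else t.2 / nrm Q t.1.

Lemma exact_weightP Q ts : posdef Q -> vn_state Q ts 0 ->
  [/\ forall t, t \in ts -> 0 <= exact_weight Q t,
      \sum_(t <- ts) exact_weight Q t *: t.1 = 0 &
      0 < \sum_(t <- ts) exact_weight Q t].
Proof.
move=> pQ [t0 t1 tE _ _].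
have w0 t : t \in ts -> 0 <= exact_weight Q t.
  by rewrite /exact_weight; case: ifP => // _ /t0 h; rewrite divr_ge0 ?nrm_ge0.
split=> //.
  rewrite [RHS]tE; apply: eq_bigr => t _; rewrite /exact_weight nvE.
  by case: eqP => [->|_]; rewrite ?scaler0 // scalerA.
have := oner_neq0 R; rewrite -t1; apply: contra_neqT; rewrite -leNgt => le0.
have /eqP : \sum_(t <- ts) exact_weight Q t = 0.
  apply/eqP; rewrite eq_le le0 /= big_seq; exact: sumr_ge0.
rewrite big_seq psumr_eq0 // => /allP hz; rewrite big_seq big1 // => t ti.
have := hz t ti; rewrite ti /= /exact_weight; have [_|g0] := eqVneq t.1 0.
  by rewrite oner_eq0.
by rewrite mulf_eq0 invr_eq0 (gt_eqF (nrm_gt0 pQ g0)) orbF => /eqP.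
Qed.

Lemma tri_exact_weights s Qa Q l ts : has_mat s Qa Q -> has_terms s l ts ->
  (size ts <= K)%N ->
  tri (exact_weights Qa l) s (K * K) 0 (fun l' s' =>
    has_terms s' l' [seq (t.1, exact_weight Q t) | t <- ts]).
Proof.
move=> hQ hl sz; have [n1 nn nK] := bound_ge n_gt0.
have hmap := @tri_mapM R V f _ _ _ _ (fun '(g, x) =>
    z <- is_zero g;;
    if z then one <- Do (Int 1);; Ret (g, one)
    else (r <- normQ Qa g;; c <- Do (Div x r);; Ret (g, c))) (@has_term R V) (@has_term R V)
    (fun t => (t.1, exact_weight Q t)) l ts s K 0.
apply: tri_cost (hmap _ _ _ hl) _ _; rewrite ?muln0 //; last first.
- by rewrite (rel2_size hl) leq_mul2r sz orbT.
- move=> [g x] [G X] s1 e1 [/= hg hx]; carry e1.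
  apply: tri_cost; first apply: tri_seq (tri_is_zero f hg) _.
  + move=> z s2 e2 zE; carry e2; rewrite zE; case: ifP => G0; last first.
      apply: tri_seq (tri_normQ f hQ hg) _ => r s3 e3 hr; carry e3.
      apply: tri_seq (tri_div f hx hr) _ => c s4 e4 hc; carry e4; apply: tri_done.
      by split=> //=; rewrite /exact_weight /= G0.
    apply: tri_cost; first apply: tri_bind_ret; first apply: tri_imp (tri_int f 1 s2) (leqnn _) (leqnn _) _.
    * move=> one s3 e3; rewrite mulr1z => h1; carry e3.
      by split=> //=; rewrite /exact_weight /= G0.
    * by lia.
    * by [].
  + by lia.
  + by [].
- by move=> ? ? ? ?; apply: term_ext.
- by move=> ? ? ? ?; apply: term_ext.
Qed.

Lemma tri_pull_phase s sc rho (b : R) Q ts (y H : {ffun V -> R}) Q' Q'a h acc p m :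
  has_val s sc (scale_of eps) -> has_val s rho ((1 + eps) * b) ->
  has_mat s Q'a Q' -> has_vec s h H -> has_phase s p (Q, ts, y) ->
  (size ts <= K)%N -> has_terms s acc m ->
  let new := [seq (t.1, pull_weight eps Q b (app Q' H) t) | t <- ts] in
  tri (pull_phase sc rho (Q'a, h, acc) p) s (K * K) 0 (fun r s' =>
    [/\ has_mat s' r.1.1 Q, has_vec s' r.1.2 (H + \sum_(t <- new) t.2 *: t.1) &
        has_terms s' r.2 (new ++ m)]).
Proof.
move=> hsc hrho hQ' hh [hQ hts _] sz hacc new; rewrite /= in hQ hts; have [n1 nn nK] := bound_ge n_gt0.
apply: (@tri_cost _ _ _ _ _ _ (2 * (n * n) + n + (K * (2 * (n * n) + 5 * n + 8) + n * (K * 2 + 2)))%N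
   (0 + (0 + n * 0))%N); last by lia.
apply: tri_seq (tri_mulmv f hQ' hh) _ => z s1 e1 hz.
have hts1 := terms_ext e1 hts; have hacc1 := terms_ext e1 hacc; carry e1.
have hmap := @tri_mapM R V f _ _ _ _ (fun '(g, x) =>
    n2 <- Defs.inner (ph_Q p) g g;;
    w <- Do (Div x n2);;
    r <- Do (Sqrt n2);;
    rr <- Do (Mul r rho);;
    gz <- dot g z;;
    d <- Do (Defs.Sub rr gz);;
    wd <- Do (Mul w d);;
    c <- Do (Mul wd sc);;
    Ret (g, c)) (@has_term R V) (@has_term R V)
    (fun t => (t.1, pull_weight eps Q b (app Q' H) t)) (ph_terms p) ts s1
    (2 * (n * n) + 5 * n + 8) 0.
apply: tri_seq.
  apply: tri_cost (hmap _ _ _ hts1) _ _.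
  - by move=> ? ? ? ?; apply: term_ext.
  - by move=> ? ? ? ?; apply: term_ext.
  - move=> [g x] [G X] s2 e2 [/= hg hx]; carry e2.
    apply: tri_cost; first apply: tri_seq (tri_inner f hQ hg hg) _.
    + move=> n2 s3 e3 hn2; carry e3.
      apply: tri_seq (tri_div f hx hn2) _ => w s4 e4 hw; carry e4.
      apply: tri_seq (tri_sqrt f hn2) _ => r s5 e5 hr; carry e5.
      apply: tri_seq (tri_mul f hr hrho) _ => rr s6 e6 hrr; carry e6.
      apply: tri_seq (tri_dot f hg hz) _ => gz s7 e7 hgz; carry e7.
      apply: tri_seq (tri_sub f hrr hgz) _ => d s8 e8 hd; carry e8.
      apply: tri_seq (tri_mul f hw hd) _ => wd s9 e9 hwd; carry e9.
      apply: tri_seq (tri_mul f hwd hsc) _ => c s10 e10 hc; carry e10.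
      by apply: tri_done; split.
    + by lia.
    + by [].
  - by rewrite (rel2_size hts) leq_mul2r sz orbT.
  - by rewrite muln0.
move=> l s2 e2 /= hl; have hacc2 := terms_ext e2 hacc1; carry e2.
have szl : (size l <= K)%N by rewrite (rel2_size hl) size_map.
have hgen : tri (genv (fun v => t <- sumM (fun '(g, c) => Do (Mul c (g v))) l;;
      Do (Add (h v) t))) s2 (n * (K * 2 + 2)) (n * 0)
    (fun a s' => has_vec s' a (H + \sum_(t <- new) t.2 *: t.1)).
  apply: tri_genv => v s3 e3; rewrite ffunE sum_ffunE.
  have hs := @tri_sumM R V f _ _ (fun '(g, c) => Do (Mul c (g v))) (@has_term R V)
    (fun u => (u.2 *: u.1) v) l new s3 1 0.
  have hl3 := terms_ext e3 hl; carry e3.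
  apply: tri_cost; first apply: tri_seq (hs _ _ hl3) _.
  - by move=> ? ? ? ?; apply: term_ext.
  - move=> [g c] [G C] s4 e4 [/= hg hc]; rewrite ffunE; exact: tri_mul hc (hg v).
  - by move=> t s4 e4 /= ht; carry e4; apply: tri_add (hh v) ht.
  - by rewrite addSnnS leq_add2r leq_mul2r szl orbT.
  - by rewrite muln0.
apply: tri_bind_ret; apply: tri_imp hgen _ _ _ => // h' s3 e3 hh'.
split=> //=; first exact: mat_ext e3 hQ.
by apply: rel2_cat; [exact: terms_ext e3 hl|exact: terms_ext e3 hacc2].
have h1 : (K * (2 * (n * n) + 5 * n + 8) <= K * (15 * (n * n)))%N by rewrite leq_mul2l; lia.
have h2 : (K * (100 * (n * n)) <= K * K)%N by rewrite leq_mul2l nK orbT.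
have h3 : (n * n <= K * (n * n))%N by rewrite leq_pmull //; lia.
have h4 : (n * (K * 2 + 2) <= 4 * (K * (n * n)))%N by nia.
lia.
Qed.

Lemma tri_pull s sc rho (b mu : R) ws Q A phs Qa h (H : {ffun V -> R}) acc m :
  has_val s sc (scale_of eps) -> has_val s rho ((1 + eps) * b) -> 0 <= b ->
  rescalings ws Q A -> has_mat s Qa Q -> rel2 (has_phase s) phs ws ->
  all_prop (phase_ok f mu) ws -> has_vec s h H -> qform Q H <= b ^+ 2 ->
  has_terms s acc m ->
  tri (foldM (pull_phase sc rho) (Qa, h, acc) (rev phs)) s (size phs * (K * K)) 0
    (fun r s' => exists new : seq ({ffun V -> R} * R),
       [/\ has_terms s' r.2 (new ++ m), (size new <= size ws * K)%N,
           forall t, t \in new -> 0 <= t.2 /\ vertex f mu t.1 &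
           qform (idm R (V := V)) (H + \sum_(t <- new) t.2 *: t.1) <= b ^+ 2]).
Proof.
move=> + + b0 run; elim: run s Qa h H acc phs m => {ws Q A}
  [|ws Q A ts y run IH vn ny y0 A'] s Qa h H acc phs m hsc hrho hQ hphs ok hh hb hacc.
  case: phs hphs => [_|//]; apply: tri_ret; exists [::].
  by split=> //; rewrite big_nil addr0.
have [phs' [p [phsE hphs' hp]]] := rel2_rconsP hphs; subst phs.
have [ok' [/= sz vts]] := all_prop_rconsP ok.
have [sA pA AQ _] := rescalings_inv n_gt0 run.
have e0 : 0 <= eps by rewrite ltW // eps_of_gt0.
have AQ' : inverse_pair A' (foldl (@pivot_mx R V) A' (enum V)).
  by apply: inverse_foldl; apply: posdef_rescaled vn.
set Q' := foldl _ _ _ in AQ' hQ hb; rewrite rev_rcons size_rcons /= mulSn.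
have step := tri_pull_phase hsc hrho hQ hh hp sz hacc.
rewrite -[0%N]addn0; apply: tri_seq step _ => -[[Q1 h1] acc1] s1 e1 [/= hQ1 hh1 hacc1].
have hphs1 := phases_ext e1 hphs'; carry e1.
set new1 := [seq (t.1, _) | t <- ts] in hh1 hacc1.
have hb1 : qform Q (H + \sum_(t <- new1) t.2 *: t.1) <= b ^+ 2.
  by rewrite big_map; apply: (pull_back e0 sA pA AQ vn AQ' b0 hb ny).
apply: tri_imp (IH _ _ _ _ _ _ _ hsc hrho hQ1 hphs1 ok' hh1 hb1 hacc1) _ _ _ => //.
move=> [[Q2 h2] acc2] s2 _ [new [hacc2 sznew hnew hq]] /=; exists (new ++ new1); split.
- by rewrite -catA.
- by rewrite size_cat size_map size_rcons mulSn addnC leq_add.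
- move=> t; rewrite mem_cat => /orP[/hnew//|/mapP[t' ti ->]] /=; split; last exact: vts.
  exact: (pull_weight_ge0 e0 sA pA AQ vn AQ' b0 hb ti).
- by rewrite big_cat /= [X in H + X]addrC addrA.
Qed.

Lemma rescalings_last ws Q A w : rescalings (rcons ws w) Q A -> w.2 != 0.
Proof.
move E: (rcons ws w) => us run; case: run E => [|us' Q1 A1 ts y _ _ _ y0 A'].
  by case: ws.
by move=> /rcons_inj[_ ->].
Qed.

Lemma tri_thin_weights s Qa Aa Q A phs ws mu T : rescalings ws Q A ->
  has_mat s Qa Q -> has_mat s Aa A -> rel2 (has_phase s) phs ws ->
  all_prop (phase_ok f mu) ws -> (size ws <= T)%N ->
  tri (thin_weights Qa Aa (rev phs)) s (T * (2 * (K * K)) + K) 0 (fun l s' =>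
    exists (b : R) (u : {ffun V -> R}) v0 (ts1 ts2 : seq ({ffun V -> R} * R)),
    [/\ has_terms s' l (ts1 ++ ts2) /\ (size (ts1 ++ ts2) <= 2 * (T * K))%N,
        forall t, t \in ts1 ++ ts2 -> 0 <= t.2 /\ vertex f mu t.1,
        [/\ 0 <= b, u v0 = b ^+ 2 & forall v, A v v <= b ^+ 2],
        qform (idm R (V := V)) (u + \sum_(t <- ts1) t.2 *: t.1) <= b ^+ 2 &
        qform (idm R (V := V)) (- u + \sum_(t <- ts2) t.2 *: t.1) <= b ^+ 2]).
Proof.
move=> run hQ hA hphs ok szT; have [n1 nn nK] := bound_ge n_gt0.
have [sA pA AQ _] := rescalings_inv n_gt0 run.
have szp : size phs = size ws by exact: rel2_size hphs.
apply: tri_cost; first apply: tri_seq (tri_int f 1 s) _.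
- move=> one s1 e1; rewrite mulr1z => hone; have hp1 := phases_ext e1 hphs; carry e1.
  apply: tri_seq (tri_int f _ s1) _ => d s2 e2 hd; have hp2 := phases_ext e2 hp1; carry e2.
  apply: tri_seq (tri_div f hone hd) _ => ea s3 e3 he; have hp3 := phases_ext e3 hp2; carry e3.
  have {}he : has_val s3 ea eps by exact: he.
  apply: tri_seq (tri_int f 0 s3) _ => zero s4 e4; rewrite mulr0z => hz.
  have hp4 := phases_ext e4 hp3; carry e4.
  have hbest := @tri_best V R f (fun v => Do (Defs.Sub zero (Aa v v)))
    (fun v => 0 - A v v) (enum V) s4 1 0.
  apply: tri_seq (hbest _) _.
    by move=> v s' e _; carry e; apply: tri_sub hz (hA v v).
  move=> [[v a]|] s5 e5; last first.
    move=> V0; have /card_gt0P[v _] := n_gt0; have := mem_enum V v.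
    by rewrite V0.
  move=> [_ _ vmax]; have hp5 := phases_ext e5 hp4; carry e5.
  set b := Num.sqrt (A v v).
  have Avv : 0 < A v v by exact: diag_gt0.
  have bE : b ^+ 2 = A v v by rewrite sqr_sqrtr // ltW.
  have b0 : 0 <= b by exact: sqrtr_ge0.
  apply: tri_seq (tri_sqrt f (hA v v)) _ => ba s6 e6; rewrite -/b => hb.
  have hp6 := phases_ext e6 hp5; carry e6.
  apply: tri_seq (tri_add f hone he) _ => ea1 s7 e7 he1; have hp7 := phases_ext e7 hp6; carry e7.
  apply: tri_seq (tri_mul f he1 hb) _ => rho s8 e8 hrho; have hp8 := phases_ext e8 hp7; carry e8.
  apply: tri_seq (tri_mul f he1 he1) _ => ea2 s9 e9 he2; have hp9 := phases_ext e9 hp8; carry e9.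
  apply: tri_seq (tri_div f hone he2) _ => sc s10 e10; rewrite -/(scale_of eps) => hsc.
  have hp10 := phases_ext e10 hp9; carry e10.
  pose u : {ffun V -> R} := [ffun w => A w v].
  have hneg : tri (genv (fun w => Do (Defs.Sub zero (Aa w v)))) s10 (n * 1) (n * 0)
      (fun a s' => has_vec s' a (- u)).
    apply: tri_genv => w s' e; carry e; rewrite !ffunE -sub0r; exact: tri_sub hz (hA w v).
  apply: tri_seq hneg _ => h s11 e11 hh; have hp11 := phases_ext e11 hp10; carry e11.
  have hu : has_vec s11 (fun w => Aa w v) u by move=> w; rewrite ffunE; apply: hA.
  have uE : qform Q u = b ^+ 2.
    by rewrite bE /u -app_delta (qform_app_inverse AQ) /qform app_delta dotpC dotp_delta ffunE.
  have hpull1 := @tri_pull s11 sc rho b mu ws Q A phs Qa _ u [::] [::] hsc hrho b0 run hQ hp11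
    ok hu _ I.
  have hpull1' : tri (pull sc rho Qa (fun w => Aa w v) (rev phs)) s11 (T * (K * K)) 0
    (fun r s' => exists new : seq ({ffun V -> R} * R),
       [/\ has_terms s' r new, (size new <= T * K)%N,
           forall t, t \in new -> 0 <= t.2 /\ vertex f mu t.1 &
           qform (idm R (V := V)) (u + \sum_(t <- new) t.2 *: t.1) <= b ^+ 2]).
    apply: tri_bind_ret; apply: tri_imp (hpull1 _) _ _ _ => //.
    + by rewrite uE.
    + by rewrite szp leq_mul2r szT orbT.
    + move=> r s' _ [new [h1 h2 h3 h4]]; exists new; rewrite cats0 in h1; split=> //.
      by apply: leq_trans h2 _; rewrite leq_mul2r szT orbT.
  apply: tri_seq hpull1' _ => l1 s12 e12 [ts1 [hl1 sz1 ht1 hq1]].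
  have hp12 := phases_ext e12 hp11; carry e12.
  have hpull2 := @tri_pull s12 sc rho b mu ws Q A phs Qa _ (- u) [::] [::] hsc hrho b0 run hQ hp12
    ok hh _ I.
  have hpull2' : tri (pull sc rho Qa h (rev phs)) s12 (T * (K * K)) 0
    (fun r s' => exists new : seq ({ffun V -> R} * R),
       [/\ has_terms s' r new, (size new <= T * K)%N,
           forall t, t \in new -> 0 <= t.2 /\ vertex f mu t.1 &
           qform (idm R (V := V)) (- u + \sum_(t <- new) t.2 *: t.1) <= b ^+ 2]).
    apply: tri_bind_ret; apply: tri_imp (hpull2 _) _ _ _ => //.
    + by rewrite qformN uE.
    + by rewrite szp leq_mul2r szT orbT.
    + move=> r s' _ [new [h1 h2 h3 h4]]; exists new; rewrite cats0 in h1; split=> //.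
      by apply: leq_trans h2 _; rewrite leq_mul2r szT orbT.
  apply: tri_seq hpull2' _ => l2 s13 e13 [ts2 [hl2 sz2 ht2 hq2]]; apply: tri_done.
  exists b, u, v, ts1, ts2; split=> //.
  + split; last by rewrite size_cat; lia.
    by apply: rel2_cat hl2; apply: terms_ext e13 hl1.
  + by move=> t; rewrite mem_cat => /orP[/ht1|/ht2].
  + split=> //; first by rewrite ffunE.
    move=> w; have := vmax w (mem_enum V w); rewrite bE; lra.
- by rewrite size_enumV; lia.
- by rewrite size_enumV; lia.
Qed.

End Weights.

(** * The approximation guarantee *)

Definition certificate (V : finType) (out : rsfm_state V) : prog V (combination V) :=
  (ws <- weights out;; l <- reduce ws;; to_bases l)%prog.

Section Final.
Variables (R : realType) (V : finType) (f : {set V} -> int) (delta : R).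
Hypotheses (n_gt0 : (0 < #|V|)%N) (sf : submodular f) (f0 : f set0 = 0).
Hypothesis delta_gt0 : 0 < delta.
Implicit Types (s : state R).
Local Notation n := (dim V).
Local Notation K := (svn_bound V).
Local Notation T := (nb_phases n delta).
Local Notation L := (max_l1 R f).
Local Notation "'tri' p s c q P" := (tri f p s c%N q%N P)
  (at level 10, p, s, c, q, P at level 9).

Lemma max_l1_ge0 (mu : R) g : vertex f mu g -> 0 <= L.
Proof.
move=> /(vertex_unshift sf f0 n_gt0)[h _ /l1_le_max]; apply: le_trans.
exact: sumr_ge0.
Qed.

(** Hadamard's inequality turns the growth of the determinant into a large
    diagonal entry. *)
Lemma thin_direction ws Q (A : V -> V -> R) (b : R) : rescalings ws Q A -> size ws = T -> 0 <= b ->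
  (forall v, A v v <= b ^+ 2) -> 2 <= b /\ 8 * (n%:R / delta) <= b.
Proof.
move=> run szT b0 hb; have [sA pA _ dA] := rescalings_inv n_gt0 run.
have n0 : (0 < n)%N by exact: dim_gt0.
set m := Num.max 2 (n%:R / delta); have m2 : 2 <= m by rewrite le_max lexx.
have mn : n%:R / delta <= m by rewrite le_max lexx orbT.
have m4b : m ^+ 4 <= b.
  have : (m ^+ 8) ^+ n <= (b ^+ 2) ^+ n.
    rewrite -exprM; apply: le_trans (nb_phases_growth delta n0) _.
    rewrite -szT; apply: le_trans dA _; case/andP: (hadamardV sA pA) => _.
    move/le_trans; apply; rewrite /dim -[X in _ <= X]prodr_const.
    by apply: ler_prod => v _; rewrite hb ltW // diag_gt0.
  rewrite ler_pXn2r ?nnegrE ?exprn_ge0 ?sqr_ge0 //; try lra.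
  by rewrite -[8%N]/(4 * 2)%N exprM ler_pXn2r ?nnegrE ?exprn_ge0 //; lra.
have m3 : 8 <= m ^+ 3.
  have -> : 8 = 2 ^+ 3 :> R by rewrite -natrX.
  by rewrite lerXn2r ?nnegrE //; lra.
have m4 : 8 * m <= m ^+ 4 by rewrite exprSr ler_wpM2r //; lra.
by split; lra.
Qed.

Lemma tri_weights s out m ws : rsfm_final f T s out m ws ->
  tri (weights out) s (T * (4 * (K * K))) 0 (fun l s' => exists ts,
    [/\ has_terms s' l ts, (size ts <= 2 * (T * K))%N,
        forall t, t \in ts -> 0 <= t.2 /\ vertex f m t.1,
        0 < \sum_(t <- ts) t.2 &
        forall v, `|(\sum_(t <- ts) t.2 *: t.1) v| <=
                  (\sum_(t <- ts) t.2) * (delta * L / n%:R)]).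
Proof.
move=> [[WE szT] hph ok hfin]; have [n1 nn nK] := bound_ge n_gt0.
have nr : 0 < n%:R :> R by rewrite ltr0n.
have KK : (100 * K <= K * K)%N by rewrite leq_mul2r; lia.
have T1 : (0 < T)%N by [].
have [w [ws' wsE]] : exists w ws', ws = rcons ws' w.
  case: hfin => [[Q [A [_ sz _ _]]]|[ws' [Q [ts [-> _ _ _]]]]]; last first.
    by exists (Q, ts, 0), ws'.
  by case/lastP: ws sz {WE szT hph ok} => [//|ws' w] _; exists w, ws'.
move: hph; rewrite wsE => hph; have [phs [p [phE hphs hp]]] := rel2_rconsP hph.
have [_ [szw vw]] : all_prop (phase_ok f m) ws' /\ phase_ok f m w.
  by apply: all_prop_rconsP; rewrite -wsE.
rewrite /weights phE rev_rcons.
have [hQ hts hy] := hp.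
apply: tri_cost; first apply: tri_seq (tri_is_zero f hy) _.
- move=> z s1 e1 ->; have hts1 := terms_ext e1 hts; carry e1.
  have hph1 : rel2 (has_phase s1) (rcons phs p) (rcons ws' w).
    by apply: (phases_ext e1); apply: rel2_rcons.
  have [w0|w0] := eqVneq w.2 0; last first.
    case: hfin => [[Q [A [run sz hQf hAf]]]|[us [Q [ts [E _ _ _]]]]]; last first.
      by move: w0; move: E; rewrite wsE => /rcons_inj[_ ->]; rewrite eqxx.
    have hQ1 := mat_ext e1 hQf; have hA1 := mat_ext e1 hAf.
    rewrite -wsE in hph1; rewrite -rev_rcons.
    apply: tri_imp (tri_thin_weights n_gt0 run hQ1 hA1 hph1 ok szT) (leqnn _) (leqnn _) _.
    move=> l s2 _ [b [u [v0 [ts1 [ts2 [[hl sz2] hts12 [b0 uE hb] q1 q2]]]]]].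
    have [b2 bn] := thin_direction run sz b0 hb.
    have [short heavy] : (forall v, `|(\sum_(t <- ts1 ++ ts2) t.2 *: t.1) v| <= 2 * b) /\
        b ^+ 2 <= 4 * L * \sum_(t <- ts1 ++ ts2) t.2.
      apply: (thin_combination b2 uE) => // t ti; split; first by case: (hts12 t ti).
      by apply: vertex_coord WE => //; case: (hts12 t ti).
    exists (ts1 ++ ts2); move: short heavy; set D := \sum_(t <- _) t.2 => short heavy.
    have D0 : 0 <= D.
      by rewrite /D big_seq; apply: sumr_ge0 => t ti; case: (hts12 t ti).
    have b20 : 0 < b ^+ 2 by rewrite exprn_gt0 //; lra.
    split=> //.
      rewrite lt_neqAle D0 andbT eq_sym; apply: contraTneq heavy => ->.
      by rewrite mulr0 -ltNge.
    move=> v; apply: le_trans (short v) _.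
    rewrite mulrA ler_pdivlMr // mulrCA.
    have dn : 8 * n%:R <= b * delta by rewrite -ler_pdivrMr // -mulrA.
    rewrite -(ler_pM2r (_ : 0 < b)); last lra.
    have h1 : 2 * b * n%:R * b = b ^+ 2 * (2 * n%:R) by ring.
    have h2 : b ^+ 2 * (2 * n%:R) <= 4 * L * D * (2 * n%:R) by rewrite ler_wpM2r //; lra.
    have LD : 0 <= L * D.
      have : 0 < 4 * L * D by apply: lt_le_trans heavy.
      lra.
    have h3 : L * D * (8 * n%:R) <= L * D * (b * delta) by rewrite ler_wpM2l.
    by rewrite h1; lra.
  have [Q [ts [wE sQ pQ vn]]] : exists Q ts, [/\ w = (Q, ts, 0), sym Q, posdef Q &
      vn_state Q ts 0].
    case: hfin => [[Q [A [run _ _ _]]]|[us [Q [ts [E sQ pQ vn]]]]]; last first.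
      by exists Q, ts; move: E; rewrite wsE => /rcons_inj[_ ->].
    by have := rescalings_last (_ : rescalings (rcons ws' w) Q A); rewrite -wsE w0 eqxx => /(_ run).
  rewrite wE /= in hQ hts1 szw vw.
  apply: (@tri_cost _ _ _ _ _ _ (K * K)%N 0); last by [].
    apply: tri_imp (tri_exact_weights f n_gt0 hQ hts1 szw) _ _ _ => //.
    move=> l s2 _ hl; have [h1 h2 h3] := exact_weightP pQ vn.
    exists [seq (t.1, exact_weight Q t) | t <- ts]; rewrite !big_map size_map; split=> //.
    + by apply: leq_trans szw _; rewrite mul2n -addnn; have : (K <= T * K)%N by [rewrite leq_pmull]; lia.
    + by move=> t /mapP[t' ti ->] /=; split; [exact: h1|exact: vw].
    + move=> v; rewrite h2 ffunE normr0 mulr_ge0 ?(ltW h3) //.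
      rewrite divr_ge0 ?ler0n // mulr_ge0 ?(ltW delta_gt0) //.
      case: vn => _ t1 _ _ _; case: ts t1 vw {hts1 h1 h2 h3 wE szw hl} => [|t ts] t1 vw.
        by move/eqP: t1; rewrite big_nil eq_sym oner_eq0.
      exact: max_l1_ge0 (vw t (mem_head _ _)).
  have : (K * K <= T * (K * K))%N by rewrite leq_pmull.
  by rewrite mulnCA; lia.
- have : (K * K <= T * (K * K))%N by rewrite leq_pmull.
  have -> : (T * (2 * (K * K)) = 2 * (T * (K * K)))%N by lia.
  have -> : (T * (4 * (K * K)) = 4 * (T * (K * K)))%N by lia.
  lia.
- by lia.
Qed.

Lemma tri_certificate s out m ws : rsfm_final f T s out m ws ->
  tri (certificate out) s (T * (5 * (K * K)) + K * K) (K * n) (fun c s' =>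
    exists us : seq ({ffun V -> R} * {ffun V -> R} * R),
    [/\ forall u, u \in us ->
          [/\ 0 <= u.2, unshifted f m u.1.1 u.1.2 & extreme_base f u.1.2],
        \sum_(u <- us) u.2 = 1 /\ (size us <= n)%N,
        \sum_v `|(\sum_(u <- us) u.2 *: u.1.1) v| <= delta * L,
        has_vec s' (comb_point c) (\sum_(u <- us) u.2 *: u.1.2) &
        rel2 (has_base s') (comb_terms c) us]).
Proof.
move=> hfin; have [n1 nn nK] := bound_ge n_gt0.
have nr : 0 < n%:R :> R by rewrite ltr0n.
apply: (@tri_cost _ _ _ _ _ _
  (T * (4 * (K * K)) + (2 * (T * K) * (30 * (n * n)) + n * n + 1 + 30 * (n * n * (n * n))))%N
  (0 + (0 + 4 * (n * n * n)))%N).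
- apply: tri_seq (tri_weights hfin) _ => l s1 e1 [ts [hl sz hts D0 short]].
  apply: tri_seq.
    apply: tri_cost (tri_reduce f n_gt0 hl _) _ _; [| |exact: leqnn].
      by move=> t /hts[t0 /vertex_sum h].
    by rewrite !leq_add2r (rel2_size hl) leq_mul2r sz orbT.
  move=> l' s2 e2 [ts' [hl' sz' hts' massE sumE]].
  have vts' t : t \in ts' -> vertex f m t.1.
    by move=> /hts'[_ [t0 /hts[_ h] <-]].
  apply: tri_imp (tri_to_bases n_gt0 sf f0 hl' sz' vts') (leqnn _) (leqnn _) _.
  move=> c s3 _ [us [usE hus hpt hterms]]; exists us; rewrite massE in usE.
  set D := \sum_(t <- ts) t.2 in D0 short massE usE.
  have mapE (A : nmodType) (F : {ffun V -> R} * R -> A) :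
      \sum_(u <- us) F (u.1.1, u.2) = \sum_(t <- ts') F (t.1, t.2 / D).
    by have := congr1 (fun k => \sum_(w <- k) F w) usE; rewrite !big_map.
  split=> //.
  + move=> u ui; have [h1 h2] := hus u ui; split=> //.
    have : (u.1.1, u.2) \in [seq (w.1, w.2 / D) | w <- ts'].
      by rewrite -usE; apply/mapP; exists u.
    by move=> /mapP[t /hts'[t0 _] [_ ->]]; rewrite divr_ge0 // ltW.
  + split; last by rewrite -(size_map (fun u => (u.1.1, u.2))) usE size_map.
    by rewrite (mapE _ snd) -mulr_suml massE divff ?gt_eqF.
  + rewrite (mapE _ (fun w => w.2 *: w.1)).
    have -> : \sum_(t <- ts') (t.2 / D) *: t.1 = D^-1 *: \sum_(t <- ts) t.2 *: t.1.
      by rewrite -sumE scaler_sumr; apply: eq_bigr => t _; rewrite scalerA mulrC.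
    apply: (@le_trans _ _ (\sum_(v : V) delta * L / n%:R)).
      apply: ler_sum => v _; rewrite ffunE normrM gtr0_norm ?invr_gt0 //.
      by rewrite mulrC ler_pdivrMr // mulrC.
    by rewrite sumr_const -[#|_|]/n -[_ *+ _]mulr_natr divfK // gt_eqF.
- have h1 : (K * (100 * (n * n)) <= K * K)%N by rewrite leq_mul2l nK orbT.
  have h2 : (T * (K * (100 * (n * n))) <= T * (K * K))%N by rewrite leq_mul2l h1 orbT.
  have h3 : (100 * (n * n) * (100 * (n * n)) <= K * K)%N by rewrite leq_mul.
  have h4 : (n * n <= n * n * (n * n))%N by rewrite leq_pmulr // muln_gt0 n1.
  nia.
- have : (n * (100 * (n * n)) <= n * K)%N by rewrite leq_mul2l nK orbT.
  by lia.
Qed.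

Lemma base_convex (us : seq ({ffun V -> R} * {ffun V -> R} * R)) :
  (forall u, u \in us -> 0 <= u.2 /\ base_polytope R f u.1.2) ->
  \sum_(u <- us) u.2 = 1 -> base_polytope R f (\sum_(u <- us) u.2 *: u.1.2).
Proof.
move=> hus us1.
have sumS (P : pred V) : \sum_(v | P v) (\sum_(u <- us) u.2 *: u.1.2) v =
    \sum_(u <- us) u.2 * \sum_(v | P v) u.1.2 v.
  under eq_bigr => v _ do rewrite sum_ffunE.
  rewrite exchange_big; apply: eq_bigr => u _; rewrite mulr_sumr.
  by apply: eq_bigr => v _; rewrite ffunE.
have mass (c : R) : c = \sum_(u <- us) u.2 * c by rewrite -mulr_suml us1 mul1r.
split=> [S|]; rewrite sumS.
  rewrite [X in _ <= X]mass [X in X <= _]big_seq [X in _ <= X]big_seq.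
  by apply: ler_sum => u /hus[u0 [hS _]]; rewrite ler_wpM2l // hS.
rewrite [RHS]mass big_seq [RHS]big_seq.
by apply: eq_bigr => u /hus[_ [_ ->]].
Qed.

End Final.

(** Two factors come from the square of the bound 400 n^2 on the number of steps of
    a phase, the third from 10 such squares for each of at most 40 n log phases. *)
Definition time_constant (R : realType) : R := 400 * 400 * 400.

Theorem theorem3p14 (R : realType) :
  exists (C : R) (T : nat -> R -> nat)
         (post : forall V : finType,
            addr -> rsfm_state V -> prog V (combination V)),
    (forall (n : nat) (delta : R), (0 < n)%N -> 0 < delta ->
       (T n delta)%:R <= C * n%:R * safe_log (n%:R / delta)) /\
    forall (V : finType) (f : {set V} -> int) (delta EO : R),
      let n := #|V| in
      (0 < n)%N -> submodular f -> f set0 = 0 -> 0 < delta -> 0 <= EO ->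
      wp f (out <- rescaling_sfm V (T n delta);;
            comb <- post V 0%N out;;
            Ret (out, comb))%prog
         (State [:: delta] 0 0)
         (fun res s =>
            let W := out_W res.1 in
            let y := vec_at s (comb_point res.2) in
            [/\ is_base_combination f s res.2,
                (size (comb_terms res.2))%:R <= C * n%:R,
                (f W)%:~R <= neg_part y [set: V] + delta * max_l1 R f,
                (forall S : {set V}, (f W)%:~R <= (f S)%:~R + delta * max_l1 R f) &
                time EO s <=
                  C * (n%:R ^+ 4 * EO + n%:R ^+ 5) * safe_log (n%:R / delta)]).
Proof.
have C1 : 1 <= time_constant R by rewrite /time_constant; lra.
exists (time_constant R), (@nb_phases R), (fun V _ out => certificate out).
split=> [n delta n0 d0|V f delta EO n n0 sf f0 d0 EO0].
  apply: le_trans (nb_phases_le delta n0) _.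
  have : 0 <= n%:R * safe_log (n%:R / delta).
    by rewrite mulr_ge0 ?ler0n // (le_trans _ (safe_log_ge _)).
  move=> h; rewrite -!(mulrA _ n%:R) ler_wpM2r //.
  by rewrite /time_constant; lra.
set T := nb_phases n delta; set s0 := State _ _ _.
have [n1 nn nK] := bound_ge n0; set K := svn_bound V in nK.
have h : tri f (out <- rescaling_sfm V T;; comb <- certificate out;; Ret (out, comb))%prog s0
    (T.+1 * (10 * (K * K)))%N (T.+1 * (8 * (K * dim V)))%N (fun res s =>
      let W := out_W res.1 in
      let y := vec_at s (comb_point res.2) in
      [/\ is_base_combination f s res.2,
          (size (comb_terms res.2) <= n)%N &
          (f W)%:~R <= neg_part y [set: V] + delta * max_l1 R f]).
  apply: tri_cost; first apply: tri_seq (tri_rescaling_sfm n0 f0 T s0) _.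
  - move=> out s1 e1 [m [ws hfin]].
    have [[WE _] _ _ _] := hfin.
    apply: tri_bind_ret; apply: tri_imp (tri_certificate n0 sf f0 d0 hfin) (leqnn _) (leqnn _) _.
    move=> c s2 _ [us [hus [us1 szus] hE hpt hterms]] /=.
    have ptE : vec_at s2 (comb_point c) = \sum_(u <- us) u.2 *: u.1.2.
      by apply/ffunP=> v; rewrite ffunE; case: (hpt v).
    have termE (t : addr * vec V) (u : {ffun V -> R} * {ffun V -> R} * R) :
        has_base s2 t u -> val_at s2 t.1 = u.2 /\ vec_at s2 t.2 = u.1.2.
      move=> [[_ ->] hv]; split=> //; apply/ffunP=> v; rewrite ffunE.
      by case: (hv v).
    have hbase u : u \in us -> 0 <= u.2 /\ base_polytope R f u.1.2.
      by move=> /hus[u0 _ [hb _]].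
    split.
    + split.
      * by rewrite ptE; apply: base_convex.
      * apply: (@rel2_tnth _ _ _ (fun t => 0 <= val_at s2 t.1 /\ extreme_base f (vec_at s2 t.2))
          _ _ (rel2_and hterms hus)).
        by move=> t u [/termE[-> ->] [u0 _ ub]].
      * by rewrite -us1; apply: (rel2_sum hterms) => t u /termE[].
      * rewrite ptE; apply/esym; apply: (rel2_sum hterms) => t u /termE[-> ->] //.
    + by rewrite (rel2_size hterms).
    + rewrite ptE -[(f (out_W out))%:~R]/(toR R f _) WE.
      apply: (neg_part_combination _ us1 hE) => u ui.
      by have [u0 uu _] := hus u ui; split; [exact: u0|exact: uu].
  - rewrite -[nb_phases (dim V) delta]/T -/K; move: (T) (K * K)%N => t k; lia.
  - rewrite -/K; move: (T) (K * dim V)%N => t k; lia.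
apply: wp_mono h => -[out c] s [_ hops hqueries [hcomb hsz hW]] /=; split=> //.
- by rewrite (le_trans (_ : _ <= n%:R)) ?ler_nat // ler_peMl // ler0n.
- move=> S; apply: le_trans hW _; rewrite lerD2r.
  by case: hcomb => hb _ _ _; apply: neg_part_le.
set l := safe_log _; have l0 : 1 / 2 <= l by exact: safe_log_ge.
have nr : 1 <= n%:R :> R by rewrite ler1n.
have hT : (T.+1)%:R <= 40 * (n%:R * l).
  have := nb_phases_le delta n0; rewrite -/T -/l -natr1.
  have : 1 <= 2 * (n%:R * l).
    by have : 1 * (1 / 2) <= n%:R * l by [rewrite ler_pM //; lra]; lra.
  lra.
have KE : K%:R = 400 * (n%:R * n%:R) :> R by rewrite /K /svn_bound /dim !natrM.
have t0 : 0 <= (T.+1)%:R :> R by rewrite ler0n.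
have o1 : (ops s)%:R <= (T.+1)%:R * (10 * (400 * 400)) * n%:R ^+ 4 :> R.
  have -> : (T.+1)%:R * (10 * (400 * 400)) * n%:R ^+ 4 =
      (T.+1 * (10 * (K * K)))%N%:R :> R.
    by rewrite natrM (natrM _ 10) (natrM _ K) KE; ring.
  by rewrite ler_nat.
have q1 : (queries s)%:R <= (T.+1)%:R * (8 * 400) * n%:R ^+ 3 :> R.
  have -> : (T.+1)%:R * (8 * 400) * n%:R ^+ 3 =
      (T.+1 * (8 * (K * dim V)))%N%:R :> R.
    by rewrite natrM (natrM _ 8) (natrM _ K) KE /dim; ring.
  by rewrite ler_nat.
have n30 : 0 <= n%:R ^+ 3 :> R by rewrite exprn_ge0 ?ler0n.
have n40 : 0 <= n%:R ^+ 4 :> R by rewrite exprn_ge0 ?ler0n.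
have o2 : (ops s)%:R <= time_constant R * n%:R ^+ 5 * l.
  apply: le_trans o1 _.
  have -> : time_constant R * n%:R ^+ 5 * l =
      40 * (n%:R * l) * (10 * (400 * 400)) * n%:R ^+ 4 by rewrite /time_constant; ring.
  by rewrite ler_wpM2r // ler_wpM2r //; lra.
have q2 : (queries s)%:R <= time_constant R * n%:R ^+ 4 * l.
  apply: le_trans q1 _; apply: (@le_trans _ _ (40 * (n%:R * l) * (8 * 400) * n%:R ^+ 3)).
    by rewrite ler_wpM2r // ler_wpM2r //; lra.
  have -> : 40 * (n%:R * l) * (8 * 400) * n%:R ^+ 3 = 40 * 8 * 400 * (n%:R ^+ 4 * l) by ring.
  have : 0 <= n%:R ^+ 4 * l by rewrite mulr_ge0 //; lra.
  by rewrite /time_constant; lra.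
have : EO * (queries s)%:R <= EO * (time_constant R * n%:R ^+ 4 * l) by rewrite ler_wpM2l.
by rewrite /time; lra.
Qed.
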